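(* Let $\lambda_1,\lambda_2>0$. There exists a real constant $\Lambda>0$ such that for every $\beta>\Lambda$ the system $$ \begin{cases} -u''+\lambda_1 u = u^3+\beta uv,\\ -v''+\lambda_2 v = \tfrac12 v^2+\tfrac12\beta u^2, \end{cases} \qquad x\in\mathbb{R}, $$ has a positive even ground state $\tilde{\mathbf u}=(\tilde u,\tilde v)$, i.e. a ground state with $\tilde u>0$, $\tilde v>0$ on $\mathbb{R}$ and both $\tilde u,\tilde v$ even functions.
   Context: $E=W^{1,2}(\mathbb{R})$ (real-valued functions), $\mathbb{E}=E\times E$, with elements $\mathbf u=(u,v)$ and $\mathbf 0=(0,0)$. For $j=1,2$, $\|u\|_j^2=\int_{\mathbb{R}}(|u'|^2+\lambda_j u^2)\,dx$, and $\|\mathbf u\|^2=\|u\|_1^2+\|v\|_2^2$. The energy functional $\Phi:\mathbb{E}\to\mathbb{R}$ associated with the system is $$\Phi(\mathbf u)=\tfrac12\|u\|_1^2-\tfrac14\int_{\mathbb{R}}u^4\,dx+\tfrac12\|v\|_2^2-\tfrac16\int_{\mathbb{R}}v^3\,dx-\tfrac12\beta\int_{\mathbb{R}}u^2v\,dx .$$ A non-trivial bound state of the system is a critical point $\mathbf u\in\mathbb{E}\setminus\{\mathbf 0\}$ of $\Phi$. A ground state is a non-trivial bound state $\tilde{\mathbf u}$ of minimal energy among all non-trivial bound states: $$\Phi(\tilde{\mathbf u})=\min\{\Phi(\mathbf u):\mathbf u\in\mathbb{E}\setminus\{\mathbf 0\},\ \Phi'(\mathbf u)=0\}.$$ *)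

(* Defs.v *)
From HB Require Import structures.
From mathcomp Require Import all_boot all_order all_algebra.
From mathcomp Require Import all_classical all_reals all_analysis.

Set Implicit Arguments.
Unset Strict Implicit.
Unset Printing Implicit Defensive.

Import Order.TTheory GRing.Theory Num.Theory.
Import numFieldNormedType.Exports.

Local Open Scope classical_set_scope.
Local Open Scope ring_scope.

Notation leb R := (@lebesgue_measure R).

Definition test_function (R : realType) (phi : R -> R) : Prop :=
  (forall (n : nat) (x : R), derivable (phi^`(n)%classic) x 1) /\
  compact (closure [set x | phi x != 0]).

Definition weak_derivative (R : realType) (u g : R -> R) : Prop :=
  forall phi : R -> R, test_function phi ->
    \int[leb R]_x (u x * phi^`()%classic x) = - \int[leb R]_x (g x * phi x).

(* Elements of W^{1,2}(R) are represented by functions R -> R; two functions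
   that agree almost everywhere represent the same element. *)
Definition W12 (R : realType) (u : R -> R) : Prop :=
  u \in Lfun (leb R) 2%:E /\
  exists g : R -> R, g \in Lfun (leb R) 2%:E /\ weak_derivative u g.

(* A chosen representative of the weak derivative, which is unique up to almost
   everywhere equality; the value is irrelevant when u is not in W12. *)
Definition wderiv (R : realType) (u : R -> R) : R -> R :=
  xget (fun=> 0) [set g | g \in Lfun (leb R) 2%:E /\ weak_derivative u g].

Definition EE (R : realType) (w : (R -> R) * (R -> R)) : Prop :=
  W12 w.1 /\ W12 w.2.

(* w represents the zero element of EE. *)
Definition EE_zero (R : realType) (w : (R -> R) * (R -> R)) : Prop :=
  w.1 = (fun=> 0) %[ae leb R] /\ w.2 = (fun=> 0) %[ae leb R].

Definition sqnorm (R : realType) (lambda : R) (u : R -> R) : R :=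
  \int[leb R]_x (wderiv u x ^+ 2 + lambda * u x ^+ 2).

Definition EE_norm (R : realType) (lambda1 lambda2 : R)
    (w : (R -> R) * (R -> R)) : R :=
  Num.sqrt (sqnorm lambda1 w.1 + sqnorm lambda2 w.2).

Definition Phi (R : realType) (lambda1 lambda2 beta : R)
    (w : (R -> R) * (R -> R)) : R :=
  2^-1 * sqnorm lambda1 w.1 - 4^-1 * (\int[leb R]_x (w.1 x ^+ 4))
  + 2^-1 * sqnorm lambda2 w.2 - 6^-1 * (\int[leb R]_x (w.2 x ^+ 3))
  - 2^-1 * beta * (\int[leb R]_x (w.1 x ^+ 2 * w.2 x)).

(* The Frechet derivative of Phi at w on the normed space EE exists and is 0.
   Testing Phi'(w) = 0 against (f, g) in EE gives the weak form of
     - u'' + lambda1 u = u^3 + beta u v,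
     - v'' + lambda2 v = v^2 / 2 + beta u^2 / 2. *)
Definition critical_point (R : realType) (lambda1 lambda2 beta : R)
    (w : (R -> R) * (R -> R)) : Prop :=
  forall e : R, 0 < e -> exists d : R, 0 < d /\
    forall h : (R -> R) * (R -> R), EE h ->
      EE_norm lambda1 lambda2 h < d ->
      `|Phi lambda1 lambda2 beta (w + h) - Phi lambda1 lambda2 beta w|
        <= e * EE_norm lambda1 lambda2 h.

Definition nontrivial_bound_state (R : realType) (lambda1 lambda2 beta : R)
    (w : (R -> R) * (R -> R)) : Prop :=
  [/\ EE w, ~ EE_zero w & critical_point lambda1 lambda2 beta w].

Definition ground_state (R : realType) (lambda1 lambda2 beta : R)
    (w : (R -> R) * (R -> R)) : Prop :=
  nontrivial_bound_state lambda1 lambda2 beta w /\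
  forall w' : (R -> R) * (R -> R),
    nontrivial_bound_state lambda1 lambda2 beta w' ->
    Phi lambda1 lambda2 beta w <= Phi lambda1 lambda2 beta w'.

(* Main.v *)
Require Import Defs.
From mathcomp Require Import all_boot all_order all_algebra.
From mathcomp Require Import all_classical all_reals all_analysis.
From mathcomp Require Import measurable_realfun ring lra.

Set Implicit Arguments.
Unset Strict Implicit.
Unset Printing Implicit Defensive.

Import Order.TTheory GRing.Theory Num.Theory.
Import numFieldNormedType.Exports.

Local Open Scope classical_set_scope.
Local Open Scope ring_scope.

(* Put A = ||u||_1^2 + ||v||_2^2, C = int u^4, B = int (v^3/2 + 3 beta u^2 v/2) and
   Psi = A - B - C = Phi'(u,v)(u,v), so that Phi = En + Psi/3 with En = A/6 + C/12.
   Nontrivial critical points have Psi = 0, hence energy at least the infimum c of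
   En over the pairs with Psi < 0.

   To attain c, cut a near-minimizer at the supremum m of the points x such that the
   integral over [x, +oo[ of the density of Psi is negative, and reflect each side.
   The left reflection has Psi < 0, so its energy is at least c; the right one has
   Psi = 0, energy close to c, and is bounded away from zero at its center, the
   density of Psi being nonnegative wherever u and v are small. Thus a minimizing
   sequence can be taken even and non-vanishing at 0. It is uniformly bounded and
   1/2-Hoelder, so a subsequence converges pointwise to (u,v). Minimality along t
   (u_n,v_n) + s h gives in the limit the weak Euler-Lagrange equations, so (u,v) is
   a C^2 solution by du Bois-Reymond; then Psi(u,v) = 0, and lower semicontinuity
   gives En(u,v) = c.

   Passing to (|u|,|v|) keeps A and C and does not increase Psi, so it is again a
   minimizer, and the strong maximum principle makes v positive and u either
   positive or zero. The latter is impossible for large beta: every (0,v) has an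
   energy bounded below independently of beta, while a fixed pair rescaled shows
   that c tends to 0. *)

(** * Integrals of real functions *)

Section RealIntegral.
Context {R : realType}.
Local Notation mu := (@lebesgue_measure R).
Local Notation mset D := (@measurable _ (measurableTypeR R) D).
Implicit Types (f g h : R -> R) (D : set R) (a b c x y : R).

(** The obstacle is the loss of compactness under translations of the line, on top of a cubic term
    of indefinite sign. Subtracting a third of [Psi] from the energy removes exactly the cubic part:
    what is left is nonnegative, increases along rays and is suited to lower semicontinuity.
    Minimizing under the open condition Psi < 0 rather than on Psi = 0 leaves room to perturb in any
    direction without projecting back onto the constraint; scaling by 1 + s or 1 - s passes between
    the two conditions. Cutting and reflecting takes the place of a rearrangement: it pins the mass
    at the origin, so that pointwise convergence at 0 alone excludes a zero limit. Strong
    convergence of the sequence is never established: the constraint is not passed to the limit but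
    recovered from the equations solved by the limit. Since W^{1,2} consists of classes up to null
    sets while the argument is pointwise, everything runs on continuous representatives paired with
    an explicit derivative, and is linked to [Phi] and to Frechet criticality only at the end. *)

Definition itg D f : Prop := mu.-integrable D (EFin \o f).
Definition Rint D f : R := Rintegral mu D f.
Definition mble f : Prop :=
  @measurable_fun _ _ (measurableTypeR R) R setT f.

Lemma itg_mble f : itg setT f -> mble f.
Proof. by move=> /measurable_int /measurable_EFinP. Qed.

Lemma itgD D f g : mset D -> itg D f -> itg D g ->
  itg D (fun x => f x + g x).
Proof.
move=> mD hf hg; have := integrableD mD hf hg.
by apply: eq_integrable => // x _ /=; rewrite EFinD.
Qed.

Lemma itgZ D k f : mset D -> itg D f -> itg D (fun x => k * f x).
Proof.
move=> mD hf; have := integrableZl mD k hf.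
by apply: eq_integrable => // x _ /=; rewrite EFinM.
Qed.

Lemma itgN D f : mset D -> itg D f -> itg D (fun x => - f x).
Proof.
move=> mD hf; have := integrableN hf.
by apply: eq_integrable => // x _ /=; rewrite EFinN.
Qed.

Lemma itgB D f g : mset D -> itg D f -> itg D g ->
  itg D (fun x => f x - g x).
Proof.
move=> mD hf hg; have := integrableB mD hf hg.
by apply: eq_integrable => // x _ /=; rewrite EFinB.
Qed.

Lemma itgS D D' f : mset D -> mset D' -> D' `<=` D ->
  itg D f -> itg D' f.
Proof. by move=> mD mD' s hf; exact: (integrableS mD mD' s hf). Qed.

Lemma itgTS D f : mset D -> itg setT f -> itg D f.
Proof. by move=> mD; apply: itgS. Qed.

Lemma itg_le D f g : mset D -> mble f -> itg D g ->
  (forall x, D x -> `|f x| <= g x) -> itg D f.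
Proof.
move=> mD mf hg fg; apply: (le_integrable mD _ _ hg).
  by apply/measurable_EFinP; exact: measurable_funTS.
by move=> x Dx /=; rewrite lee_fin (le_trans (fg _ Dx))// ler_norm.
Qed.

Lemma itg_norm D f : mset D -> itg D f -> itg D (fun x => `|f x|).
Proof.
by move=> mD hf; exact: integrable_norm hf.
Qed.

Lemma eq_itg D f g : mset D -> (forall x, D x -> f x = g x) ->
  itg D f -> itg D g.
Proof.
move=> mD fg; apply: eq_integrable => // x; rewrite inE => Dx /=.
by rewrite fg.
Qed.

Lemma itg_cont a b f : continuous f -> itg `[a, b] f.
Proof.
move=> cf; apply: continuous_compact_integrable; first exact: segment_compact.
exact: continuous_subspaceT.
Qed.

Lemma RintD D f g : mset D -> itg D f -> itg D g ->
  Rint D (fun x => f x + g x) = Rint D f + Rint D g.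
Proof. exact: RintegralD. Qed.

Lemma RintB D f g : mset D -> itg D f -> itg D g ->
  Rint D (fun x => f x - g x) = Rint D f - Rint D g.
Proof. exact: RintegralB. Qed.

Lemma RintZ D k f : mset D -> itg D f ->
  Rint D (fun x => k * f x) = k * Rint D f.
Proof. exact: RintegralZl. Qed.

Lemma Rint_le D f g : mset D -> itg D f -> itg D g ->
  (forall x, D x -> f x <= g x) -> Rint D f <= Rint D g.
Proof. exact: le_Rintegral. Qed.

Lemma Rint_ge0 D f : (forall x, D x -> 0 <= f x) -> 0 <= Rint D f.
Proof. by move=> f0; apply: (@Rintegral_ge0 _ _ _ mu). Qed.

Lemma Rint_norm D f : mset D -> itg D f ->
  `|Rint D f| <= Rint D (fun x => `|f x|).
Proof. exact: le_normr_Rintegral. Qed.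

Lemma eq_Rint D f g : (forall x, D x -> f x = g x) -> Rint D f = Rint D g.
Proof. by move=> fg; apply: eq_Rintegral => x; rewrite inE => /fg. Qed.

Lemma RintN D f : mset D -> itg D f -> Rint D (fun x => - f x) = - Rint D f.
Proof.
move=> mD hf; rewrite -mulN1r -RintZ//; apply: eq_Rint => x _.
by rewrite mulN1r.
Qed.

Lemma Rint_cst a b k : a <= b -> Rint `[a, b] (fun=> k) = k * (b - a).
Proof.
move=> ab; rewrite /Rint Rintegral_cst//= lebesgue_measure_itv/= lte_fin.
by move: ab; rewrite le_eqVlt => /predU1P[->|->//]; rewrite ltxx subrr.
Qed.

Lemma Rint_pt a f : Rint `[a, a] f = 0.
Proof. by rewrite /Rint set_itv1 Rintegral_set1. Qed.

Lemma itg_cst a b k : itg `[a, b] (fun=> k).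
Proof. by apply: itg_cont => x; exact: cvg_cst. Qed.

Lemma Rint_split a b c f : a <= b -> b <= c -> itg `[a, c] f ->
  Rint `[a, c] f = Rint `[a, b] f + Rint `[b, c] f.
Proof.
move=> ab bc hf.
have := @Rintegral_itvB R f (BLeft a) (BRight c) b hf.
rewrite !bnd_simp ab bc => /(_ isT isT).
rewrite Rintegral_itv_obnd_cbnd => [e|].
  by rewrite /Rint -e addrC subrK.
by apply: itgS hf => //; apply: subset_itvr; rewrite bnd_simp.
Qed.

Lemma Rint_split_ray a b f : a <= b -> itg `[a, +oo[ f ->
  Rint `[a, +oo[ f = Rint `[a, b] f + Rint `[b, +oo[ f.
Proof.
move=> ab hf.
have := @Rintegral_itvB R f (BLeft a) (BInfty R false) b hf.
rewrite !bnd_simp => /(_ ab isT).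
rewrite Rintegral_itv_obnd_cbnd => [e|].
  by rewrite /Rint -e addrC subrK.
by apply: itgS hf => //; apply: subset_itvr; rewrite bnd_simp.
Qed.

Lemma Rint_splitT a f : itg setT f ->
  Rint setT f = Rint `]-oo, a] f + Rint `[a, +oo[ f.
Proof.
move=> hf.
have := @Rintegral_itvB R f (BInfty R true) (BInfty R false) a.
rewrite !bnd_simp set_itvE => /(_ hf isT isT).
rewrite Rintegral_itv_obnd_cbnd => [e|].
  by rewrite /Rint -e addrC subrK.
by apply: itgTS hf.
Qed.

Lemma Rint_sub_le D D' f : mset D -> mset D' -> D' `<=` D ->
  itg D f -> (forall x, D x -> 0 <= f x) -> Rint D' f <= Rint D f.
Proof.
move=> mD mD' s hf f0.
have hf' : itg D' f by exact: itgS hf.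
rewrite /Rint /Rintegral; apply: fine_le.
- exact: integrable_fin_num hf'.
- exact: integrable_fin_num hf.
- apply: ge0_subset_integral => //; first exact: (measurable_int mu hf).
Qed.

Lemma ae_eq_Rint f g : mble f -> mble g -> ae_eq mu setT f g ->
  Rint setT f = Rint setT g.
Proof.
move=> mf mg fg; rewrite /Rint /Rintegral; congr fine.
apply: ae_eq_integral => //; [exact/measurable_EFinP|exact/measurable_EFinP|].
by apply: filterS fg => x /= h _; rewrite h.
Qed.

Lemma ae_eq_itg f g : mble f -> mble g -> ae_eq mu setT f g ->
  itg setT f -> itg setT g.
Proof.
move=> mf mg fg /integrableP[_ hf]; apply/integrableP; split.
  exact/measurable_EFinP.
move: hf; congr (_ < _)%E; apply: ae_eq_integral => //.
- by apply: measurableT_comp => //; exact/measurable_EFinP.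
- by apply: measurableT_comp => //; exact/measurable_EFinP.
by apply: filterS fg => x /= h _; rewrite h.
Qed.

Lemma cont_mble f : continuous f -> mble f.
Proof. exact: continuous_measurable_fun. Qed.

Lemma Rint_dom D (f_ : nat -> R -> R) f g : mset D ->
  (forall n, mble (f_ n)) -> mble f -> itg D g ->
  (forall x, D x -> f_ ^~ x @ \oo --> f x) ->
  (forall n x, D x -> `|f_ n x| <= g x) ->
  Rint D (f_ n) @[n --> \oo] --> Rint D f.
Proof.
move=> mD mf_ mf hg cv dm.
have := @dominated_convergence _ (measurableTypeR R) R mu D mD
  (fun n => EFin \o f_ n) (EFin \o f) (EFin \o g).
case=> //.
- by move=> n; apply/measurable_EFinP; exact: (measurable_funTS (mf_ n)).
- by apply/measurable_EFinP; exact: measurable_funTS.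
- apply: aeW => x /= Dx.
  apply: cvg_EFin.
    exact: nearW.
  exact: cv.
- by apply: aeW => x /= Dx n; rewrite lee_fin; exact: dm.
move=> hf _ h.
have h' : (\int[mu]_(x in D) (EFin \o f_ n) x)%E @[n --> \oo] -->
    (fine (\int[mu]_(x in D) (EFin \o f) x)%E)%:E.
  by rewrite fineK//; exact: integrable_fin_num hf.
by have /fine_cvgP[] := h'.
Qed.

Lemma Rint_cvg_itv f : itg setT f ->
  Rint `[- n%:R, n%:R] f @[n --> \oo] --> Rint setT f.
Proof.
move=> hf.
have mf := itg_mble hf.
have e n : Rint `[- n%:R, n%:R] f = Rint setT (f \_ `[- n%:R, n%:R]).
  by rewrite /Rint Rintegral_mkcond.
rewrite (_ : (fun n => _) = (fun n => Rint setT (f \_ `[- n%:R, n%:R]))); last first.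
  by apply/funext => n; rewrite e.
apply: (@Rint_dom setT _ _ (fun x => `|f x|)) => //.
- move=> n; rewrite /mble -(setTI `[- n%:R, n%:R]%classic).
  apply/(measurable_restrict f) => //; rewrite ?setTI//.
  exact: measurable_funTS.
- exact: itg_norm.
- move=> x _.
  apply: (@cvg_near_cst _ _ (f x)).
  near=> n; rewrite /patch mem_set//= in_itv/= -ler_norml.
  by near: n; exact: nbhs_infty_ger.
- by move=> n x _; rewrite /patch; case: ifP => //; rewrite normr0.
Unshelve. all: by end_near. Qed.

End RealIntegral.

(** * Absolutely continuous functions *)

Section AbsCont.
Context {R : realType}.
Local Notation mset D := (@measurable _ (measurableTypeR R) D).
Implicit Types (u g p q f h : R -> R) (D : set R) (a b c x y : R).

Lemma contX n f : continuous f -> continuous (fun x => f x ^+ n).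
Proof.
move=> cf x; apply: (@continuous_comp _ _ _ f (fun y : R => y ^+ n)); first exact: cf.
exact: exprn_continuous.
Qed.

Lemma contD f g : continuous f -> continuous g -> continuous (fun x => f x + g x).
Proof. by move=> cf cg x; apply: continuousD; [exact: cf|exact: cg]. Qed.

Lemma contB f g : continuous f -> continuous g -> continuous (fun x => f x - g x).
Proof. by move=> cf cg x; apply: continuousB; [exact: cf|exact: cg]. Qed.

Lemma contM f g : continuous f -> continuous g -> continuous (fun x => f x * g x).
Proof. by move=> cf cg x; apply: continuousM; [exact: cf|exact: cg]. Qed.

Lemma contZ c f : continuous f -> continuous (fun x => c * f x).
Proof. by move=> cf; apply: contM => //; move=> x; exact: cvg_cst. Qed.

Lemma mbleD f g : mble f -> mble g -> mble (fun x => f x + g x).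
Proof. exact: measurable_funD. Qed.

Lemma mbleB f g : mble f -> mble g -> mble (fun x => f x - g x).
Proof. exact: measurable_funB. Qed.

Lemma mbleM f g : mble f -> mble g -> mble (fun x => f x * g x).
Proof. exact: measurable_funM. Qed.

Lemma mbleX f n : mble f -> mble (fun x => f x ^+ n).
Proof. exact: measurable_funX. Qed.

Lemma mble_cst c : mble (fun=> c : R).
Proof. exact: measurable_cst. Qed.

Lemma mbleZ c f : mble f -> mble (fun x => c * f x).
Proof. by move=> hf; apply: mbleM => //; exact: mble_cst. Qed.

Lemma mbleN f : mble f -> mble (fun x => - f x).
Proof.
move=> hf; rewrite (_ : (fun x => - f x) = (fun x => (-1) * f x)).
  exact: mbleZ.
by apply/funext => x; rewrite mulN1r.
Qed.

Lemma mble_norm f : mble f -> mble (fun x => `|f x|).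
Proof. by move=> hf; apply: measurableT_comp hf. Qed.

Lemma itg_sq D g : mset D -> mble g -> itg D (fun=> 1) ->
  itg D (fun x => g x ^+ 2) -> itg D g.
Proof.
move=> mD mg h1 hg.
apply: (itg_le mD mg (itgD mD h1 hg)) => x _.
rewrite -real_normK ?num_real//.
have := sqr_ge0 (`|g x| - 1); nra.
Qed.

Lemma itg_sq_itv a b g : mble g -> itg `[a, b] (fun x => g x ^+ 2) ->
  itg `[a, b] g.
Proof. by move=> mg; apply: itg_sq => //; exact: itg_cst. Qed.

Lemma itg_mul D f g : mset D -> mble f -> mble g ->
  itg D (fun x => f x ^+ 2) -> itg D (fun x => g x ^+ 2) ->
  itg D (fun x => f x * g x).
Proof.
move=> mD mf mg hf hg.
apply: (itg_le mD (mbleM mf mg) (itgD mD hf hg)) => x _.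
rewrite normrM -[f x ^+ 2]real_normK ?num_real// -[g x ^+ 2]real_normK ?num_real//.
have := sqr_ge0 (`|f x| - `|g x|); have := normr_ge0 (f x); have := normr_ge0 (g x).
nra.
Qed.

Lemma itg_bddM D f g c : mset D -> mble f -> mble g ->
  (forall x, `|f x| <= c) -> itg D g -> itg D (fun x => f x * g x).
Proof.
move=> mD mf mg fc hg.
apply: (itg_le mD (mbleM mf mg) (itgZ c mD (itg_norm mD hg))) => x _.
by rewrite normrM ler_wpM2r.
Qed.

(** Expands the nonnegative integral of (|g| - c)^2, where c is the mean of |g| over the
    interval. *)
Lemma Rint_CS a b g : a <= b -> mble g -> itg `[a, b] (fun x => g x ^+ 2) ->
  Rint `[a, b] (fun x => `|g x|) ^+ 2 <= (b - a) * Rint `[a, b] (fun x => g x ^+ 2).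
Proof.
rewrite (le_eqVlt a b) => /predU1P[<- _ _|ab mg hg].
  by rewrite !Rint_pt subrr mul0r expr0n.
have ba : 0 < b - a by rewrite subr_gt0.
set G := Rint _ (fun x => `|g x|).
have hg1 : itg `[a, b] (fun x => `|g x|).
  by apply: itg_norm => //; exact: itg_sq_itv.
pose c := G / (b - a).
have : 0 <= Rint `[a, b] (fun x => (g x ^+ 2 - 2 * c * `|g x|) + c ^+ 2).
  apply: Rint_ge0 => x _; rewrite -[g x ^+ 2]real_normK ?num_real//.
  by have := sqr_ge0 (`|g x| - c); nra.
rewrite RintD//; first last.
- exact: itg_cst.
- by apply: itgB => //; exact: itgZ.
rewrite RintB//; last exact: itgZ.
rewrite RintZ// (Rint_cst _ (ltW ab)) -/G.
have -> : c ^+ 2 * (b - a) = G ^+ 2 / (b - a).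
  by rewrite /c; field; rewrite gt_eqF.
have -> : 2 * c * G = 2 * (G ^+ 2 / (b - a)) by rewrite /c; ring.
have -> : forall s t : R, s - 2 * t + t = s - t by move=> s t; ring.
by rewrite subr_ge0 ler_pdivrMr// mulrC.
Qed.

(** Local W^{1,2}, encoded by increments: [u] is a primitive of a given locally square integrable
    [g]. Almost everywhere differentiability is never invoked, and [u] comes out continuous. *)
Record AC u g : Prop := MkAC {
  ac_mble : mble g ;
  ac_sq : forall a b, itg `[a, b] (fun x => g x ^+ 2) ;
  ac_ftc : forall a b, a <= b -> u b - u a = Rint `[a, b] g }.

Record H1 u g : Prop := MkH1 {
  h1_ac : AC u g ;
  h1_fun : itg setT (fun x => u x ^+ 2) ;
  h1_der : itg setT (fun x => g x ^+ 2) }.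

Lemma ac_itg u g a b : AC u g -> itg `[a, b] g.
Proof. by move=> h; apply: itg_sq_itv; [exact: ac_mble h|exact: ac_sq h _ _]. Qed.

Lemma ac_osc u g a b x y : AC u g -> a <= x -> x <= y -> y <= b ->
  `|u y - u x| <= Rint `[a, b] (fun z => `|g z|).
Proof.
move=> h ax xy yb; rewrite (ac_ftc h)//.
apply: le_trans (Rint_norm _ (ac_itg _ _ h)) _ => //.
apply: Rint_sub_le => //.
- by apply: subset_itv; rewrite bnd_simp.
- by apply: itg_norm => //; exact: ac_itg h.
Qed.

(** Cauchy-Schwarz turns a bound on the integral of g^2 into 1/2-Hoelder continuity, the
    equicontinuity from which limits are later extracted. *)
Lemma ac_osc_sq u g a b x y : AC u g -> a <= x -> x <= y -> y <= b ->
  (u y - u x) ^+ 2 <= (b - a) * Rint `[a, b] (fun z => g z ^+ 2).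
Proof.
move=> h ax xy yb.
have ab : a <= b by rewrite (le_trans ax)// (le_trans xy).
apply: le_trans _ (Rint_CS ab (ac_mble h) (ac_sq h _ _)).
rewrite -real_normK ?num_real// ler_pXn2r ?nnegrE//.
  exact: ac_osc h _ _ _.
by apply: Rint_ge0.
Qed.

Lemma ac_cont u g : AC u g -> continuous u.
Proof.
move=> h x; apply/cvgrPdist_lt => e e0.
pose K := Rint `[x - 1, x + 1] (fun z => g z ^+ 2) + 1.
have K0 : 0 < K.
  by rewrite ltr_wpDl// Rint_ge0// => ? _; exact: sqr_ge0.
pose d := Num.min 1 (e ^+ 2 / K).
have d0 : 0 < d by rewrite lt_min ltr01 divr_gt0// exprn_gt0.
have key s t : x - 1 <= s -> s <= t -> t <= x + 1 -> t - s < d -> `|u t - u s| < e.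
  move=> xs st tx ts.
  rewrite -(@ltr_pXn2r _ 2)// ?nnegrE//; last exact: ltW.
  rewrite real_normK ?num_real//.
  apply: le_lt_trans (ac_osc_sq h (lexx s) st (lexx t)) _.
  apply: (@le_lt_trans _ _ ((t - s) * K)).
    apply: ler_wpM2l; first by rewrite subr_ge0.
    rewrite /K; apply: ler_wpDr => //.
    apply: Rint_sub_le => //.
    - by apply: subset_itv; rewrite bnd_simp.
    - exact: ac_sq h _ _.
    - by move=> ? _; exact: sqr_ge0.
  by rewrite -ltr_pdivlMr// (lt_le_trans ts)// ge_min lexx orbT.
have d1 : d <= 1 by rewrite ge_min lexx.
near=> y.
have yd : `|x - y| < d.
  near: y; exact: (@cvgr_dist_lt _ _ _ _ _ id x).
move: (yd); rewrite ltr_norml => /andP[y1 y2].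
have [xy|/ltW yx] := leP x y.
- by rewrite distrC; apply: key => //; lra.
- by apply: key => //; lra.
Unshelve. all: by end_near. Qed.

Lemma AC_D u g p q : AC u g -> AC p q ->
  AC (fun x => u x + p x) (fun x => g x + q x).
Proof.
move=> h k; split.
- by apply: mbleD; [exact: ac_mble h|exact: ac_mble k].
- move=> a b; apply: (@itg_le _ _ _ (fun x => 2 * g x ^+ 2 + 2 * q x ^+ 2)) => //.
  + by apply: mbleX; apply: mbleD; [exact: ac_mble h|exact: ac_mble k].
  + by apply: itgD => //; apply: itgZ => //; [exact: ac_sq h _ _|exact: ac_sq k _ _].
  + move=> x _; rewrite ger0_norm ?sqr_ge0//.
    by have := sqr_ge0 (g x - q x); nra.
- move=> a b ab; rewrite RintD//; [|exact: ac_itg h|exact: ac_itg k].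
  by rewrite -(ac_ftc h)// -(ac_ftc k)//; ring.
Qed.

Lemma AC_Z c u g : AC u g -> AC (fun x => c * u x) (fun x => c * g x).
Proof.
move=> h; split.
- by apply: mbleZ; exact: ac_mble h.
- move=> a b; apply: (@eq_itg _ _ (fun x => c ^+ 2 * g x ^+ 2)) => //.
    by move=> x _; rewrite exprMn.
  by apply: itgZ => //; exact: ac_sq h _ _.
- move=> a b ab; rewrite RintZ//; last exact: ac_itg h.
  by rewrite -(ac_ftc h)//; ring.
Qed.

Lemma itgT_sqD f g : mble f -> mble g ->
  itg setT (fun x => f x ^+ 2) -> itg setT (fun x => g x ^+ 2) ->
  itg setT (fun x => (f x + g x) ^+ 2).
Proof.
move=> mf mg hf hg.
apply: (@itg_le _ _ _ (fun x => 2 * f x ^+ 2 + 2 * g x ^+ 2)) => //.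
+ by apply: mbleX; exact: mbleD.
+ by apply: itgD => //; apply: itgZ.
+ move=> x _; rewrite ger0_norm ?sqr_ge0//.
  by have := sqr_ge0 (f x - g x); nra.
Qed.

Lemma h1_cont u g : H1 u g -> continuous u.
Proof. by move=> h; exact: ac_cont (h1_ac h). Qed.

Lemma h1_mble u g : H1 u g -> mble u.
Proof. by move=> h; apply: cont_mble; exact: h1_cont h. Qed.

Lemma h1_dmble u g : H1 u g -> mble g.
Proof. by move=> h; exact: ac_mble (h1_ac h). Qed.

Definition L2 f := mble f /\ itg setT (fun x => f x ^+ 2).

Lemma L2_mul f g : L2 f -> L2 g -> itg setT (fun x => f x * g x).
Proof. by move=> [mf hf] [mg hg]; exact: itg_mul. Qed.

Lemma h1_L2 u g : H1 u g -> L2 u.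
Proof. by move=> h; split; [exact: h1_mble h|exact: h1_fun h]. Qed.

Lemma h1_dL2 u g : H1 u g -> L2 g.
Proof. by move=> h; split; [exact: h1_dmble h|exact: h1_der h]. Qed.

Lemma H1_D u g p q : H1 u g -> H1 p q ->
  H1 (fun x => u x + p x) (fun x => g x + q x).
Proof.
move=> h k; split.
- by apply: AC_D; exact: h1_ac.
- by apply: itgT_sqD; [exact: h1_mble h|exact: h1_mble k|exact: h1_fun h|exact: h1_fun k].
- by apply: itgT_sqD; [exact: h1_dmble h|exact: h1_dmble k|exact: h1_der h|exact: h1_der k].
Qed.

Lemma H1_Z c u g : H1 u g -> H1 (fun x => c * u x) (fun x => c * g x).
Proof.
move=> h; split.
- exact: AC_Z (h1_ac h).
- apply: (@eq_itg _ _ (fun x => c ^+ 2 * u x ^+ 2)) => //.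
    by move=> x _; rewrite exprMn.
  by apply: itgZ => //; exact: h1_fun h.
- apply: (@eq_itg _ _ (fun x => c ^+ 2 * g x ^+ 2)) => //.
    by move=> x _; rewrite exprMn.
  by apply: itgZ => //; exact: h1_der h.
Qed.

(* Halving the interval halves the bound, so D vanishes. *)
Lemma additive_eq0 (E : R -> R -> R) (m : R -> R) :
  (forall a b c, a <= b -> b <= c -> E a c = E a b + E b c) ->
  (forall a b, a <= b -> `|E a b| <= (b - a) * (m b - m a)) ->
  forall a b, a <= b -> E a b = 0.
Proof.
move=> Eadd Em.
have H n : forall a b, a <= b -> `|E a b| <= 2^-1 ^+ n * ((b - a) * (m b - m a)).
  elim: n => [a b ab|n IH a b ab]; first by rewrite expr0 mul1r Em.
  pose c := (a + b) / 2.
  have ac : a <= c by rewrite /c; lra.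
  have cb : c <= b by rewrite /c; lra.
  rewrite (Eadd a c b)//.
  apply: le_trans (ler_normD _ _) _.
  apply: le_trans (lerD (IH a c ac) (IH c b cb)) _.
  by rewrite exprS /c; lra.
move=> a b ab; apply/eqP; rewrite -normr_le0.
set K := (b - a) * (m b - m a) in H.
have : (fun n => 2^-1 ^+ n * ((b - a) * (m b - m a))) @ \oo --> (0 * ((b - a) * (m b - m a)) : R).
  apply: cvgM; last exact: cvg_cst.
  by apply: cvg_expr; rewrite ger0_norm// invf_lt1// ltr1n.
rewrite mul0r => hc.
apply: (ler_cvg_to (cvg_cst `|E a b|) hc).
by near=> n; exact: H.
Unshelve. all: by end_near. Qed.

Lemma itg_contM a b f g : continuous f -> itg `[a, b] g -> mble g ->
  itg `[a, b] (fun x => f x * g x).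
Proof.
move=> cf hg mg.
have [M [_ hM]] : bounded_set (f @` `[a, b]).
  apply: compact_bounded; apply: continuous_compact; last exact: segment_compact.
  exact: continuous_subspaceT.
have M1 : M < M + 1 by rewrite ltrDl.
apply: (@itg_le _ _ _ (fun x => (M + 1) * `|g x|)) => //.
- by apply: mbleM => //; exact: cont_mble.
- by apply: itgZ => //; exact: itg_norm.
- move=> x xab; rewrite normrM ler_wpM2r//.
  by apply: (hM _ M1); exists x.
Qed.

(** The defect [E] of the formula is additive over adjacent intervals. Writing it as the integral of
    (u b - u x) q - (p x - p a) g bounds it by the length times the integral of g^2 + q^2, a bound
    of the kind [additive_eq0] asks for, so it vanishes. *)
Lemma ac_prod u g p q : AC u g -> AC p q -> forall a b, a <= b ->
  u b * p b - u a * p a = Rint `[a, b] (fun x => u x * q x + g x * p x).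
Proof.
move=> h k.
have ifun a b : itg `[a, b] (fun x => u x * q x + g x * p x).
  apply: itgD => //.
    apply: itg_contM; [exact: ac_cont h|exact: ac_itg k|exact: ac_mble k].
  apply: (@eq_itg _ _ (fun x => p x * g x)) => //; first by move=> x _; rewrite mulrC.
  by apply: itg_contM; [exact: ac_cont k|exact: ac_itg h|exact: ac_mble h].
pose E a b := u b * p b - u a * p a - Rint `[a, b] (fun x => u x * q x + g x * p x).
pose w x := g x ^+ 2 + q x ^+ 2.
have iw a b : itg `[a, b] w.
  by apply: itgD => //; [exact: ac_sq h _ _|exact: ac_sq k _ _].
have E0 a b c : a <= b -> b <= c -> E a c = E a b + E b c.
  by move=> ab bc; rewrite /E (Rint_split ab bc)//; ring.
have w0 a b c : a <= b -> b <= c -> Rint `[a, c] w - Rint `[a, b] w = Rint `[b, c] w.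
  by move=> ab bc; rewrite (Rint_split ab bc)//; ring.
have E1 a b : a <= b -> `|E a b| <= (b - a) * Rint `[a, b] w.
  move=> ab.
  pose G := Rint `[a, b] (fun x => `|g x|).
  pose Q := Rint `[a, b] (fun x => `|q x|).
  have iq := ac_itg a b k; have ig := ac_itg a b h.
  have iq' := itg_norm (measurable_itv `[a, b]) iq.
  have ig' := itg_norm (measurable_itv `[a, b]) ig.
  have i1 : itg `[a, b] (fun x => u b * q x + p a * g x).
    by apply: itgD => //; apply: itgZ.
  have -> : E a b = Rint `[a, b] (fun x => (u b * q x + p a * g x)
                      - (u x * q x + g x * p x)).
    have e1 : Rint `[a, b] (fun x => u b * q x + p a * g x) =
        u b * (p b - p a) + p a * (u b - u a).
      rewrite RintD//; [|exact: itgZ|exact: itgZ].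
      by rewrite !RintZ// -(ac_ftc h)// -(ac_ftc k).
    by rewrite RintB// e1 /E; ring.
  apply: (@le_trans _ _ (2 * (G * Q))); last first.
    apply: (@le_trans _ _ (G ^+ 2 + Q ^+ 2)).
      by have := sqr_ge0 (G - Q); nra.
    rewrite RintD//; [|exact: ac_sq h _ _|exact: ac_sq k _ _].
    rewrite mulrDr; apply: lerD.
      by apply: Rint_CS => //; [exact: ac_mble h|exact: ac_sq h _ _].
    by apply: Rint_CS => //; [exact: ac_mble k|exact: ac_sq k _ _].
  apply: le_trans (Rint_norm _ _) _ => //; first exact: itgB.
  have -> : 2 * (G * Q) = Rint `[a, b] (fun x => G * `|q x| + Q * `|g x|).
    rewrite RintD//; [|exact: itgZ|exact: itgZ].
    by rewrite !RintZ// -/G -/Q; ring.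
  apply: Rint_le => //.
  - by apply: itg_norm => //; exact: itgB.
  - by apply: itgD => //; apply: itgZ.
  - move=> x /=; rewrite in_itv/= => /andP[ax xb].
    have -> : u b * q x + p a * g x - (u x * q x + g x * p x)
              = (u b - u x) * q x - (p x - p a) * g x by ring.
    apply: le_trans (ler_normB _ _) _; rewrite !normrM; apply: lerD.
      by apply: ler_wpM2r => //; exact: (ac_osc h ax xb (lexx b)).
    by apply: ler_wpM2r => //; exact: (ac_osc k (lexx a) ax xb).
move=> a0 b0 ab0; apply/eqP; rewrite -subr_eq0; apply/eqP.
have H : forall a b, a0 <= a -> a <= b -> E a b = 0; last exact: (H a0 b0).
(* [additive_eq0] expects one function m on the whole line; clamping the endpoints at [a0] lets the
   integral of [w] from [a0] play this role. *)
pose E' a b := E (Num.max a0 a) (Num.max a0 b).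
have mono a b : a <= b -> Num.max a0 a <= Num.max a0 b.
  by move=> ab; rewrite ge_max le_max lexx /= le_max ab orbT.
have E'0 : forall a b, a <= b -> E' a b = 0.
  apply: (@additive_eq0 E' (fun b => Rint `[a0, Num.max a0 b] w)).
  - by move=> a b c ab bc; rewrite /E' (E0 _ (Num.max a0 b))// mono.
  - move=> a b ab; rewrite /E'.
    apply: le_trans (E1 _ _ (mono _ _ ab)) _.
    rewrite w0 ?mono// ?le_max ?lexx//.
    apply: ler_wpM2r.
      by apply: Rint_ge0 => x _; rewrite addr_ge0 ?sqr_ge0.
    by rewrite /Num.max; do 2 case: ifP => ?; lra.
move=> a b a0a ab; have := E'0 a b ab.
by rewrite /E' !max_r// (le_trans a0a).
Qed.

Lemma AC_C1 u g : (forall x, is_derive x 1 u (g x)) -> continuous g -> AC u g.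
Proof.
move=> du cg; split; first exact: cont_mble.
- by move=> a b; apply: itg_cont; exact: contX.
- move=> a b; rewrite le_eqVlt => /predU1P[->|ab]; first by rewrite Rint_pt subrr.
  have dd x : derivable u x 1 by case: (du x).
  have ddE x : (u^`())%classic x = g x by rewrite derive1E; apply: derive_val.
  have cu : continuous u.
    by move=> x; apply: differentiable_continuous; apply/derivable1_diffP.
  have hu : derivable_oo_LRcontinuous u a b.
    split; first by move=> x _; exact: dd.
    - by apply: cvg_at_right_filter; exact: cu.
    - by apply: cvg_at_left_filter; exact: cu.
  have := continuous_FTC2 ab (continuous_subspaceT cg) hu (fun x _ => ddE x).
  by rewrite /Rint /Rintegral => ->.
Qed.

(** Averages u(x)^2 <= 2 u(y)^2 + 2 (u(y) - u(x))^2 over y in a unit interval. Being local, the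
    bound also yields decay at infinity. *)
Lemma H1_sup u g x : H1 u g ->
  u x ^+ 2 <= 2 * Rint `[x, x + 1] (fun y => u y ^+ 2 + g y ^+ 2).
Proof.
move=> h; have hac := h1_ac h.
have x1 : x <= x + 1 by rewrite lerDl.
have -> : u x ^+ 2 = Rint `[x, x + 1] (fun=> u x ^+ 2).
  by rewrite Rint_cst// addrAC subrr add0r mulr1.
have iu : itg `[x, x + 1] (fun y => u y ^+ 2) by apply: itgTS => //; exact: h1_fun h.
have ig : itg `[x, x + 1] (fun y => g y ^+ 2) by exact: ac_sq hac _ _.
set K := Rint `[x, x + 1] (fun y => g y ^+ 2).
apply: (@le_trans _ _ (Rint `[x, x + 1] (fun y => 2 * u y ^+ 2 + 2 * K))).
  apply: Rint_le => //.
  - exact: itg_cst.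
  - by apply: itgD => //; [exact: itgZ|exact: itg_cst].
  - move=> y /=; rewrite in_itv/= => /andP[xy y1].
    have := ac_osc_sq hac (lexx x) xy y1.
    rewrite addrAC subrr add0r mul1r -/K => H.
    by have := sqr_ge0 (u x - 2 * u y); nra.
rewrite RintD//; [|exact: itgZ|exact: itg_cst].
rewrite RintZ// Rint_cst// addrAC subrr add0r mulr1.
by rewrite RintD// mulrDr.
Qed.

Lemma H1_bound u g x : H1 u g ->
  u x ^+ 2 <= 2 * (Rint setT (fun y => u y ^+ 2) + Rint setT (fun y => g y ^+ 2)).
Proof.
move=> h; apply: le_trans (H1_sup x h) _.
have iu := h1_fun h; have ig := h1_der h.
rewrite -RintD// ler_wpM2l// Rint_sub_le//.
- exact: itgD.
- by move=> y _; rewrite addr_ge0 ?sqr_ge0.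
Qed.

Lemma Rint_tail f : itg setT f -> (forall x, 0 <= f x) -> forall e, 0 < e ->
  exists2 M : R, 0 < M & forall x y, x <= y -> (M <= x \/ y <= - M) -> Rint `[x, y] f < e.
Proof.
move=> hf f0 e e0.
have cv := Rint_cvg_itv hf.
have : \forall n \near \oo, `|Rint setT f - Rint `[- n%:R, n%:R] f| < e.
  by apply: (@cvgr_dist_lt _ _ _ _ _ _ _ cv).
move=> [N _ hN].
exists (N.+1%:R); first by rewrite ltr0n.
move=> x y xy hxy.
have {hN} := hN N.+1 (leqnSn N).
apply: le_lt_trans.
set M : R := N.+1%:R in hxy *.
have M0 : - M <= M by rewrite /M; have := ler0n R N.+1; lra.
have sub a b : itg `[a, b] f by exact: itgTS.
have suba a : itg `[a, +oo[ f by exact: itgTS.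
have subb a : itg `]-oo, a] f by exact: itgTS.
apply: le_trans _ (ler_norm _).
rewrite (Rint_splitT (- M) hf) (Rint_split_ray M0)//.
have -> : forall s t r : R, s + (t + r) - t = s + r by move=> s t r; ring.
case: hxy => [Mx|yM].
- apply: (@le_trans _ _ (Rint `[M, +oo[ f)).
    apply: Rint_sub_le => //.
    by apply: subset_itv; rewrite bnd_simp.
  by rewrite lerDr Rint_ge0.
- apply: (@le_trans _ _ (Rint `]-oo, - M] f)).
    apply: Rint_sub_le => //.
    by apply: subset_itv; rewrite bnd_simp.
  by rewrite lerDl Rint_ge0.
Qed.

Lemma H1_decay u g : H1 u g -> forall e, 0 < e ->
  exists2 M : R, 0 < M & forall x, M <= `|x| -> `|u x| < e.
Proof.
move=> h e e0.
have iw : itg setT (fun y => u y ^+ 2 + g y ^+ 2).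
  by apply: itgD => //; [exact: h1_fun h|exact: h1_der h].
have e2 : 0 < e ^+ 2 / 2 by rewrite divr_gt0// exprn_gt0.
have [|M M0 hM] := Rint_tail iw _ e2; first by move=> x; rewrite addr_ge0 ?sqr_ge0.
exists (M + 1); first by lra.
move=> x Mx; rewrite -(@ltr_pXn2r _ 2)// ?nnegrE//; last exact: ltW.
rewrite real_normK ?num_real//.
apply: le_lt_trans (H1_sup x h) _.
rewrite -ltr_pdivlMl// mulrC; apply: hM; first by rewrite lerDl.
move: Mx; rewrite ler_normr => /orP[|] ?; [left|right]; lra.
Qed.

(** The boundary terms on [-n, n] vanish by [H1_decay]. With p the derivative of a solution and q
    its second derivative, this tests the equation against any H1 function, not only against test
    functions. *)
Lemma H1_prod u g p q : H1 u g -> H1 p q ->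
  Rint setT (fun x => u x * q x + g x * p x) = 0.
Proof.
move=> h k.
have iw : itg setT (fun x => u x * q x + g x * p x).
  by apply: itgD => //; apply: L2_mul;
    by [exact: h1_L2 h|exact: h1_L2 k|exact: h1_dL2 h|exact: h1_dL2 k].
apply: (cvg_unique _ (Rint_cvg_itv iw)); first exact: Rhausdorff.
apply/cvgrPdist_lt => e e0.
pose e1 := Num.min 1 (e / 4).
have e10 : 0 < e1 by rewrite lt_min ltr01 divr_gt0.
have [M M0 hM] := H1_decay h e10.
have [M' M'0 hM'] := H1_decay k e10.
near=> n.
have nn : - n%:R <= n%:R :> R by have := ler0n R n; lra.
rewrite -(ac_prod (h1_ac h) (h1_ac k) nn) sub0r normrN.
have Mn : M <= n%:R by near: n; exact: nbhs_infty_ger.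
have M'n : M' <= n%:R by near: n; exact: nbhs_infty_ger.
have absn : `|n%:R : R| = n%:R by rewrite ger0_norm.
have b1 : `|u n%:R * p n%:R| < e / 4.
  rewrite normrM; apply: (@lt_le_trans _ _ (1 * (e / 4))); last by rewrite mul1r.
  apply: ltr_pM => //.
    by apply: lt_le_trans (hM _ _) _; rewrite ?absn// ge_min lexx.
  by apply: lt_le_trans (hM' _ _) _; rewrite ?absn// ge_min lexx orbT.
have b2 : `|u (- n%:R) * p (- n%:R)| < e / 4.
  rewrite normrM; apply: (@lt_le_trans _ _ (1 * (e / 4))); last by rewrite mul1r.
  apply: ltr_pM => //.
    by apply: lt_le_trans (hM _ _) _; rewrite ?normrN ?absn// ge_min lexx.
  by apply: lt_le_trans (hM' _ _) _; rewrite ?normrN ?absn// ge_min lexx orbT.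
apply: le_lt_trans (ler_normB _ _) _; lra.
Unshelve. all: by end_near. Qed.

End AbsCont.

(** * Test functions *)

Section Smooth.
Context {R : realType}.
Implicit Types (f g p q : R -> R) (a b c x y : R).

(** Derivatives are existential witnesses rather than values of an operator, which makes closure
    under sums, products and affine substitutions a direct induction. *)
Fixpoint Cn (n : nat) f : Prop :=
  if n is m.+1 then
    exists2 f', (forall x, is_derive x 1 f (f' x)) & Cn m f'
  else True.

Definition smooth f := forall n, Cn n f.

Lemma Cn_pred n f : Cn n.+1 f -> Cn n f.
Proof.
elim: n f => [//|n IH] f [f' df hf'].
by exists f' => //; exact: IH.
Qed.

Lemma CnD n f g : Cn n f -> Cn n g -> Cn n (fun x => f x + g x).
Proof.
elim: n f g => [//|n IH] f g [f' df hf] [g' dg hg].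
exists (fun x => f' x + g' x); last exact: IH.
by move=> x; apply: is_deriveD.
Qed.

Lemma Cn_cst n c : Cn n (fun=> c : R).
Proof.
elim: n c => [//|n IH] c; exists (fun=> 0); last exact: IH.
by move=> x; exact: is_derive_cst.
Qed.

Lemma CnM n f g : Cn n f -> Cn n g -> Cn n (fun x => f x * g x).
Proof.
elim: n f g => [//|n IH] f g hf hg.
have hf0 := Cn_pred hf; have hg0 := Cn_pred hg.
case: hf => f' df hf; case: hg => g' dg hg.
exists (fun x => f x * g' x + g x * f' x); last by apply: CnD; apply: IH.
by move=> x; have := @is_deriveM _ _ f g x 1 _ _ (df x) (dg x).
Qed.

Lemma Cn_aff n f k c : Cn n f -> Cn n (fun x => f (k * x + c)).
Proof.
elim: n f => [//|n IH] f [f' df hf].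
exists (fun x => f' (k * x + c) * k).
  move=> x.
  apply: (@is_derive1_comp R f (fun x => k * x + c) x (f' (k * x + c)) k (df _)).
  have h1 := @is_deriveZ _ _ _ (@id R) k x 1 1 (is_derive_id _ _).
  have h2 := @is_deriveD _ _ _ _ (cst c) x 1 _ _ h1 (is_derive_cst c x 1).
  by apply: is_derive_eq h2 _; rewrite addr0 /GRing.scale/= mulr1.
by apply: CnM; [exact: IH|exact: Cn_cst].
Qed.

Lemma smooth_deriv f f' : (forall x, is_derive x 1 f (f' x)) -> smooth f' -> smooth f.
Proof. by move=> df hf [//|n]; exists f'. Qed.

(** Each order n comes with its own witness; uniqueness of the derivative identifies them. *)
Lemma smooth_derive f : smooth f ->
  exists2 f', (forall x, is_derive x 1 f (f' x)) & smooth f'.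
Proof.
move=> hf; have [f' df _] := hf 1%N.
exists f' => // n; have [g dg hg] := hf n.+1.
suff -> : f' = g by [].
apply/funext => x; have h1 := df x; have h2 := dg x.
by rewrite -(@derive_val _ _ _ _ _ _ _ h1) -(@derive_val _ _ _ _ _ _ _ h2).
Qed.

Lemma is_derive_derive1 f (f' : R -> R) : (forall x, is_derive x 1 f (f' x)) ->
  (f^`())%classic = f'.
Proof. by move=> df; apply/funext => x; rewrite derive1E; exact: derive_val. Qed.

Lemma smooth_derivable f : smooth f ->
  forall (n : nat) (x : R), derivable (f^`(n)%classic) x 1.
Proof.
move=> + n; elim: n f => [|n IH] f /smooth_derive[f' df hf] x.
  by rewrite derive1n0; case: (df x).
by rewrite derive1Sn (is_derive_derive1 df); exact: IH.
Qed.

Lemma derivable_smooth f :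
  (forall (n : nat) (x : R), derivable (f^`(n)%classic) x 1) -> smooth f.
Proof.
move=> + n; elim: n f => [//|n IH] f df.
exists (f^`())%classic.
  by move=> x; have := df 0%N x; rewrite derive1n0 derive1E => h; exact: derivableP.
by apply: IH => m x; rewrite -derive1Sn.
Qed.

Lemma is_derive_cont f (f' : R -> R) : (forall x, is_derive x 1 f (f' x)) -> continuous f.
Proof.
by move=> df x; apply: differentiable_continuous; apply/derivable1_diffP; case: (df x).
Qed.

Lemma smooth_cont f : smooth f -> continuous f.
Proof. by move=> /smooth_derive[f' df _]; exact: is_derive_cont df. Qed.

Lemma smooth_cst c : smooth (fun=> c).
Proof. by move=> n; exact: Cn_cst. Qed.
Lemma smoothD f g : smooth f -> smooth g -> smooth (fun x => f x + g x).
Proof. by move=> hf hg n; apply: CnD. Qed.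
Lemma smoothM f g : smooth f -> smooth g -> smooth (fun x => f x * g x).
Proof. by move=> hf hg n; apply: CnM. Qed.
Lemma smooth_aff f k c : smooth f -> smooth (fun x => f (k * x + c)).
Proof. by move=> hf n; apply: Cn_aff. Qed.
Lemma smoothZ k f : smooth f -> smooth (fun x => k * f x).
Proof. by move=> hf; apply: smoothM => //; exact: smooth_cst. Qed.
Lemma smoothB f g : smooth f -> smooth g -> smooth (fun x => f x - g x).
Proof.
move=> hf hg; rewrite (_ : (fun x => _) = (fun x => f x + (-1) * g x)).
  by apply: smoothD => //; exact: smoothZ.
by apply/funext => x; rewrite mulN1r.
Qed.

(* The smooth functions P(1/x) exp(-1/x), extended by 0 to x <= 0. *)
Definition flat (P : {poly R}) x : R := if 0 < x then P.[x^-1] * expR (- x^-1) else 0.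

(** Each factor y is absorbed by half of the exponent, y <= (2/a) exp(a y / 2), which is why the
    induction on P quantifies over all a. *)
Lemma horner_le_expR (P : {poly R}) : forall a, 0 < a ->
  exists2 C, 0 <= C & forall y, 0 <= y -> `|P.[y]| <= C * expR (a * y).
Proof.
elim/poly_ind: P => [|P c IH] a a0.
  by exists 0 => // y _; rewrite horner0 normr0 mul0r.
have a2 : 0 < a / 2 by rewrite divr_gt0.
have [C C0 hC] := IH _ a2.
exists (C * (2 / a) + `|c|).
  by rewrite addr_ge0// mulr_ge0// ltW// divr_gt0.
move=> y y0; rewrite hornerMXaddC (le_trans (ler_normD _ _))// mulrDl.
apply: lerD; last first.
  rewrite ler_peMr// (le_trans _ (expR_ge1Dx _))// lerDl.
  by rewrite mulr_ge0// ltW.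
rewrite normrM (ger0_norm y0).
have -> : a * y = a / 2 * y + a / 2 * y by field.
rewrite expRD.
have h1 : y <= 2 / a * expR (a / 2 * y).
  rewrite -ler_pdivrMl ?divr_gt0//.
  apply: le_trans _ (expR_ge1Dx _).
  have -> : (2 / a)^-1 * y = a / 2 * y by field; rewrite gt_eqF.
  by rewrite lerDr.
have -> : C * (2 / a) * (expR (a / 2 * y) * expR (a / 2 * y)) =
   (C * expR (a / 2 * y)) * (2 / a * expR (a / 2 * y)) by ring.
by apply: ler_pM => //; exact: hC.
Qed.

Lemma is_derive_flat0 f (C : R) : f 0 = 0 -> (forall x, `|f x| <= C * x ^+ 2) ->
  is_derive (0 : R) (1 : R) f 0.
Proof.
move=> f0 fC.
have C0 : 0 <= C.
  by have := le_trans (normr_ge0 _) (fC 1); rewrite expr1n mulr1.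
have H : h^-1 *: (f (h *: (1:R) + 0) - f 0) @[h --> 0^'] --> (0 : R).
  apply/cvgrPdist_lt => e e0.
  have C1 : 0 < C + 1 by lra.
  near=> h.
  have h0 : h != 0 by near: h; exact: nbhs_dnbhs_neq.
  have he : `|h| < e / (C + 1).
    near: h; apply: dnbhs0_lt; exact: divr_gt0.
  rewrite sub0r normrN f0 subr0 addr0 /GRing.scale/= mulr1 normrM.
  apply: (@le_lt_trans _ _ (`|h^-1| * (C * h ^+ 2))).
    by apply: ler_wpM2l.
  rewrite -[h ^+ 2]real_normK ?num_real// normfV expr2.
  have -> : `|h|^-1 * (C * (`|h| * `|h|)) = C * `|h|.
    by field; rewrite normr_eq0.
  apply: (@le_lt_trans _ _ ((C + 1) * `|h|)).
    by rewrite ler_wpM2r// lerDl.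
  by rewrite mulrC -ltr_pdivlMr.
apply: DeriveDef; last by apply/cvg_lim => //; exact: Rhausdorff.
by apply/cvg_ex; exists 0.
Unshelve. all: by end_near. Qed.

(** With y = 1/x one has d/dx = - y^2 d/dy, and P(y) exp(-y) becomes y^2 (P - P')(y) exp(-y). The
    family is therefore stable under differentiation, which gives smoothness by induction. *)
Lemma flat_derive P x : is_derive x 1 (flat P) (flat ('X^2 * (P - P^`())) x).
Proof.
have [x0|x0|->] := ltgtP x 0.
- have -> : flat ('X^2 * (P - P^`())) x = 0 by rewrite /flat ltNge (ltW x0).
  apply: (@near_eq_is_derive _ _ _ (cst (0:R)) _ x 1 0 _ (is_derive_cst (0:R) x 1)).
  near=> y; rewrite /flat ifF//; apply/negbTE; rewrite -leNgt ltW//.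
  by near: y; exact: lt_nbhsl.
- have -> : flat ('X^2 * (P - P^`())) x = ('X^2 * (P - P^`())).[x^-1] * expR (- x^-1).
    by rewrite /flat x0.
  have xn0 : x != 0 by rewrite gt_eqF.
  pose f := fun y : R => P.[y^-1] * expR (- y^-1).
  apply: (@near_eq_is_derive _ _ _ f).
    near=> y; rewrite /flat ifT//.
    by near: y; exact: lt_nbhsr.
  have di : is_derive x 1 (fun y : R => y^-1) (- x ^- 2).
    have := @is_deriveV R id x 1 1 xn0 (is_derive_id _ _).
    by rewrite /GRing.scale/= mulr1.
  have dP := @is_derive1_comp R (horner P) (fun y => y^-1) x _ _ (is_derive_poly P _) di.
  have dE := @is_derive1_comp R expR (fun y => - y^-1) x _ _ (is_derive_expR _) (is_deriveN di).
  have := is_deriveM dP dE.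
  move=> h; apply: is_derive_eq h _.
  rewrite /GRing.scale/= !hornerE /=.
  by field.
- apply: is_derive_eq.
  (* Bounding y^2 P(y) instead of P(y) produces the factor x^2 that makes the derivative at 0
     vanish. *)
  have [C C0 hC] := horner_le_expR ('X^2 * P) ltr01.
  apply: (@is_derive_flat0 _ C); first by rewrite /flat ltxx.
    move=> y; rewrite /flat; case: ifPn => y0; last first.
      by rewrite normr0 mulr_ge0 ?sqr_ge0.
    have yi : 0 <= y^-1 by rewrite invr_ge0 ltW.
    have := hC _ yi; rewrite mul1r hornerM hornerXn !normrM.
    rewrite (ger0_norm (expR_ge0 _)) (ger0_norm yi) expRN ler_pdivrMr ?expR_gt0//.
    move=> h; rewrite mulrAC -ler_pdivrMr ?exprn_gt0//.
    by apply: le_trans h; rewrite expr2 invfM mulrC.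
  by rewrite /flat ltxx.
Unshelve. all: by end_near. Qed.

Lemma flat_smooth P : smooth (flat P).
Proof.
move=> n; elim: n P => [//|n IH] P.
by exists (flat ('X^2 * (P - P^`()))) => // x; exact: flat_derive.
Qed.

Definition bump x : R := flat 1 x * flat 1 (- x + 1).

Lemma bump_smooth : smooth bump.
Proof.
apply: smoothM; first exact: flat_smooth.
rewrite (_ : (fun x => _) = fun x => flat 1 ((-1) * x + 1)).
  by apply: smooth_aff; exact: flat_smooth.
by apply/funext => x; rewrite mulN1r.
Qed.

Lemma flat1_ge0 x : 0 <= flat 1 x.
Proof. by rewrite /flat; case: ifP => // _; rewrite hornerC mul1r expR_ge0. Qed.

Lemma bump_ge0 x : 0 <= bump x.
Proof. by rewrite mulr_ge0 ?flat1_ge0. Qed.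

Lemma bump_gt0 x : 0 < x -> x < 1 -> 0 < bump x.
Proof.
move=> x0 x1; rewrite /bump /flat x0 ifT; last lra.
by rewrite !hornerC !mul1r mulr_gt0 ?expR_gt0.
Qed.

Lemma bump_out x : x <= 0 \/ 1 <= x -> bump x = 0.
Proof.
rewrite /bump /flat => -[|] h; first by rewrite ltNge h mul0r.
by rewrite [X in _ * X]ifF ?mulr0//; apply/negbTE; rewrite -leNgt; lra.
Qed.

End Smooth.

(** * Compact supports, cut-offs and the du Bois-Reymond lemma *)

Section TestFunctions.
Context {R : realType}.
Local Notation mu := (@lebesgue_measure R).
Local Notation mset D := (@measurable _ (measurableTypeR R) D).
Implicit Types (f g p q u phi psi : R -> R) (a b c x y M : R).

Definition supp_in M f := forall x, M <= `|x| -> f x = 0.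

(** Equivalent to [test_function] by [tf_test] and [test_tf]; an explicit radius replaces the
    compact closure of the support. *)
Definition tf phi := smooth phi /\ exists2 M, 0 < M & supp_in M phi.

Lemma supp_in_itv M f x : supp_in M f -> ~ `[- M, M]%classic x -> f x = 0.
Proof.
move=> fM /negP; rewrite /= in_itv/= -ler_norml -ltNge => h.
by apply: fM; exact: ltW.
Qed.

Lemma itg_supp M f : mble f -> supp_in M f -> itg `[- M, M] f -> itg setT f.
Proof.
move=> mf fM hf.
have e : f = f \_ `[- M, M].
  apply/funext => x; rewrite /patch; case: ifPn => // /negP h.
  by apply: (supp_in_itv fM) => h'; apply: h; rewrite inE.
rewrite e /itg -restrict_EFin; apply/integrable_restrict => //.
by rewrite setTI.
Qed.

Lemma Rint_supp M f : supp_in M f -> Rint setT f = Rint `[- M, M] f.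
Proof.
move=> fM; rewrite /Rint [RHS]Rintegral_mkcond; apply: eq_Rint => x _.
rewrite /patch; case: ifPn => // /negP h.
by apply: (supp_in_itv fM) => h'; apply: h; rewrite inE.
Qed.

Lemma itg_suppM f phi : mble f -> (forall a b, itg `[a, b] f) ->
  continuous phi -> (exists2 M, 0 < M & supp_in M phi) ->
  itg setT (fun x => f x * phi x).
Proof.
move=> mf hf cp [M M0 hM].
apply: (@itg_supp M).
- by apply: mbleM => //; exact: cont_mble.
- by move=> x /hM ->; rewrite mulr0.
- apply: (@eq_itg _ _ (fun x => phi x * f x)) => //; first by move=> x _; rewrite mulrC.
  exact: itg_contM.
Qed.

Lemma itg_supp_cont phi : continuous phi -> (exists2 M, 0 < M & supp_in M phi) ->
  itg setT phi.
Proof.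
move=> cp [M M0 hM]; apply: (itg_supp _ hM); first exact: cont_mble.
exact: itg_cont.
Qed.

Lemma tf_cont phi : tf phi -> continuous phi.
Proof. by case=> /smooth_cont. Qed.

Lemma tf_itg phi : tf phi -> itg setT phi.
Proof. by move=> h; apply: itg_supp_cont; [exact: tf_cont|case: h]. Qed.

Lemma supp_in_derive M f f' : supp_in M f -> (forall x, is_derive x 1 f (f' x)) ->
  supp_in (M + 1) f'.
Proof.
move=> fM df x Mx.
have h : is_derive x 1 f 0.
  apply: (@near_eq_is_derive _ _ _ (cst (0:R)) _ x 1 0 _ (is_derive_cst (0:R) x 1)).
  near=> y; rewrite fM//.
  have xy : `|x - y| < 1 by near: y; exact: (@cvgr_dist_lt _ _ _ _ _ id x).
  have := ler_normD (x - y) y; rewrite subrK; lra.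
by rewrite -(@derive_val _ _ _ _ _ _ _ (df x)) (@derive_val _ _ _ _ _ _ _ h).
Unshelve. all: by end_near. Qed.

Lemma tf_derive phi : tf phi -> exists2 phi', (forall x, is_derive x 1 phi (phi' x)) & tf phi'.
Proof.
move=> [hs [M M0 hM]]; have [phi' dphi hs'] := smooth_derive hs.
exists phi' => //; split=> //; exists (M + 1); first lra.
exact: supp_in_derive hM dphi.
Qed.

Lemma tf_of_derive phi phi' : tf phi -> (forall x, is_derive x 1 phi (phi' x)) -> tf phi'.
Proof.
move=> h dphi; have [p' dp' tp'] := tf_derive h.
suff <- : p' = phi' by [].
by rewrite -(is_derive_derive1 dphi) -(is_derive_derive1 dp').
Qed.

Lemma supp_in_le M M' f : M <= M' -> supp_in M f -> supp_in M' f.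
Proof. by move=> MM' fM x hx; apply: fM; exact: le_trans hx. Qed.

Lemma tf_itgM f phi : continuous f -> tf phi -> itg setT (fun x => f x * phi x).
Proof.
move=> cf tp; apply: itg_suppM => //; [exact: cont_mble|by move=> *; exact: itg_cont| |].
  exact: tf_cont.
by case: tp.
Qed.

Lemma tf_add phi psi : tf phi -> tf psi -> tf (fun x => phi x + psi x).
Proof.
move=> [h1 [M M0 hM]] [h2 [M' M'0 hM']]; split; first exact: smoothD.
exists (M + M'); first lra.
move=> x hx; rewrite hM ?hM' ?addr0//; lra.
Qed.

Lemma tf_scale k phi : tf phi -> tf (fun x => k * phi x).
Proof.
move=> [h1 [M M0 hM]]; split; first exact: smoothZ.
by exists M => // x hx; rewrite hM ?mulr0.
Qed.

Lemma tf_sqr_itg phi : tf phi -> itg setT (fun x => phi x ^+ 2).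
Proof.
move=> h; apply: itg_supp_cont.
  by apply: contX; exact: tf_cont.
by case: h => _ [M M0 hM]; exists M => // x /hM ->; rewrite expr0n.
Qed.

Lemma tf_H1 phi phi' : tf phi -> (forall x, is_derive x 1 phi (phi' x)) -> H1 phi phi'.
Proof.
move=> h dphi; have tp' := tf_of_derive h dphi; split.
- by apply: AC_C1 => //; exact: tf_cont.
- exact: tf_sqr_itg.
- exact: tf_sqr_itg.
Qed.

Lemma tf_test phi : tf phi -> test_function phi.
Proof.
move=> [hs [M M0 hM]]; split; first exact: smooth_derivable.
apply: (@subclosed_compact _ _ `[- M, M]); first exact: closed_closure.
  exact: segment_compact.
rewrite (_ : `[- M, M]%classic = closure `[- M, M]); last first.
  by apply/closure_id; exact: interval_closed.
apply: closure_subset => x /= /eqP; apply: contra_notP; exact: supp_in_itv.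
Qed.

Lemma test_tf phi : test_function phi -> tf phi.
Proof.
move=> [hd hc]; split; first exact: derivable_smooth.
have [M [_ hM]] := compact_bounded hc.
exists (`|M| + 1); first by have := normr_ge0 M; lra.
move=> x hx; apply/eqP/negP => /negP h.
have MM : M < `|M| + 1 / 2 by have := ler_norm M; lra.
have := hM _ MM x (@subset_closure _ [set x | phi x != 0] x h) => /=; lra.
Qed.

Definition anti psi x := Rint `]-oo, x] psi.

Lemma anti_derive psi x : tf psi -> is_derive x 1 (anti psi) (psi x).
Proof.
move=> h.
have hi : itg `]-oo, x + 1] psi by apply: itgTS => //; exact: tf_itg.
have x1 : x < x + 1 by lra.
have cp : continuous psi by exact: tf_cont.
have [hd he] := @continuous_FTC1 R psi (BInfty R true) x (x + 1) x1 hi (ltNyr _) (cp x).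
by rewrite -he derive1E; exact: derivableP.
Qed.

Lemma anti_smooth psi : tf psi -> smooth (anti psi).
Proof.
move=> h; apply: (@smooth_deriv _ _ psi); last by case: h.
by move=> x; exact: anti_derive.
Qed.

Lemma anti_left M psi x : supp_in M psi -> x <= - M -> anti psi x = 0.
Proof.
move=> hM xM; rewrite /anti -(Rintegral_set0 mu psi).
rewrite -[RHS](_ : Rint `]-oo, x] (fun=> 0) = _); last first.
  by rewrite /Rint Rintegral_set0 (@Rintegral_cst _ _ _ mu)// mul0r.
apply: eq_Rint => y /=; rewrite in_itv/= => yx.
by apply: hM; rewrite ler_normr; apply/orP; right; lra.
Qed.

Lemma anti_right M psi x : tf psi -> supp_in M psi -> M <= x -> anti psi x = Rint setT psi.
Proof.
move=> h hM xM; rewrite (Rint_splitT x (tf_itg h)) -[LHS]addr0; congr (_ + _).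
have -> : Rint `[x, +oo[ psi = Rint `[x, +oo[ (fun=> 0).
  apply: eq_Rint => y /=; rewrite in_itv/= andbT => xy.
  by apply: hM; rewrite ler_normr; apply/orP; left; lra.
by rewrite /Rint (@Rintegral_cst _ _ _ mu)// mul0r.
Qed.

(** To the right of the support, [anti psi] equals the total integral, so zero mean is what makes
    its support compact. *)
Lemma anti_tf psi : tf psi -> Rint setT psi = 0 -> tf (anti psi).
Proof.
move=> h h0; split; first exact: anti_smooth.
case: (h) => _ [M M0 hM]; exists M => // x; rewrite ler_normr => /orP[] Mx.
  by rewrite (anti_right h hM).
by rewrite (anti_left hM)//; lra.
Qed.

Lemma bump_supp : supp_in 1 (@bump R).
Proof. by move=> x; rewrite ler_normr => /orP[] ?; apply: bump_out; [right|left]; lra. Qed.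

Lemma bump_tf : tf (@bump R).
Proof. by split; [exact: bump_smooth|exists 1 => //; exact: bump_supp]. Qed.

Lemma Rint_gt0 f x0 : continuous f -> itg setT f -> (forall x, 0 <= f x) ->
  0 < f x0 -> 0 < Rint setT f.
Proof.
move=> cf hf f0 fx0.
have [d d0 hd] : exists2 d, 0 < d & forall y, `|x0 - y| < d -> f x0 / 2 < f y.
  have := cf x0 => /cvgrPdist_lt /(_ (f x0 / 2)); rewrite divr_gt0// => /(_ isT).
  move=> [d d0 hd]; exists d => // y hy.
  by have := hd y hy; rewrite ltr_norml => /andP[]; lra.
apply: (@lt_le_trans _ _ (Rint `[x0, x0 + d / 2] f)); last exact: Rint_sub_le.
apply: (@lt_le_trans _ _ (Rint `[x0, x0 + d / 2] (fun=> f x0 / 2))).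
  by rewrite Rint_cst; [rewrite mulr_gt0//; lra|lra].
apply: Rint_le => //; [exact: itg_cst|exact: itgTS|].
move=> y /=; rewrite in_itv/= => /andP[y1 y2]; apply/ltW/hd.
by rewrite distrC ger0_norm; lra.
Qed.

Lemma Rint_bump_gt0 : 0 < Rint setT (@bump R).
Proof.
apply: (@Rint_gt0 _ 2^-1).
- exact: tf_cont bump_tf.
- exact: tf_itg bump_tf.
- exact: bump_ge0.
- by apply: bump_gt0; lra.
Qed.

(** A smooth step climbing from 0 to 1 on [0, 1]. *)
Definition step x : R := (Rint setT (@bump R))^-1 * anti (@bump R) x.

Lemma step_smooth : smooth step.
Proof. by apply: smoothZ; apply: anti_smooth; exact: bump_tf. Qed.

Lemma step0 x : x <= 0 -> step x = 0.
Proof.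
move=> x0; rewrite /step /anti.
have -> : Rint `]-oo, x] (@bump R) = Rint `]-oo, x] (fun=> 0).
  by apply: eq_Rint => y /=; rewrite in_itv/= => yx; apply: bump_out; left; lra.
by rewrite /Rint (@Rintegral_cst _ _ _ mu)// mul0r mulr0.
Qed.

Lemma step1 x : 1 <= x -> step x = 1.
Proof.
move=> x1; rewrite /step (anti_right bump_tf bump_supp x1) mulVf//.
by rewrite gt_eqF// Rint_bump_gt0.
Qed.

Lemma step_itv x : 0 <= step x <= 1.
Proof.
have h := Rint_bump_gt0.
rewrite /step mulr_ge0 /=; [|by rewrite invr_ge0 ltW|by apply: Rint_ge0 => y _; exact: bump_ge0].
rewrite ler_pdivrMl// mulr1 /anti; apply: Rint_sub_le => //; first exact: tf_itg bump_tf.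
by move=> y _; exact: bump_ge0.
Qed.

(** A smooth approximation of the indicator of ]a, b]. Both ramps start at the endpoint and have
    width 1/(n+1): the limit is half-open, and all supports stay in [a, b + 1], as dominated
    convergence requires. *)
Definition plateau a b (n : nat) x := step (n.+1%:R * (x - a)) - step (n.+1%:R * (x - b)).

Lemma plateau_out a b n x : a <= b -> x <= a \/ b + 1 <= x -> plateau a b n x = 0.
Proof.
move=> ab; rewrite /plateau; have n1 : 1 <= n.+1%:R :> R by rewrite ler1n.
case=> h.
  by rewrite !step0 ?subrr//; nra.
by rewrite !step1 ?subrr//; nra.
Qed.

Lemma plateau_norm a b n x : `|plateau a b n x| <= 1.
Proof.
rewrite /plateau.
have /andP[] := step_itv (n.+1%:R * (x - a)).
have /andP[] := step_itv (n.+1%:R * (x - b)).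
by rewrite ler_norml => *; apply/andP; split; lra.
Qed.

Lemma plateau_tf a b n : a <= b -> tf (plateau a b n).
Proof.
move=> ab; split.
  apply: smoothB.
    rewrite (_ : (fun x => _) = (fun x => step (n.+1%:R * x + (- n.+1%:R * a)))).
      exact: smooth_aff step_smooth.
    by apply/funext => x; congr step; ring.
  rewrite (_ : (fun x => _) = (fun x => step (n.+1%:R * x + (- n.+1%:R * b)))).
    exact: smooth_aff step_smooth.
  by apply/funext => x; congr step; ring.
exists (`|a| + `|b| + 1).
  by have := normr_ge0 a; have := normr_ge0 b; lra.
move=> x; rewrite ler_normr => /orP hx; apply: plateau_out => //.
have a0 := normr_ge0 a; have b0 := normr_ge0 b.
have a1 := ler_norm (- a); have b1 := ler_norm b; rewrite normrN in a1.
by case: hx => ?; [right|left]; lra.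
Qed.

Lemma plateau_cvg a b x : a <= b ->
  plateau a b n x @[n --> \oo] --> (if (a < x) && (x <= b) then 1 else 0 : R).
Proof.
move=> ab.
have stepc c :
    step (n.+1%:R * (x - c)) @[n --> \oo] --> (if c < x then 1 else 0 : R).
  apply: (@cvg_near_cst _ _ (if c < x then 1 else 0 : R)).
  have [cx|xlec] := ltP c x.
    near=> n; apply: step1.
    rewrite -ler_pdivrMr ?subr_gt0// mul1r.
    apply: (@le_trans _ _ n%:R); last by rewrite ler_nat.
    by near: n; exact: nbhs_infty_ger.
  near=> n; apply: step0; rewrite pmulr_rle0 ?ltr0n// subr_le0//.
have -> : (if (a < x) && (x <= b) then 1 else 0 : R) =
   (if a < x then 1 else 0) - (if b < x then 1 else 0).
  have [ax|xlea] := ltP a x; have [bx|bx] := ltP b x => /=.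
  - by rewrite subrr.
  - by rewrite subr0.
  - by exfalso; lra.
  - by rewrite subr0.
by apply: cvgB; apply: stepc.
Unshelve. all: by end_near. Qed.

Lemma mble_restrict (D : set R) f : mset D -> mble f -> mble (f \_ D).
Proof.
move=> mD mf; apply/(@measurable_restrictT _ _ (measurableTypeR R) _ D f) => //.
exact: measurable_funTS.
Qed.

Lemma test_Rint0 f : mble f -> (forall a b, itg `[a, b] f) ->
  (forall phi, tf phi -> Rint setT (fun x => f x * phi x) = 0) ->
  forall a b, a <= b -> Rint `[a, b] f = 0.
Proof.
move=> mf hf h a b ab.
pose f0 := f \_ `]a, b].
have e : Rint `[a, b] f = Rint setT f0.
  rewrite /Rint -Rintegral_mkcond -Rintegral_itv_obnd_cbnd//.
  by apply: itgS (hf a b) => //; apply: subset_itvr; rewrite bnd_simp.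
rewrite e.
pose g := (fun x => `|f x|) \_ `[a, b + 1].
have hg : itg setT g.
  rewrite /itg -restrict_EFin; apply/integrable_restrict => //.
  by rewrite setTI; apply: itg_norm.
have cv : Rint setT (fun x => f x * plateau a b n x) @[n --> \oo] --> Rint setT f0.
  apply: (@Rint_dom _ _ _ _ g) => //.
  - move=> n; apply: mbleM => //; apply: cont_mble; apply: tf_cont.
    exact: plateau_tf.
  - exact: mble_restrict.
  - move=> x _.
    have -> : f0 x = f x * (if (a < x) && (x <= b) then 1 else 0).
      rewrite /f0 /patch; case: ifPn => [|/negP].
        by rewrite inE/= in_itv/= => ->; rewrite mulr1.
      by rewrite inE/= in_itv/= => /negP/negbTE ->; rewrite mulr0.
    by apply: cvgM; [exact: cvg_cst|exact: plateau_cvg].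
  - move=> n x _; rewrite /g /patch; case: ifPn => [|/negP].
      by rewrite normrM ler_piMr// plateau_norm.
    rewrite inE/= in_itv/= => /negP; rewrite negb_and -!ltNge => hx.
    rewrite (plateau_out n ab) ?mulr0 ?normr0//.
    by case/orP: hx => ?; [left|right]; lra.
have {}cv : (fun _ : nat => 0 : R) n @[n --> \oo] --> Rint setT f0.
  apply: cvg_trans cv; apply: near_eq_cvg; near=> n.
  by rewrite h//; exact: plateau_tf.
exact: (cvg_unique (@Rhausdorff R) cv (cvg_cst 0)).
Unshelve. all: by end_near. Qed.

Lemma Rint0_ae f : mble f -> (forall a b, itg `[a, b] f) ->
  (forall a b, a <= b -> Rint `[a, b] f = 0) -> ae_eq mu setT f (fun=> 0).
Proof.
move=> mf hf h.
(* Lebesgue differentiation is applied to an indefinite integral with a fixed left endpoint, here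
   -n; the countably many exceptional null sets are united afterwards. *)
have H (n : nat) : {ae mu, forall x, - n%:R < x -> f x = 0}.
  pose f0 := f \_ `[- n%:R, +oo[.
  have mf0 : mble f0 by exact: mble_restrict.
  have i0 c b : itg `[c, b] f0.
    apply: (@itg_le _ _ _ (fun x => `|f x|)) => //; first exact: itg_norm.
    by move=> x _; rewrite /f0 /patch; case: ifP => //; rewrite normr0.
  have := @FTC1 R f0 (BLeft (- n%:R)).
  move=> /(_ (fun y => i0 _ _)).
  have lf0 : locally_integrable [set: R] f0.
    split => //; first exact: openT.
    move=> K _ cK; have [M [_ hM]] := compact_bounded cK.
    have M1 : M < `|M| + 1 by have := ler_norm M; lra.
    have sK : K `<=` `[- (`|M| + 1), `|M| + 1].
      by move=> x Kx /=; rewrite in_itv/= -ler_norml; exact: hM Kx.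
    have mK : mset K by exact: compact_measurable.
    by have /integrableP[_] := itgS (measurable_itv _) mK sK (i0 _ _).
  move=> /(_ lf0) /=; apply: (@filterS _ _ (ae_filter_ringOfSetsType mu)) => x hx xn.
  have e : (fun y => Rintegral mu `[- n%:R, y] f0) = cst 0.
    apply/funext => y.
    have [ny|yn] := leP (- n%:R) y; last first.
      by rewrite set_itv_ge ?bnd_simp -?ltNge// Rintegral_set0.
    rewrite -[RHS](h _ _ ny); apply: eq_Rint => z /=; rewrite in_itv/= => /andP[nz _].
    by rewrite /f0 /patch ifT// inE/= in_itv/= nz.
  have <- : f0 x = f x by rewrite /f0 /patch ifT// inE/= in_itv/= ltW.
  have [|_ <-] := hx; first by rewrite lte_fin.
  by rewrite e derive1_cst.
have := ae_foralln H.
apply: (@filterS _ _ (ae_filter_ringOfSetsType mu)) => x hx _.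
apply: (hx (Num.bound `|x|)).
by rewrite ltrNl (le_lt_trans (ler_norm _))// normrN archi_boundP.
Qed.

Lemma test_ae0 f : mble f -> (forall a b, itg `[a, b] f) ->
  (forall phi, tf phi -> Rint setT (fun x => f x * phi x) = 0) ->
  ae_eq mu setT f (fun=> 0).
Proof. by move=> mf hf h; apply: Rint0_ae => //; exact: test_Rint0. Qed.

Lemma cont_Rint0 f : continuous f -> (forall a b, a <= b -> Rint `[a, b] f = 0) ->
  forall x, f x = 0.
Proof.
move=> cf h.
have key (e : R) x : continuous (fun y => e * f y) -> 0 < e * f x -> False.
  move=> ce fx0.
  have : exists2 d, 0 < d & forall y, `|x - y| < d -> e * f x / 2 < e * f y.
    have := ce x => /cvgrPdist_lt /(_ (e * f x / 2)); rewrite divr_gt0// => /(_ isT).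
    move=> [d d0 hd]; exists d => // y hy.
    by have := hd y hy; rewrite ltr_norml => /andP[]; lra.
  move=> [d d0 hd].
  have xd : x <= x + d / 2 by lra.
  have : Rint `[x, x + d / 2] (fun=> e * f x / 2) <= Rint `[x, x + d / 2] (fun y => e * f y).
    apply: Rint_le => //; [exact: itg_cst|exact: itg_cont|].
    move=> y /=; rewrite in_itv/= => /andP[y1 y2]; apply/ltW/hd.
    by rewrite distrC ger0_norm; lra.
  rewrite Rint_cst// RintZ//; last exact: itg_cont.
  rewrite h// mulr0 leNgt mulr_gt0//; lra.
move=> x; apply/eqP; case: (ltgtP (f x) 0) => // fx.
- exfalso; apply: (key (-1) x); first exact: contZ.
  by rewrite mulN1r; lra.
- exfalso; apply: (key 1 x); first exact: contZ.
  by rewrite mul1r.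
Qed.

(** Subtracting from [psi] the multiple of [bump] with the same integral leaves a zero-mean test
    function, hence the derivative of a test function. The constant is the average of [z] against
    the normalized bump. *)
Lemma du_bois_reymond z : mble z -> (forall a b, itg `[a, b] z) ->
  (forall phi phi', tf phi -> (forall x, is_derive x 1 phi (phi' x)) ->
     Rint setT (fun x => z x * phi' x) = 0) ->
  exists c, forall psi, tf psi -> Rint setT (fun x => (z x - c) * psi x) = 0.
Proof.
move=> mz hz h.
pose K := Rint setT (@bump R).
have K0 : K != 0 by rewrite gt_eqF// Rint_bump_gt0.
have itf psi : tf psi -> itg setT (fun x => z x * psi x).
  by move=> t; apply: itg_suppM => //; [exact: tf_cont|case: t].
exists (Rint setT (fun x => z x * bump x) / K) => psi tpsi.
pose k := - (Rint setT psi / K).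
pose phi' x := psi x + k * bump x.
have tp' : tf phi' by apply: tf_add => //; apply: tf_scale; exact: bump_tf.
have tb := tf_itg (@bump_tf).
have ip' : Rint setT phi' = 0.
  rewrite RintD//; [|exact: tf_itg|exact: itgZ].
  by rewrite RintZ// -/K /k mulNr divfK// subrr.
have := h _ _ (anti_tf tp' ip') (fun x => anti_derive x tp').
have -> : (fun x => z x * phi' x) = (fun x => z x * psi x + k * (z x * bump x)).
  by apply/funext => x; rewrite /phi'; ring.
have ib := itf _ bump_tf.
rewrite RintD//; [|exact: itf|exact: itgZ].
rewrite RintZ// => H.
have -> : (fun x => (z x - Rint setT (fun x0 => z x0 * bump x0) / K) * psi x) =
  (fun x => z x * psi x - (Rint setT (fun x0 => z x0 * bump x0) / K) * psi x).
  by apply/funext => x; ring.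
rewrite RintB//; [|exact: itf|by apply: itgZ => //; exact: tf_itg].
rewrite RintZ//; last exact: tf_itg.
by rewrite -H /k; ring.
Qed.

Lemma du_bois_reymond_ae z : mble z -> (forall a b, itg `[a, b] z) ->
  (forall phi phi', tf phi -> (forall x, is_derive x 1 phi (phi' x)) ->
     Rint setT (fun x => z x * phi' x) = 0) ->
  exists c, ae_eq mu setT z (fun=> c).
Proof.
move=> mz hz h; have [c hc] := du_bois_reymond mz hz h.
exists c; have : ae_eq mu setT (fun x => z x - c) (fun=> 0).
  apply: test_ae0 => //; first by apply: mbleB => //; exact: mble_cst.
  by move=> a b; apply: itgB => //; exact: itg_cst.
by apply: (@filterS _ _ (ae_filter_ringOfSetsType mu)) => x /= hx /hx/eqP;
  rewrite subr_eq0 => /eqP.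
Qed.

Lemma du_bois_reymond_cont (z : R -> R) : continuous z ->
  (forall phi phi', tf phi -> (forall x, is_derive x 1 phi (phi' x)) ->
     Rint setT (fun x => z x * phi' x) = 0) ->
  exists c, forall x, z x = c.
Proof.
move=> cz h.
have hz a b : itg `[a, b] z by exact: itg_cont.
have [c hc] := du_bois_reymond (cont_mble cz) hz h.
have cc : continuous (fun x => z x - c).
  by apply: contB => // x; exact: cvg_cst.
exists c => x; apply/eqP; rewrite -subr_eq0; apply/eqP.
apply: (cont_Rint0 cc) => a b ab.
apply: test_Rint0 => //; first exact: cont_mble.
by move=> a' b'; exact: itg_cont.
Qed.

End TestFunctions.

(** * Reflections and even extensions *)

Section Reflection.
Context {R : realType}.
Local Notation mu := (@lebesgue_measure R).
Local Notation mset D := (@measurable _ (measurableTypeR R) D).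
Implicit Types (f g u : R -> R) (D : set R) (a b c x y : R).

Definition flip c : R -> measurableTypeR R := fun x => c - x.

Lemma flip_measurable c :
  @measurable_fun _ _ (measurableTypeR R) (measurableTypeR R) setT (flip c).
Proof. by apply: measurable_funB => //; exact: measurable_cst. Qed.

(** By uniqueness of the measure it is enough to compare on the intervals ]a, b], whose preimages [c
    - b, c - a[ have the same length. *)
Lemma lebesgue_measure_flip c (A : set R) : mset A ->
  pushforward mu (flip c) A = mu A.
Proof.
move=> mA; apply/esym/lebesgue_measure_unique => //=.
  exact: flip_measurable.
move=> _ _ [[a b]] _ <-.
rewrite /pushforward.
rewrite (_ : flip c @^-1` _ = `[c - b, c - a[%classic); last first.
  by apply/seteqP; split => x /=; rewrite /flip !in_itv/= => /andP[? ?]; lra.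
rewrite !lebesgue_measure_itv/= !lte_fin ltrD2l ltrN2.
by case: ifP => // _; rewrite !EFinN -!EFinB; congr EFin; ring.
Qed.

Lemma mble_flip c f : mble f -> mble (fun x => f (c - x)).
Proof. by move=> mf; exact: (measurableT_comp mf (flip_measurable c)). Qed.

Lemma itg_flip c f : itg setT f -> itg setT (fun x => f (c - x)).
Proof.
move=> hf; have mf := itg_mble hf.
apply/integrableP; split.
  by apply/measurable_EFinP; exact: mble_flip.
have /integrableP[_] := hf; apply: le_lt_trans.
rewrite le_eqVlt; apply/orP; left; apply/eqP.
have mn : measurable_fun setT (fun y : measurableTypeR R => `|f y|%:E).
  by apply/measurable_EFinP; exact: mble_norm.
rewrite -(@ge0_integral_pushforward _ _ _ _ _ _ (flip_measurable c) mu setT (fun y => `|f y|%:E))//.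
apply: eq_measure_integral; first exact: flip_measurable.
by move=> mA' A mA _; exact: lebesgue_measure_flip.
Qed.

Lemma Rint_flip c f : itg setT f -> Rint setT (fun x => f (c - x)) = Rint setT f.
Proof.
move=> hf; have mf := itg_mble hf.
rewrite /Rint /Rintegral; congr fine.
have := @integral_pushforward _ _ (measurableTypeR R) (measurableTypeR R) R
  (flip c) (flip_measurable c) mu setT (EFin \o f).
rewrite preimage_setT => <- //.
- apply: eq_measure_integral; first exact: flip_measurable.
  by move=> mA' A mA _; exact: lebesgue_measure_flip.
- exact/measurable_EFinP.
- exact: itg_flip.
Qed.

Lemma itg_restrict D f : mset D -> itg D f -> itg setT (f \_ D).
Proof.
move=> mD hf; rewrite /itg -restrict_EFin; apply/integrable_restrict => //.
by rewrite setTI.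
Qed.

Lemma itg_unrestrict D f : mset D -> itg setT (f \_ D) -> itg D f.
Proof.
move=> mD; rewrite /itg -restrict_EFin => h.
by have /integrable_restrict := h; rewrite setTI; exact.
Qed.

Lemma restrict_flip c (D D' : set R) f : (forall x, D x <-> D' (c - x)) ->
  (fun x => f (c - x)) \_ D = (fun x => (f \_ D') (c - x)).
Proof.
move=> h; apply/funext => x; rewrite /patch.
case: ifPn => [|/negP]; rewrite inE => hx; first by rewrite ifT// inE; exact/h.
by rewrite ifF//; apply/negP; rewrite inE => /h.
Qed.

Lemma itg_flip_on c D D' f : mset D -> mset D' -> (forall x, D x <-> D' (c - x)) ->
  itg D' f -> itg D (fun x => f (c - x)).
Proof.
move=> mD mD' h hf; apply: itg_unrestrict => //.
by rewrite (restrict_flip _ h); apply: itg_flip; exact: itg_restrict.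
Qed.

Lemma Rint_flip_on c D D' f : mset D -> mset D' -> (forall x, D x <-> D' (c - x)) ->
  itg D' f -> Rint D (fun x => f (c - x)) = Rint D' f.
Proof.
move=> mD mD' h hf.
rewrite (_ : Rint D _ = Rint setT ((fun x => f (c - x)) \_ D)); last exact: Rintegral_mkcond.
rewrite (restrict_flip _ h) (Rint_flip c (itg_restrict mD' hf)).
by rewrite /Rint -Rintegral_mkcond.
Qed.

Lemma H1_flip c u g : H1 u g -> H1 (fun x => u (c - x)) (fun x => - g (c - x)).
Proof.
move=> h; split.
- split.
  + by apply: mbleN; apply: mble_flip; exact: h1_dmble h.
  + move=> a b; apply: (@eq_itg _ _ (fun x => g (c - x) ^+ 2)) => //.
      by move=> x _; rewrite sqrrN.
    apply: (@itg_flip_on c _ `[c - b, c - a] (fun x => g x ^+ 2)) => //.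
      by move=> x /=; rewrite !in_itv/=; split => /andP[? ?]; lra.
    exact: ac_sq (h1_ac h) _ _.
  + move=> a b ab.
    have ig x y : itg `[x, y] g by exact: ac_itg (h1_ac h).
    have hh x : `[a, b]%classic x <-> `[c - b, c - a]%classic (c - x).
      by rewrite /= !in_itv/=; split => /andP[? ?]; lra.
    rewrite RintN//; last by apply: (itg_flip_on _ _ hh).
    rewrite (Rint_flip_on _ _ hh)// -(ac_ftc (h1_ac h)); first by ring.
    lra.
- exact: (itg_flip c (h1_fun h)).
- apply: (@eq_itg _ _ (fun x => g (c - x) ^+ 2)) => //.
    by move=> x _; rewrite sqrrN.
  exact: (itg_flip c (h1_der h)).
Qed.

(** The second ray is open so that 0 is counted once. *)
Lemma even_decomp f x : f `|x| = (f \_ `[0, +oo[) x + (f \_ `]0, +oo[) (0 - x).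
Proof.
rewrite /patch; case: (ltgtP x 0) => [x0|x0|->].
- rewrite ifF ?ifT ?add0r ?ltr0_norm//; last first.
    by apply/negbTE; rewrite notin_setE/= in_itv/= andbT => ?; lra.
  by rewrite inE/= in_itv/= andbT; lra.
- rewrite ifT ?ifF ?addr0 ?gtr0_norm//; last by rewrite inE/= in_itv/= andbT ltW.
  by apply/negbTE; rewrite notin_setE/= in_itv/= andbT => ?; lra.
- rewrite normr0 ifT; last by rewrite inE/= in_itv/= lexx.
  rewrite ifF ?addr0//.
  by apply/negbTE; rewrite notin_setE/= in_itv/= andbT => ?; lra.
Qed.

Lemma even_itg f : itg `[0, +oo[ f -> itg setT (fun x => f `|x|).
Proof.
move=> hf; have hf' : itg `]0, +oo[ f.
  by apply: itgS hf => //; apply: subset_itvr; rewrite bnd_simp.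
rewrite (_ : (fun x => _) = (fun x => (f \_ `[0, +oo[) x + (f \_ `]0, +oo[) (0 - x))).
  apply: itgD => //; first exact: itg_restrict.
  by apply: (@itg_flip 0 (f \_ `]0, +oo[)); exact: itg_restrict.
by apply/funext => x; exact: even_decomp.
Qed.

Lemma even_Rint f : itg `[0, +oo[ f ->
  Rint setT (fun x => f `|x|) = 2 * Rint `[0, +oo[ f.
Proof.
move=> hf; have hf' : itg `]0, +oo[ f.
  by apply: itgS hf => //; apply: subset_itvr; rewrite bnd_simp.
rewrite (_ : (fun x => _) = (fun x => (f \_ `[0, +oo[) x + (f \_ `]0, +oo[) (0 - x))).
  have h1 := itg_restrict (measurable_itv `[0, +oo[) hf.
  have h2 := itg_restrict (measurable_itv `]0, +oo[) hf'.
  rewrite RintD//; last exact: (itg_flip 0 h2).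
  rewrite (Rint_flip 0 h2) /Rint -!Rintegral_mkcond Rintegral_itv_obnd_cbnd//.
  by ring.
by apply/funext => x; exact: even_decomp.
Qed.

Definition evenext u x := u `|x|.
(** The derivative of an even function is odd; the value given at 0 does not matter, a single point
    being negligible. *)
Definition evenext' g x := if 0 <= x then g x else - g (- x).

Lemma evenext'_pos g x : 0 <= x -> evenext' g x = g x.
Proof. by move=> x0; rewrite /evenext' x0. Qed.

Lemma evenext'_neg g x : x < 0 -> evenext' g x = - g (0 - x).
Proof. by move=> x0; rewrite /evenext' leNgt x0 sub0r. Qed.

Lemma evenext'_decomp g x :
  evenext' g x = (g \_ `[0, +oo[) x - (g \_ `]0, +oo[) (0 - x).
Proof.
have [x0|x0] := leP 0 x.
- rewrite evenext'_pos// /patch ifT ?ifF ?subr0//; last by rewrite inE/= in_itv/= x0.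
  by apply/negbTE; rewrite notin_setE/= in_itv/= andbT => ?; lra.
- rewrite evenext'_neg// /patch ifF ?ifT ?sub0r//; last first.
    by apply/negbTE; rewrite notin_setE/= in_itv/= andbT => ?; lra.
  by rewrite inE/= in_itv/= andbT; lra.
Qed.

Lemma mble_evenext' g : mble g -> mble (evenext' g).
Proof.
move=> mg; rewrite (_ : evenext' g =
    (fun x => (g \_ `[0, +oo[) x - (g \_ `]0, +oo[) (0 - x))); last first.
  by apply/funext => x; exact: evenext'_decomp.
apply: mbleB; first exact: mble_restrict.
by apply: (@mble_flip 0 (g \_ `]0, +oo[)); exact: mble_restrict.
Qed.

Lemma evenext'_sq g x : evenext' g x ^+ 2 = g `|x| ^+ 2.
Proof.
have [x0|x0] := leP 0 x; first by rewrite evenext'_pos// ger0_norm.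
by rewrite evenext'_neg// ltr0_norm// sub0r sqrrN.
Qed.

Lemma Rint_co a b f : itg `[a, b] f -> Rint `[a, b] f = Rint `[a, b[ f.
Proof.
move=> hf; rewrite /Rint Rintegral_itv_bndo_bndc//.
by apply: itgS hf => //; apply: subset_itvl; rewrite bnd_simp.
Qed.

Lemma H1_evenext u g : H1 u g -> H1 (evenext u) (evenext' g).
Proof.
move=> h; have hac := h1_ac h.
have mg := h1_dmble h.
have sq : itg setT (fun x => evenext' g x ^+ 2).
  apply: (@eq_itg _ _ (fun x => g `|x| ^+ 2)) => //.
    by move=> x _; rewrite evenext'_sq.
  by apply: (@even_itg (fun x => g x ^+ 2)); apply: itgTS => //; exact: h1_der h.
have me := mble_evenext' mg.
have ie x y : itg `[x, y] (evenext' g).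
  by apply: itg_sq_itv => //; exact: itgTS.
have pos a b : 0 <= a -> a <= b -> Rint `[a, b] (evenext' g) = u b - u a.
  move=> a0 ab; rewrite (ac_ftc hac)//; apply: eq_Rint => x /=.
  by rewrite in_itv/= => /andP[ax _]; rewrite evenext'_pos// (le_trans a0).
have neg a b : a <= b -> b <= 0 -> Rint `[a, b] (evenext' g) = u (- b) - u (- a).
  move=> ab b0.
  have hh x : `[a, b]%classic x <-> `[0 - b, 0 - a]%classic (0 - x).
    by rewrite /= !in_itv/=; split => /andP[? ?]; lra.
  have ig x y : itg `[x, y] g by exact: ac_itg hac.
  have -> : u (- b) - u (- a) = Rint `[a, b] (fun x => - g (0 - x)).
    rewrite RintN//; last exact: (itg_flip_on _ _ hh).
    rewrite (Rint_flip_on _ _ hh)// -(ac_ftc hac); last lra.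
    by rewrite !sub0r; ring.
  have [b1|b1] := ltP b 0.
    apply: eq_Rint => x /=; rewrite in_itv/= => /andP[ax xb].
    by rewrite evenext'_neg//; lra.
  (* At the endpoint 0 the two integrands may disagree, g 0 against - g 0; passing to the half-open
     interval discards that point. *)
  have b2 : b = 0 by lra.
  have i0 x y : itg `[x, y] (fun x => - g (0 - x)).
    apply: itgN => //; apply: (@itg_flip_on 0 _ `[0 - y, 0 - x] g) => //.
    by move=> z; rewrite /= !in_itv/=; split => /andP[? ?]; lra.
  rewrite b2 (Rint_co (ie a 0)) (Rint_co (i0 a 0)).
  apply: eq_Rint => x /=; rewrite in_itv/= => /andP[ax xb].
  by rewrite evenext'_neg.
split => //.
- split => //; first by move=> a b; exact: itgTS.
  move=> a b ab; rewrite /evenext.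
  have [a0|a0] := leP 0 a.
    by rewrite pos// !ger0_norm// (le_trans a0).
  have [b0|b0] := leP b 0.
    by rewrite neg// (ltr0_norm a0) (ler0_norm b0).
  rewrite (@Rint_split _ a 0 b _ (ltW a0) (ltW b0))// (neg _ _ (ltW a0) (lexx 0)) (pos _ _ (lexx 0) (ltW b0)).
  by rewrite (ltr0_norm a0) (gtr0_norm b0) oppr0; ring.
- apply: (@even_itg (fun x => u x ^+ 2)).
  by apply: itgTS => //; exact: h1_fun h.
Qed.

End Reflection.

Module Energy.

(** * The Nehari functional and the level c *)

Section Functional.
Context {R : realType}.
Implicit Types (f g u v : R -> R) (D : set R) (a b c x y t s : R).

(* A candidate pair (su, sv) together with its derivatives (sg, sk). *)
Record st := St { su : R -> R; sg : R -> R; sv : R -> R; sk : R -> R }.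
Implicit Types w z : st.

Definition H1p w := H1 (su w) (sg w) /\ H1 (sv w) (sk w).

Definition sc t w := St (fun x => t * su w x) (fun x => t * sg w x)
  (fun x => t * sv w x) (fun x => t * sk w x).

Definition sadd w z := St (fun x => su w x + su z x) (fun x => sg w x + sg z x)
  (fun x => sv w x + sv z x) (fun x => sk w x + sk z x).

Definition sflip c w := St (fun x => su w (c - x)) (fun x => - sg w (c - x))
  (fun x => sv w (c - x)) (fun x => - sk w (c - x)).

Definition seven w := St (evenext (su w)) (evenext' (sg w))
  (evenext (sv w)) (evenext' (sk w)).

Lemma H1p_sc t w : H1p w -> H1p (sc t w).
Proof. by move=> [h k]; split; exact: H1_Z. Qed.
Lemma H1p_add w z : H1p w -> H1p z -> H1p (sadd w z).
Proof. by move=> [h k] [h' k']; split; exact: H1_D. Qed.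
Lemma H1p_flip c w : H1p w -> H1p (sflip c w).
Proof. by move=> [h k]; split; exact: H1_flip. Qed.
Lemma H1p_even w : H1p w -> H1p (seven w).
Proof. by move=> [h k]; split; exact: H1_evenext. Qed.

Variables (l1 l2 be : R).
Hypotheses (l1_gt0 : 0 < l1) (l2_gt0 : 0 < l2) (be_gt0 : 0 < be).

Definition dA w x := sg w x ^+ 2 + sk w x ^+ 2 + l1 * su w x ^+ 2 + l2 * sv w x ^+ 2.
Definition dC w x := su w x ^+ 4.
Definition dB w x := 2^-1 * sv w x ^+ 3 + 3 / 2 * be * (su w x ^+ 2 * sv w x).
Definition dPsi w x := dA w x - dB w x - dC w x.
Definition dI w x := 6^-1 * dA w x + 12^-1 * dC w x.

(* Psi w = Phi'(w) w and Phi = En + Psi / 3; on nontrivial critical points Phi = En. *)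
Definition mA w := Rint setT (dA w).
Definition mB w := Rint setT (dB w).
Definition mC w := Rint setT (dC w).
Definition Psi w := mA w - mB w - mC w.
Definition En w := 6^-1 * mA w + 12^-1 * mC w.

Lemma H1_bdd u g : H1 u g -> exists2 K : R, 0 < K & forall x, `|u x| <= K.
Proof.
move=> h; set S := 2 * (Rint setT (fun y => u y ^+ 2) + Rint setT (fun y => g y ^+ 2)).
have S0 : 0 <= S.
  by rewrite mulr_ge0// addr_ge0//; apply: Rint_ge0 => x _; exact: sqr_ge0.
exists (1 + S); first lra.
move=> x; have := H1_bound x h; rewrite -/S -real_normK ?num_real//.
have := sqr_ge0 (`|u x| - 1); nra.
Qed.

Lemma itg_dA w : H1p w -> itg setT (dA w).
Proof.
move=> [h k]; apply: itgD => //; last by apply: itgZ => //; exact: h1_fun k.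
apply: itgD => //; last by apply: itgZ => //; exact: h1_fun h.
by apply: itgD => //; [exact: h1_der h|exact: h1_der k].
Qed.

Lemma itg_bddP u v p K : H1 u v -> mble p -> (forall x, `|p x| <= K) ->
  itg setT (fun x => p x * u x ^+ 2).
Proof.
move=> h mp hp; apply: (itg_bddM _ mp _ hp) => //; last exact: h1_fun h.
by apply: mbleX; exact: h1_mble h.
Qed.

Lemma itg_dC w : H1p w -> itg setT (dC w).
Proof.
move=> [h k]; have [K K0 hK] := H1_bdd h.
apply: (@eq_itg _ _ (fun x => su w x ^+ 2 * su w x ^+ 2)) => //.
  by move=> x _; rewrite /dC -exprD.
apply: (itg_bddP (K := K ^+ 2) h); first by apply: mbleX; exact: h1_mble h.
by move=> x; rewrite normrX ler_pXn2r ?nnegrE// ltW.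
Qed.

Lemma itg_dB w : H1p w -> itg setT (dB w).
Proof.
move=> [h k]; have [K K0 hK] := H1_bdd k.
have mv := h1_mble k.
apply: itgD => //; apply: itgZ => //.
  apply: (@eq_itg _ _ (fun x => sv w x * sv w x ^+ 2)) => //.
  exact: itg_bddP k mv hK.
apply: (@eq_itg _ _ (fun x => sv w x * su w x ^+ 2)) => //.
  by move=> x _; rewrite mulrC.
exact: itg_bddP h mv hK.
Qed.

Lemma itg_dPsi w : H1p w -> itg setT (dPsi w).
Proof.
move=> h; apply: itgB => //; last exact: itg_dC.
by apply: itgB => //; [exact: itg_dA|exact: itg_dB].
Qed.

Lemma itg_dI w : H1p w -> itg setT (dI w).
Proof.
by move=> h; apply: itgD => //; apply: itgZ => //; [exact: itg_dA|exact: itg_dC].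
Qed.

Lemma PsiE w : H1p w -> Psi w = Rint setT (dPsi w).
Proof.
move=> h; have iA := itg_dA h; have iB := itg_dB h; have iC := itg_dC h.
by rewrite RintB//; [rewrite RintB|exact: itgB].
Qed.

Lemma EnE w : H1p w -> En w = Rint setT (dI w).
Proof.
move=> h; have iA := itg_dA h; have iC := itg_dC h.
by rewrite RintD//; [rewrite !RintZ|exact: itgZ|exact: itgZ].
Qed.

Lemma dA_ge0 w x : 0 <= dA w x.
Proof. by rewrite !addr_ge0// ?sqr_ge0// mulr_ge0 ?sqr_ge0// ltW. Qed.
Lemma dC_ge0 w x : 0 <= dC w x.
Proof. by rewrite /dC exprn_even_ge0. Qed.
Lemma dI_ge0 w x : 0 <= dI w x.
Proof. by rewrite addr_ge0// mulr_ge0// ?dA_ge0 ?dC_ge0. Qed.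
Lemma mA_ge0 w : 0 <= mA w.
Proof. by apply: Rint_ge0 => x _; exact: dA_ge0. Qed.
Lemma mC_ge0 w : 0 <= mC w.
Proof. by apply: Rint_ge0 => x _; exact: dC_ge0. Qed.
Lemma En_ge0 w : 0 <= En w.
Proof. by rewrite addr_ge0// mulr_ge0// ?mA_ge0 ?mC_ge0. Qed.

Lemma mA_sc t w : H1p w -> mA (sc t w) = t ^+ 2 * mA w.
Proof.
move=> h; rewrite -RintZ//; last exact: itg_dA.
by apply: eq_Rint => x _; rewrite /dA /=; ring.
Qed.
Lemma mB_sc t w : H1p w -> mB (sc t w) = t ^+ 3 * mB w.
Proof.
move=> h; rewrite -RintZ//; last exact: itg_dB.
by apply: eq_Rint => x _; rewrite /dB /=; ring.
Qed.
Lemma mC_sc t w : H1p w -> mC (sc t w) = t ^+ 4 * mC w.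
Proof.
move=> h; rewrite -RintZ//; last exact: itg_dC.
by apply: eq_Rint => x _; rewrite /dC /=; ring.
Qed.

Lemma h1_eq0 u g : H1 u g -> Rint setT (fun x => u x ^+ 2) <= 0 -> forall x, u x = 0.
Proof.
move=> h h0 x; apply/eqP; rewrite -sqrf_eq0 eq_le sqr_ge0 andbT leNgt.
apply/negP => ux; have := @Rint_gt0 _ (fun x => u x ^+ 2) x.
move=> /(_ (contX (h1_cont h)) (h1_fun h) (fun x => sqr_ge0 _) ux); lra.
Qed.

Lemma mA_ge w : H1p w ->
  l1 * Rint setT (fun x => su w x ^+ 2) <= mA w /\
  l2 * Rint setT (fun x => sv w x ^+ 2) <= mA w.
Proof.
move=> hw; have iA := itg_dA hw; case: hw => h k.
have iu := h1_fun h; have iv := h1_fun k.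
split; rewrite -RintZ//; apply: Rint_le => //; try exact: itgZ.
- move=> x _; rewrite /dA.
  have := sqr_ge0 (sg w x); have := sqr_ge0 (sk w x).
  have : 0 <= l2 * sv w x ^+ 2 by rewrite mulr_ge0 ?sqr_ge0// ltW.
  lra.
- move=> x _; rewrite /dA.
  have := sqr_ge0 (sg w x); have := sqr_ge0 (sk w x).
  have : 0 <= l1 * su w x ^+ 2 by rewrite mulr_ge0 ?sqr_ge0// ltW.
  lra.
Qed.

Lemma mA_eq0 w : H1p w -> mA w <= 0 -> (forall x, su w x = 0) /\ (forall x, sv w x = 0).
Proof.
move=> hw h0; have [e1 e2] := mA_ge hw; case: (hw) => h k; split.
- apply: (h1_eq0 h); rewrite -(pmulr_rle0 _ l1_gt0); lra.
- apply: (h1_eq0 k); rewrite -(pmulr_rle0 _ l2_gt0); lra.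
Qed.

Lemma mA_gt0 w : H1p w -> Psi w < 0 -> 0 < mA w.
Proof.
move=> hw hP; rewrite ltNge; apply/negP => h0.
have [u0 v0] := mA_eq0 hw h0.
move: hP; rewrite PsiE// ltNge => /negP; apply; apply: Rint_ge0 => x _.
rewrite /dPsi /dB /dC u0 v0 !expr0n /= !mul0r !mulr0 addr0 !subr0; exact: dA_ge0.
Qed.

(** The strict inequality survives small perturbations, which a constraint Psi = 0 would not; states
    with Psi = 0 are recovered by scaling in [cinf_le0]. *)
Definition adm : set R := [set En w | w in [set w | H1p w /\ Psi w < 0]].
Definition cinf := inf adm.

Lemma adm_lb : lbound adm 0.
Proof. by move=> _ [w _ <-]; exact: En_ge0. Qed.

Lemma cinf_le w : H1p w -> Psi w < 0 -> cinf <= En w.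
Proof.
move=> h k; apply: ge_inf; first by exists 0; exact: adm_lb.
by exists w.
Qed.

Lemma cinf_near w0 e : H1p w0 -> Psi w0 < 0 -> 0 < e ->
  exists w, [/\ H1p w, Psi w < 0 & En w < cinf + e].
Proof.
move=> h k e0; have hi : has_inf adm.
  by split; [exists (En w0); exists w0|exists 0; exact: adm_lb].
have [_ [w [hw kw] <-] lt] := inf_adherent e0 hi.
by exists w.
Qed.

(** Divided by t^2, [Psi] at t w is A - t B - t^2 C. When A > 0 and A <= B + C this is negative for
    every t > 1, while the energy varies continuously with t. *)
Lemma cinf_le0 w : H1p w -> 0 < mA w -> Psi w <= 0 -> cinf <= En w.
Proof.
move=> hw A0 P0; have C0 := mC_ge0 w; have E0 := En_ge0 w.
apply/ler_addgt0Pr => e e0.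
(* The 15 = 4 + 6 + 4 + 1 comes from (1 + s)^4 <= 1 + 15 s on [0, 1]; the energy then grows by at
   most 15 s En w <= e. *)
pose s := Num.min 1 (e / (15 * (En w + 1))).
have s0 : 0 < s by rewrite lt_min ltr01 divr_gt0// mulr_gt0//; lra.
have s1 : s <= 1 by rewrite ge_min lexx.
have s2 : s * (15 * (En w + 1)) <= e.
  by rewrite -ler_pdivlMr ?ge_min ?lexx ?orbT// mulr_gt0//; lra.
have hP : Psi (sc (1 + s) w) < 0.
  rewrite /Psi mA_sc// mB_sc// mC_sc//.
  move: P0; rewrite /Psi => P0.
  have -> : (1 + s) ^+ 2 * mA w - (1 + s) ^+ 3 * mB w - (1 + s) ^+ 4 * mC w =
    (1 + s) ^+ 2 * (mA w - (1 + s) * (mB w + mC w) - s * (1 + s) * mC w) by ring.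
  rewrite pmulr_rlt0; last by rewrite exprn_gt0//; lra.
  have : 0 <= s * (1 + s) * mC w by rewrite !mulr_ge0//; lra.
  nra.
apply: le_trans (cinf_le (H1p_sc _ hw) hP) _.
rewrite /En mA_sc// mC_sc//.
have A1 : (1 + s) ^+ 2 <= 1 + 15 * s by nra.
have A2 : (1 + s) ^+ 4 <= 1 + 15 * s.
  have : s ^+ 2 <= s by nra.
  have : s ^+ 3 <= s by rewrite -[leRHS]expr1; apply: ler_wiXn2l => //; lra.
  have : s ^+ 4 <= s by rewrite -[leRHS]expr1; apply: ler_wiXn2l => //; lra.
  have -> : (1 + s) ^+ 4 = 1 + 4 * s + 6 * s ^+ 2 + 4 * s ^+ 3 + s ^+ 4 by ring.
  lra.
apply: (@le_trans _ _ ((1 + 15 * s) * En w)).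
  rewrite /En; have : (1 + s) ^+ 2 * mA w <= (1 + 15 * s) * mA w by rewrite ler_wpM2r// ltW.
  have : (1 + s) ^+ 4 * mC w <= (1 + 15 * s) * mC w by rewrite ler_wpM2r.
  lra.
rewrite mulrDl mul1r lerD2l; apply: le_trans s2.
have -> : s * (15 * (En w + 1)) = 15 * s * En w + 15 * s by ring.
by rewrite lerDl mulr_ge0// ltW.
Qed.

(** Scaling by 1 - s keeps [Psi] negative for small s and strictly lowers the energy. Hence the
    infimum is not attained where Psi < 0, and a minimizer found under Psi <= 0 satisfies Psi =
    0. *)
Lemma cinf_lt w : H1p w -> Psi w < 0 -> cinf < En w.
Proof.
move=> hw P0; have A0 := mA_gt0 hw P0; have C0 := mC_ge0 w.
have E0 : 0 < En w by rewrite /En; lra.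
pose N := 1 + `|mB w| + mC w.
have N1 : 1 <= N by rewrite /N; have := normr_ge0 (mB w); lra.
(* After division by (1 - s)^2, [Psi] changes by s B + s (2 - s) C, which is at most 2 s N, hence at
   most half of - Psi w. *)
pose s := Num.min 2^-1 (- Psi w / (4 * N)).
have s0 : 0 < s by rewrite lt_min invr_gt0 ltr0n /= divr_gt0//; lra.
have s1 : s <= 2^-1 by rewrite ge_min lexx.
have s2 : s * (4 * N) <= - Psi w.
  by rewrite -ler_pdivlMr ?ge_min ?lexx ?orbT//; lra.
have hP : Psi (sc (1 - s) w) < 0.
  rewrite /Psi mA_sc// mB_sc// mC_sc//.
  have -> : (1 - s) ^+ 2 * mA w - (1 - s) ^+ 3 * mB w - (1 - s) ^+ 4 * mC w =
    (1 - s) ^+ 2 * (Psi w + s * (mB w) + s * (2 - s) * mC w) by rewrite /Psi; ring.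
  rewrite pmulr_rlt0; last by rewrite exprn_gt0//; lra.
  have : s * mB w <= s * `|mB w| by rewrite ler_pM2l// ler_norm.
  have : s * (2 - s) * mC w <= s * 2 * mC w by apply: ler_wpM2r => //; nra.
  have s3 : 4 * s + 4 * (s * `|mB w|) + 4 * (s * mC w) <= - Psi w.
    by apply: le_trans s2; rewrite /N le_eqVlt; apply/orP; left; apply/eqP; ring.
  have s4 : 0 <= s * `|mB w| by rewrite mulr_ge0// ltW.
  have s5 : 0 <= s * mC w by rewrite mulr_ge0// ltW.
  lra.
apply: le_lt_trans (cinf_le (H1p_sc _ hw) hP) _.
rewrite /En mA_sc// mC_sc//.
have : (1 - s) ^+ 2 < 1 by nra.
have : (1 - s) ^+ 4 <= 1 by apply: exprn_ile1; lra.
move=> h4 h2.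
have : (1 - s) ^+ 2 * mA w < mA w by rewrite -[ltRHS]mul1r ltr_pM2r.
have : (1 - s) ^+ 4 * mC w <= mC w by rewrite -[leRHS]mul1r ler_wpM2r.
lra.
Qed.

Lemma dens_flip c w x : dPsi (sflip c w) x = dPsi w (c - x) /\
  dI (sflip c w) x = dI w (c - x).
Proof. by rewrite /dPsi /dI /dA /dB /dC /= !sqrrN. Qed.

Lemma dens_even w x : dPsi (seven w) x = dPsi w `|x| /\ dI (seven w) x = dI w `|x|.
Proof. by rewrite /dPsi /dI /dA /dB /dC /= /evenext !evenext'_sq. Qed.

(** Below this threshold the quadratic part absorbs the rest: u^4 + (3/2) be u^2 v <= del (1 + 2 be)
    u^2 <= l1 u^2 and v^3 / 2 <= del v^2 <= l2 v^2. The bound by 1 serves to get u^2 <= del from |u|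
    <= del. *)
Definition del := Num.min 1 (Num.min (l1 / (1 + 2 * be)) l2).

Lemma del_gt0 : 0 < del.
Proof.
rewrite !lt_min ltr01 l2_gt0 andbT /=; apply: divr_gt0 => //.
by have := be_gt0; lra.
Qed.

Lemma dPsi_small w x : `|su w x| <= del -> `|sv w x| <= del -> 0 <= dPsi w x.
Proof.
have d0 := del_gt0.
have [p1 p2 p3] : [/\ 0 < l1, 0 < l2 & 0 < be] by [].
have d1 : del <= 1 by rewrite ge_min lexx.
have d2 : del * (1 + 2 * be) <= l1.
  rewrite -ler_pdivlMr; last lra.
  by rewrite !ge_min lexx orbT.
have d3 : del <= l2 by rewrite !ge_min lexx !orbT.
rewrite !ler_norml => /andP[u1 u2] /andP[v1 v2].
rewrite /dPsi /dA /dB /dC.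
set U := su w x in u1 u2 *; set V := sv w x in v1 v2 *.
have := sqr_ge0 (sg w x); have := sqr_ge0 (sk w x).
have U2 : U ^+ 2 <= del.
  have h1 : 0 <= (del - U) * (del + U) by apply: mulr_ge0; lra.
  have h2 : 0 <= del * (1 - del) by apply: mulr_ge0; lra.
  have -> : U ^+ 2 = del - (del - U) * (del + U) - del * (1 - del) by ring.
  lra.
have U0 : 0 <= U ^+ 2 by exact: sqr_ge0.
have V0 : 0 <= V ^+ 2 by exact: sqr_ge0.
have a1 : U ^+ 4 <= U ^+ 2 * del.
  by rewrite (_ : U ^+ 4 = U ^+ 2 * U ^+ 2); [rewrite ler_wpM2l|ring].
have a2 : V ^+ 3 <= V ^+ 2 * del.
  by rewrite (_ : V ^+ 3 = V ^+ 2 * V); [rewrite ler_wpM2l|ring].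
have a3 : U ^+ 2 * V <= U ^+ 2 * del by rewrite ler_wpM2l.
have a4 : be * (U ^+ 2 * V) <= be * (U ^+ 2 * del) by rewrite ler_pM2l.
have a5 : U ^+ 2 * (del * (1 + 2 * be)) <= U ^+ 2 * l1 by rewrite ler_wpM2l.
have a6 : V ^+ 2 * del <= V ^+ 2 * l2 by rewrite ler_wpM2l.
have a7 : 0 <= be * (U ^+ 2 * del) by apply: mulr_ge0; [exact: ltW|apply: mulr_ge0 => //; exact: ltW].
have a8 : 0 <= V ^+ 2 * l2 by apply: mulr_ge0 => //; exact: ltW.
have a9 : U ^+ 2 * (del * (1 + 2 * be)) = U ^+ 2 * del + 2 * (be * (U ^+ 2 * del)) by ring.
lra.
Qed.

End Functional.

End Energy.
Import Energy.

(** * Cutting and reflecting a near-minimizer *)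

Section Symmetrize.
Context {R : realType}.
Implicit Types (f g u v : R -> R) (D : set R) (a b c x y t s : R) (w z : @st R).
Variables (l1 l2 be : R).
Hypotheses (l1_gt0 : 0 < l1) (l2_gt0 : 0 < l2) (be_gt0 : 0 < be).
Local Notation dPsi := (dPsi l1 l2 be).
Local Notation dI := (dI l1 l2).
Local Notation Psi := (Psi l1 l2 be).
Local Notation En := (En l1 l2).
Local Notation del := (del l1 l2 be).
Local Notation cinf := (cinf l1 l2 be).

Lemma Rint_ray_cont f : itg setT f -> continuous (fun x => Rint `[x, +oo[ f).
Proof.
move=> hf x.
have ia a : itg `[a, +oo[ f by exact: itgTS.
have iab a b : itg `[a, b] f by exact: itgTS.
have lt1 : x - 1 <= x + 1 by lra.
have /(_ (iab _ _)) := @parameterized_integral_continuous R (x - 1) (x + 1) f lt1.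
have lt2 : x - 1 < x + 1 by lra.
move=> /(continuous_within_itvP _ lt2)[cin _ _].
have {}cin : {for x, continuous (fun y => Rint `[x - 1, y] f)}.
  by apply: cin; rewrite in_itv/=; lra.
have : {for x, continuous (fun y => Rint `[x - 1, +oo[ f - Rint `[x - 1, y] f)}.
  by apply: continuousB => //; exact: cvg_cst.
move=> h.
apply: cvg_trans; last first.
  have -> : Rint `[x, +oo[ f = Rint `[x - 1, +oo[ f - Rint `[x - 1, x] f.
    by rewrite (@Rint_split_ray _ (x - 1) x)//; [ring|lra].
  exact: h.
apply: near_eq_cvg; near=> y.
rewrite (@Rint_split_ray _ (x - 1) y)//; first by ring.
by apply: ltW; near: y; apply: lt_nbhsr; lra.
Unshelve. all: by end_near. Qed.

Lemma Psi_even w : H1p w -> Psi (seven w) = 2 * Rint `[0, +oo[ (dPsi w).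
Proof.
move=> h; rewrite PsiE; last exact: H1p_even.
rewrite -even_Rint; last by apply: itgTS => //; exact: itg_dPsi.
by apply: eq_Rint => x _; case: (dens_even l1 l2 be w x).
Qed.

Lemma En_even w : H1p w -> En (seven w) = 2 * Rint `[0, +oo[ (dI w).
Proof.
move=> h; rewrite EnE; last exact: H1p_even.
rewrite -even_Rint; last by apply: itgTS => //; exact: itg_dI.
by apply: eq_Rint => x _; case: (dens_even l1 l2 be w x).
Qed.

(** The part of [w] on ]-oo, m], reflected at m, with m moved to the origin. *)
Definition sleft m w := seven (sflip m w).
(** Two flips compose to the translation x -> w (m + x), whose right half is then reflected. *)
Definition sright m w := seven (sflip 0 (sflip m w)).

Lemma sleftE m w : H1p w ->
  Psi (sleft m w) = 2 * Rint `]-oo, m] (dPsi w) /\ En (sleft m w) = 2 * Rint `]-oo, m] (dI w).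
Proof.
move=> h; have hf := H1p_flip m h.
have hh x : `[0, +oo[%classic x <-> `]-oo, m]%classic (m - x).
  by rewrite /= !in_itv/= andbT; split; lra.
split.
- rewrite Psi_even//; congr (_ * _).
  rewrite -(Rint_flip_on _ _ hh)//; last by apply: itgTS => //; exact: itg_dPsi.
  by apply: eq_Rint => x _; case: (dens_flip l1 l2 be m w x).
- rewrite En_even//; congr (_ * _).
  rewrite -(Rint_flip_on _ _ hh)//; last by apply: itgTS => //; exact: itg_dI.
  by apply: eq_Rint => x _; case: (dens_flip l1 l2 be m w x).
Qed.

Lemma srightE m w : H1p w ->
  Psi (sright m w) = 2 * Rint `[m, +oo[ (dPsi w) /\ En (sright m w) = 2 * Rint `[m, +oo[ (dI w).
Proof.
move=> h; have hf := H1p_flip m h; have hf2 := H1p_flip 0 hf.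
have h1 x : `[0, +oo[%classic x <-> `]-oo, 0]%classic (0 - x).
  by rewrite /= !in_itv/= andbT; split; lra.
have h2 x : `]-oo, 0]%classic x <-> `[m, +oo[%classic (m - x).
  by rewrite /= !in_itv/= andbT; split; lra.
have i1 : itg `[m, +oo[ (dPsi w) by apply: itgTS => //; exact: itg_dPsi.
have i2 : itg `[m, +oo[ (dI w) by apply: itgTS => //; exact: itg_dI.
split.
- rewrite Psi_even//; congr (_ * _).
  rewrite -(Rint_flip_on _ _ h2)// -(Rint_flip_on _ _ h1)//; last exact: (itg_flip_on _ _ h2).
  apply: eq_Rint => x _; case: (dens_flip l1 l2 be 0 (sflip m w) x) => -> _.
  by case: (dens_flip l1 l2 be m w (0 - x)) => -> _.
- rewrite En_even//; congr (_ * _).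
  rewrite -(Rint_flip_on _ _ h2)// -(Rint_flip_on _ _ h1)//; last exact: (itg_flip_on _ _ h2).
  apply: eq_Rint => x _; case: (dens_flip l1 l2 be 0 (sflip m w) x) => _ ->.
  by case: (dens_flip l1 l2 be m w (0 - x)) => _ ->.
Qed.

Definition is_even f := forall x, f (- x) = f x.

Lemma cont_ball f x e : continuous f -> 0 < e ->
  exists2 d, 0 < d & forall y, `|x - y| < d -> `|f x - f y| < e.
Proof.
by move=> cf e0; have := cf x => /cvgrPdist_lt /(_ e e0) [d d0 hd]; exists d.
Qed.

(* m is the supremum of the x with negative integral over [x, +oo[; dPsi takes negative
   values arbitrarily near m, so w is not small there. *)
Lemma cut_point w : H1p w -> Psi w < 0 ->
  exists m, Rint `[m, +oo[ (dPsi w) = 0 /\ (del <= `|su w m| \/ del <= `|sv w m|).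
Proof.
move=> hw P0.
have hi := itg_dPsi l1 l2 be hw.
pose F x := Rint `[x, +oo[ (dPsi w).
have cF : continuous F by exact: Rint_ray_cont.
have ia a : itg `[a, +oo[ (dPsi w) by exact: itgTS.
have d0 := del_gt0 l1_gt0 l2_gt0 be_gt0.
pose T := [set x | F x < 0].
have [M M0 hM] : exists2 M, 0 < M & forall x, M <= `|x| -> 0 <= dPsi w x.
  case: (hw) => h k.
  have [M1 M10 hM1] := H1_decay h d0; have [M2 M20 hM2] := H1_decay k d0.
  exists (M1 + M2); first lra.
  move=> x Mx; apply: (dPsi_small l1_gt0 l2_gt0 be_gt0); apply: ltW.
    by apply: hM1; lra.
  by apply: hM2; lra.
have Tub : ubound T M.
  move=> x; rewrite /T /=; apply: contraPP => /negP; rewrite -ltNge => Mx.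
  apply/negP; rewrite -leNgt; apply: Rint_ge0 => y /=; rewrite in_itv/= andbT => xy.
  by apply: hM; rewrite ler_normr; apply/orP; left; lra.
have T0 : T !=set0.
  exists (- M); rewrite /T /= /F.
  have := Rint_splitT (- M) hi; rewrite -PsiE// => e.
  have : 0 <= Rint `]-oo, - M] (dPsi w).
    apply: Rint_ge0 => y /=; rewrite in_itv/= => xy.
    by apply: hM; rewrite ler_normr; apply/orP; right; lra.
  lra.
have hs : has_sup T by split => //; exists M.
pose m := sup T.
have mub x : F x < 0 -> x <= m by move=> hx; apply: ub_le_sup => //; exists M.
have madh d : 0 < d -> exists x, [/\ F x < 0, m - d < x & x <= m].
  move=> d1; have [x hx xm] := sup_adherent d1 hs.
  by exists x; split => //; exact: mub.
have Fm : F m = 0.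
  apply/eqP; rewrite eq_le; apply/andP; split; rewrite leNgt; apply/negP => Fm.
  - have [d d1 hd] := cont_ball m cF Fm.
    have [x [Fx mx xm]] := madh _ d1.
    have xd : `|m - x| < d by rewrite ger0_norm ?subr_ge0//; lra.
    by have := hd x xd; rewrite ltr_norml => /andP[]; lra.
  - have Fm' : 0 < - F m by lra.
    have [d d1 hd] := cont_ball m cF Fm'.
    have xd : `|m - (m + d / 2)| < d by rewrite ltr_norml; apply/andP; split; lra.
    have := hd _ xd; rewrite ltr_norml => /andP[h1 h2].
    by have := mub (m + d / 2); lra.
exists m; split => //.
have [ud|ud] := leP del `|su w m|; first by left.
have [vd|vd] := leP del `|sv w m|; first by right.
exfalso; case: (hw) => h k.
have ud' : 0 < del - `|su w m| by lra.
have vd' : 0 < del - `|sv w m| by lra.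
have [d1 d10 hd1] := cont_ball m (h1_cont h) ud'.
have [d2 d20 hd2] := cont_ball m (h1_cont k) vd'.
have dmin : 0 < Num.min d1 d2 by rewrite lt_min d10.
have [x [Fx mx xm]] := madh _ dmin.
have : 0 <= F x.
  rewrite /F (Rint_split_ray xm)// -/(F m) Fm addr0.
  apply: Rint_ge0 => y /=; rewrite in_itv/= => /andP[xy ym].
  have my : `|m - y| < Num.min d1 d2 by rewrite ger0_norm ?subr_ge0//; lra.
  move: my; rewrite lt_min => /andP[my1 my2].
  apply: (dPsi_small l1_gt0 l2_gt0 be_gt0).
    have := hd1 _ my1; have := ler_normB (su w m) (su w m - su w y).
    by rewrite subKr; lra.
  have := hd2 _ my2; have := ler_normB (sv w m) (sv w m - sv w y).
  by rewrite subKr; lra.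
lra.
Qed.

(** The two reflections have values of [Psi] adding up to 2 Psi w and energies adding up to 2 En w.
    Since the right one has Psi = 0, the left one has Psi = 2 Psi w < 0 and takes at least [cinf] of
    the total energy. *)
Lemma symmetrize w : H1p w -> Psi w < 0 ->
  exists z, [/\ H1p z, is_even (su z) /\ is_even (sv z), Psi z = 0,
    del <= `|su z 0| \/ del <= `|sv z 0| & En z <= 2 * En w - cinf].
Proof.
move=> hw P0; have [m [F0 hm]] := cut_point hw P0.
have [r1 r2] := srightE m hw; have [s1 s2] := sleftE m hw.
have eP := Rint_splitT m (itg_dPsi l1 l2 be hw).
have eI := Rint_splitT m (itg_dI l1 l2 hw).
rewrite -PsiE// in eP; rewrite -EnE// in eI.
have hl : H1p (sleft m w) by apply: H1p_even; exact: H1p_flip.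
exists (sright m w); split.
- by apply: H1p_even; apply: H1p_flip; exact: H1p_flip.
- by split => x; rewrite /= /evenext normrN.
- by rewrite r1 F0 mulr0.
- by rewrite /= /evenext normr0 !subr0.
- have Pl : Psi (sleft m w) < 0 by rewrite s1; lra.
  by have := cinf_le l1_gt0 l2_gt0 hl Pl; rewrite r2 eI s2; lra.
Qed.

End Symmetrize.

(** * Minimizing sequences *)

Section Selection.
Context {R : realType}.
Implicit Types (x y : R).

(** An ultrafilter converges to any of its cluster points, and compactness supplies one. [selection]
    thus obtains its limit at every x at once. *)
Lemma ultra_cvg (U : set_system nat) (a : nat -> R) (M : R) : UltraFilter U ->
  (forall n, `|a n| <= M) -> exists l, a n @[n --> U] --> (l : R).
Proof.
move=> UU aM.
have FM : (a @ U) [set` `[- M, M]].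
  by apply: (@filterS _ U _ setT _ _ filterT) => n _ /=; rewrite in_itv/= -ler_norml.
have [l [_ hl]] := @segment_compact R (- M) M _ (fmap_proper_filter a (@ultra_proper _ _ UU)) FM.
exists l; move=> B nB.
have [//|h] := in_ultra_setVsetC (a @^-1` B) UU.
have [y [/= nBy By]] := hl (~` B) B h nB.
by [].
Qed.

(* Arzela-Ascoli by hand: the ultralimit is approximated on finer and finer grids. *)
Lemma selection (f_ : nat -> R -> R) (M : R) :
  (forall n x, `|f_ n x| <= M) ->
  (forall n x y, x <= y -> (f_ n y - f_ n x) ^+ 2 <= (y - x) * M) ->
  exists s : nat -> nat, (forall n, n <= s n)%N /\
    exists f, forall x, f_ (s n) x @[n --> \oo] --> (f x : R).
Proof.
move=> fM fH.
have M0 : 0 <= M by exact: le_trans (normr_ge0 _) (fM 0%N 0).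
have [U [UU sU]] := @ultraFilterLemma _ _ eventually_filter.
have [f hf] := choice (fun x => ultra_cvg UU (fun n => fM n x)).
have fHf x y : x <= y -> (f y - f x) ^+ 2 <= (y - x) * M.
  move=> xy.
  have h : (f_ n y - f_ n x) ^+ 2 @[n --> U] --> (f y - f x) ^+ 2.
    by rewrite !expr2; apply: cvgM; apply: cvgB.
  apply: (cvgr_to_le h); near=> n; exact: fH.
(* The points k/(j+1) - (j+1) with k <= 2 (j+1)^2 form a grid of mesh 1/(j+1) covering
   [-(j+1), j+1]. Only finitely many conditions are imposed for each j, so some n >= j meets them
   all. *)
have key (j : nat) : exists n, (j <= n)%N /\ forall k : 'I_((j.+1 * j.+1).*2.+1),
   let p := k%:R / j.+1%:R - j.+1%:R in `|f p - f_ n p| < j.+1%:R^-1.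
  have : \forall n \near U, (j <= n)%N /\ forall k : 'I_((j.+1 * j.+1).*2.+1),
      let p := k%:R / j.+1%:R - j.+1%:R in `|f p - f_ n p| < j.+1%:R^-1.
    apply: filterI; first by apply: sU; exact: nbhs_infty_ge.
    apply: filter_forall => k /=.
    by apply: (@cvgr_dist_lt _ _ _ _ _ _ _ (hf _)); rewrite invr_gt0.
  by move=> /filter_ex.
have [s hs] := choice key.
exists s; split; first by move=> n; case: (hs n).
exists f => x; apply/cvgrPdist_lt => e e0.
have e3 : 0 < e / 3 by rewrite divr_gt0.
near=> j.
have j0 : 0 < j.+1%:R :> R by [].
have jx : `|x| <= j.+1%:R.
  by apply: (@le_trans _ _ j%:R); [near: j; exact: nbhs_infty_ger|rewrite ler_nat].
have je : j.+1%:R^-1 < e / 3.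
  rewrite -[ltRHS]invrK ltf_pV2 ?posrE ?invr_gt0//.
  by apply: (@lt_trans _ _ j%:R); [near: j; exact: nbhs_infty_gtr|rewrite ltr_nat].
have jM : j.+1%:R^-1 * M < (e / 3) ^+ 2.
  rewrite mulrC ltr_pdivrMr// mulrC -ltr_pdivrMr ?exprn_gt0//.
  by apply: (@lt_trans _ _ j%:R); [near: j; exact: nbhs_infty_gtr|rewrite ltr_nat].
move: jx; rewrite ler_norml => /andP[x1 x2].
pose q := (x + j.+1%:R) * j.+1%:R.
have q0 : 0 <= q by rewrite mulr_ge0//; lra.
have /andP[q1 q2] := truncn_itv q0.
have kP : (Num.truncn q < (j.+1 * j.+1).*2.+1)%N.
  rewrite ltnS -(ler_nat R); apply: le_trans q1 _.
  rewrite -muln2 !natrM /q.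
  have -> : j.+1%:R * j.+1%:R * 2 = (2 * j.+1%:R) * j.+1%:R :> R by ring.
  by rewrite ler_wpM2r//; lra.
have [_ /(_ (Ordinal kP))] := hs j.
set p := (_ / _ - _); rewrite /= => hp.
have px : p <= x by rewrite /p lerBlDr ler_pdivrMr.
have xp : x - p <= j.+1%:R^-1.
  rewrite /p.
  have : x + j.+1%:R <= (Num.truncn q).+1%:R / j.+1%:R by rewrite ler_pdivlMr// ltW.
  have -> : (Num.truncn q).+1%:R / j.+1%:R = (Num.truncn q)%:R / j.+1%:R + j.+1%:R^-1 :> R.
    by rewrite -[in LHS](addn1 (Num.truncn q)) natrD mulrDl mul1r.
  move: (j.+1%:R^-1) (_ / _) => r k'; lra.
have small g : (forall x y, x <= y -> (g y - g x) ^+ 2 <= (y - x) * M) -> `|g x - g p| < e / 3.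
  move=> hg; rewrite -(@ltr_pXn2r _ 2)// ?nnegrE//; last exact: ltW.
  rewrite real_normK ?num_real//; apply: le_lt_trans (hg _ _ px) _.
  by apply: le_lt_trans jM; rewrite ler_wpM2r.
have h3 := lt_trans hp je.
have h1 := small f fHf; have h2 := small _ (fH (s j)).
have -> : f x - f_ (s j) x = (f x - f p) + (f p - f_ (s j) p) - (f_ (s j) x - f_ (s j) p) by ring.
apply: le_lt_trans (ler_normB _ _) _.
have h4 := ler_normD (f x - f p) (f p - f_ (s j) p).
have -> : e = e / 3 + e / 3 + e / 3 by field.
by apply: ltrD => //; apply: le_lt_trans h4 _; exact: ltrD.
Unshelve. all: by end_near. Qed.

Lemma selection_scalar (a : nat -> R) (M : R) : (forall n, `|a n| <= M) ->
  exists s : nat -> nat, (forall n, n <= s n)%N /\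
    exists l, a (s n) @[n --> \oo] --> (l : R).
Proof.
move=> aM.
have M0 : 0 <= M by exact: le_trans (normr_ge0 _) (aM 0%N).
have [||s [hs [f hf]]] := @selection (fun n _ => a n) M; first by move=> n _.
  by move=> n x y xy; rewrite subrr expr0n /= mulr_ge0// subr_ge0.
by exists s; split => //; exists (f 0); exact: hf.
Qed.

(** [s] need not be increasing: n <= s n is enough for convergence to persist, and it is what
    [selection] provides. *)
Lemma cvg_subseq (a : nat -> R) (s : nat -> nat) l : (forall n, n <= s n)%N ->
  a n @[n --> \oo] --> (l : R) -> a (s n) @[n --> \oo] --> l.
Proof.
move=> hs ha; apply: (cvg_comp _ _ _ ha).
move=> P [N _ hN]; exists N => // n /= Nn; apply: hN => /=.
exact: leq_trans Nn (hs n).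
Qed.

End Selection.

Section PolyCrit.
Context {R : realType}.

Lemma cont_bdd01 (q : R -> R) : continuous q ->
  exists2 N, 0 < N & forall s, `|s| <= 1 -> `|q s| <= N.
Proof.
move=> cq.
have [M [_ hM]] : bounded_set (q @` `[-1, 1]).
  apply: compact_bounded; apply: continuous_compact; last exact: segment_compact.
  exact: continuous_subspaceT.
exists (`|M| + 1); first by have := normr_ge0 M; lra.
move=> s hs; apply: (hM (`|M| + 1)); first by have := ler_norm M; lra.
by exists s => //=; rewrite in_itv/= -ler_norml.
Qed.

Lemma continuous_fun_cst (k : R) : continuous (fun _ : R => k).
Proof. by move=> x; exact: cvg_cst. Qed.

Lemma continuous_fun_id : continuous (fun x : R => x).
Proof. by move=> x; exact: cvg_id. Qed.

(* A, C, X, Y1, c1 and so on are the limits, along a minimizing sequence w_n, of the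
   coefficients in the expansions of mA, mB, mC at t w_n + s h, with mB w_n -> A - C.
   At (1, 0) the polynomial P vanishes and E equals the infimum; the linear parts along
   the line t = 1 + K s, with K chosen so that P has slope X - c1 - Y1 / 3, give
   both slopes the sign of X - c1 - Y1 / 3. *)
Lemma poly_crit (A C X a Y1 Y2 b c1 c2 c3 c4 : R) :
  0 < A -> 0 <= C ->
  (forall t s, t ^+ 2 * A + 2 * t * s * X + s ^+ 2 * a
     - (t ^+ 3 * (A - C) + t ^+ 2 * s * Y1 + t * s ^+ 2 * Y2 + s ^+ 3 * b)
     - (t ^+ 4 * C + 4 * t ^+ 3 * s * c1 + 6 * t ^+ 2 * s ^+ 2 * c2
        + 4 * t * s ^+ 3 * c3 + s ^+ 4 * c4) < 0 ->
     6^-1 * A + 12^-1 * C <=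
     6^-1 * (t ^+ 2 * A + 2 * t * s * X + s ^+ 2 * a)
     + 12^-1 * (t ^+ 4 * C + 4 * t ^+ 3 * s * c1 + 6 * t ^+ 2 * s ^+ 2 * c2
        + 4 * t * s ^+ 3 * c3 + s ^+ 4 * c4)) ->
  X - c1 - 3^-1 * Y1 = 0.
Proof.
move=> A0 C0 H; set D := X - c1 - 3^-1 * Y1.
apply/eqP/negP => /negP D0.
have AC : 0 < A + C by lra.
pose K := (2 * X - Y1 - 4 * c1 - D) / (A + C).
have KE : K * (A + C) = 2 * X - Y1 - 4 * c1 - D by rewrite /K divfK// gt_eqF.
pose r2 := fun s : R => K ^+ 2.
pose r3 := fun s : R => 3 * K ^+ 2 + K ^+ 3 * s.
pose r4 := fun s : R => 6 * K ^+ 2 + 4 * K ^+ 3 * s + K ^+ 4 * s ^+ 2.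
pose T := fun s : R => 1 + K * s.
pose qa := fun s : R => K ^+ 2 * A + 2 * K * X + a.
pose qb := fun s : R => r3 s * (A - C) + (2 * K + K ^+ 2 * s) * Y1 + T s * Y2 + s * b.
pose qc := fun s : R => r4 s * C + 4 * (3 * K + 3 * K ^+ 2 * s + K ^+ 3 * s ^+ 2) * c1
   + 6 * T s ^+ 2 * c2 + 4 * T s * s * c3 + s ^+ 2 * c4.
have eA s : T s ^+ 2 * A + 2 * T s * s * X + s ^+ 2 * a = A + s * (2 * K * A + 2 * X) + s ^+ 2 * qa s.
  by rewrite /T /qa; ring.
have eB s : T s ^+ 3 * (A - C) + T s ^+ 2 * s * Y1 + T s * s ^+ 2 * Y2 + s ^+ 3 * b =
   A - C + s * (3 * K * (A - C) + Y1) + s ^+ 2 * qb s.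
  by rewrite /qb /r3 /T; ring.
have eC s : T s ^+ 4 * C + 4 * T s ^+ 3 * s * c1 + 6 * T s ^+ 2 * s ^+ 2 * c2
        + 4 * T s * s ^+ 3 * c3 + s ^+ 4 * c4 = C + s * (4 * K * C + 4 * c1) + s ^+ 2 * qc s.
  by rewrite /qc /r4 /T; ring.
have ci : continuous (fun s : R => s) by exact: continuous_fun_id.
have cc (k : R) : continuous (fun s : R => k) by exact: continuous_fun_cst.
have c2' : continuous (fun s : R => s ^+ 2) by exact: contX.
have cT : continuous T by apply: contD => //; exact: contZ.
have cT2 : continuous (fun s => T s ^+ 2) by exact: contX.
have cr3 : continuous r3 by apply: contD => //; exact: contZ.
have cr4 : continuous r4 by do 2 (apply: contD => //; last exact: contZ).
have [Na Na0 hNa] := @cont_bdd01 qa (cc _).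
have [Nb Nb0 hNb] : exists2 N, 0 < N & forall s, `|s| <= 1 -> `|qb s| <= N.
  apply: cont_bdd01; apply: contD; [|exact: contM].
  apply: contD; [|exact: contM].
  by apply: contD; apply: contM => //; apply: contD => //; exact: contZ.
have [Nc Nc0 hNc] : exists2 N, 0 < N & forall s, `|s| <= 1 -> `|qc s| <= N.
  apply: cont_bdd01; apply: contD; [|exact: contM].
  apply: contD; [|by apply: contM => //; apply: contM => //; exact: contZ].
  apply: contD; [|by apply: contM => //; exact: contZ].
  apply: contD; first exact: contM.
  apply: contM => //; apply: contZ; apply: contD; [|exact: contZ].
  by apply: contD => //; exact: contZ.
pose N := Na + Nb + Nc.
have D2 : 0 < D ^+ 2 by rewrite exprn_even_gt0.
(* With s = - r D and e = r D^2 the linear parts of P and E are - e and - 2 e / 3, while r makes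
   each of the three quadratic remainders at most e / 4. Then P < 0 and E drops below its value at
   (1, 0), a contradiction. *)
pose r := Num.min (`|D| + 1)^-1 (4 * (N + 1))^-1.
have nD := normr_ge0 D.
have r0 : 0 < r by rewrite lt_min !invr_gt0; apply/andP; split; rewrite /N; lra.
have rD : r * (`|D| + 1) <= 1.
  by rewrite -ler_pdivlMr ?mul1r ?div1r ?ge_min ?lexx//; lra.
have rN : r * (4 * (N + 1)) <= 1.
  by rewrite -ler_pdivlMr ?mul1r ?div1r ?ge_min ?lexx ?orbT// /N; lra.
pose s := - (r * D).
have s1 : `|s| <= 1.
  rewrite /s normrN normrM gtr0_norm//; apply: le_trans rD.
  by apply: ler_wpM2l; [exact: ltW|lra].
have ss : s ^+ 2 = r * (r * D ^+ 2) by rewrite /s; ring.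
have sD : s * D = - (r * D ^+ 2) by rewrite /s; ring.
pose e := r * D ^+ 2.
have e0 : 0 < e by rewrite mulr_gt0.
have hbd q M : 0 < M -> M <= N -> `|q| <= M -> `|s ^+ 2 * q| <= e / 4.
  move=> M0 MN qM; rewrite ss -/e normrM (gtr0_norm (mulr_gt0 r0 e0)).
  apply: (@le_trans _ _ (r * e * (N + 1))).
    by apply: ler_wpM2l; [apply: mulr_ge0; exact: ltW|lra].
  have -> : r * e * (N + 1) = (r * (4 * (N + 1))) * (e / 4) by field.
  by rewrite ler_piMl// divr_ge0// ltW.
have := hbd _ _ Na0 _ (hNa s s1) ; have := hbd _ _ Nb0 _ (hNb s s1).
have := hbd _ _ Nc0 _ (hNc s s1).
have [N1 N2 N3] : [/\ Na <= N, Nb <= N & Nc <= N] by rewrite /N; split; lra.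
move=> /(_ N3); rewrite ler_norml => /andP[bc1 bc2].
move=> /(_ N2); rewrite ler_norml => /andP[bb1 bb2].
move=> /(_ N1); rewrite ler_norml => /andP[ba1 ba2].
have := H (T s) s; rewrite eA eB eC.
have k1 : s * (2 * K * A + 2 * X) - s * (3 * K * (A - C) + Y1) - s * (4 * K * C + 4 * c1) = s * D.
  have -> : s * (2 * K * A + 2 * X) - s * (3 * K * (A - C) + Y1) - s * (4 * K * C + 4 * c1)
    = s * (2 * X - Y1 - 4 * c1 - K * (A + C)) by ring.
  by rewrite KE; ring.
have k2 : 6^-1 * (s * (2 * K * A + 2 * X)) + 12^-1 * (s * (4 * K * C + 4 * c1)) = 2 / 3 * (s * D).
  have -> : 6^-1 * (s * (2 * K * A + 2 * X)) + 12^-1 * (s * (4 * K * C + 4 * c1))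
    = 3^-1 * s * (K * (A + C) + X + c1) by field.
  by rewrite KE /D; field.
move: k1 k2 bc1 bc2 bb1 bb2 ba1 ba2; rewrite sD -/e.
move: (s * (2 * K * A + 2 * X)) (s * (3 * K * (A - C) + Y1)) (s * (4 * K * C + 4 * c1)) => x1 x2 x3.
move: (s ^+ 2 * qa s) (s ^+ 2 * qb s) (s ^+ 2 * qc s) => y1 y2 y3.
move=> k1 k2 bc1 bc2 bb1 bb2 ba1 ba2 h.
have h1 : A + x1 + y1 - (A - C + x2 + y2) - (C + x3 + y3) < 0 by lra.
have := h h1; lra.
Qed.

End PolyCrit.

(** * Euler-Lagrange equations along a minimizing sequence *)

Section EulerLagrange.
Context {R : realType}.
Implicit Types (f g u v phi chi psi : R -> R) (D : set R) (a b c x y t s : R) (w z : @st R).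

(** Bounded pointwise convergence: stable under products, and sufficient to pass to the limit in
    integrals against compactly supported continuous functions ([CI_BC]). *)
Record BC (f_ : nat -> R -> R) f : Prop := MkBC {
  bc_m : forall n, mble (f_ n) ;
  bc_ml : mble f ;
  bc_b : exists2 K : R, 0 < K & forall n x, `|f_ n x| <= K ;
  bc_c : forall x, f_ n x @[n --> \oo] --> f x }.

Lemma BC_M (f_ g_ : nat -> R -> R) f g : BC f_ f -> BC g_ g -> BC (fun n x => f_ n x * g_ n x) (fun x => f x * g x).
Proof.
move=> [m1 m2 [K K0 hK] c1] [m1' m2' [K' K'0 hK'] c1']; split.
- by move=> n; exact: mbleM.
- exact: mbleM.
- exists (K * K'); first exact: mulr_gt0.
  by move=> n x; rewrite normrM ler_pM.
- by move=> x; apply: cvgM.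
Qed.

Definition CS psi := continuous psi /\ exists2 M, 0 < M & supp_in M psi.

Lemma tf_CS psi : tf psi -> CS psi.
Proof. by move=> h; split; [exact: tf_cont|case: h]. Qed.

Lemma CS_M phi psi : CS phi -> CS psi -> CS (fun x => phi x * psi x).
Proof.
move=> [c1 [M M0 hM]] [c2 _]; split; first exact: contM.
by exists M => // x hx; rewrite hM// mul0r.
Qed.

Record CI (d_ : nat -> R -> R) d : Prop := MkCI {
  ci_n : forall n, itg setT (d_ n) ;
  ci_l : itg setT d ;
  ci_c : Rint setT (d_ n) @[n --> \oo] --> Rint setT d }.

Lemma CS_itg psi : CS psi -> itg setT psi.
Proof. by move=> [c1 c2]; exact: itg_supp_cont. Qed.

Lemma CI_BC (f_ : nat -> R -> R) f psi : BC f_ f -> CS psi -> CI (fun n x => f_ n x * psi x) (fun x => f x * psi x).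
Proof.
move=> h hp; have ip := itg_norm measurableT (CS_itg hp).
have mp := cont_mble (proj1 hp).
case: h => m1 m2 [K K0 hK] c1.
have hl x : `|f x| <= K.
  apply: (cvgr_to_le (cvg_norm (c1 x))); exact: nearW.
have iK : itg setT (fun x => K * `|psi x|) by exact: itgZ.
split.
- move=> n; apply: (itg_le _ _ iK) => //; first exact: mbleM.
  by move=> x _; rewrite normrM ler_wpM2r.
- apply: (itg_le _ _ iK) => //; first exact: mbleM.
  by move=> x _; rewrite normrM ler_wpM2r.
- apply: (Rint_dom _ _ _ iK) => //.
  + by move=> n; exact: mbleM.
  + exact: mbleM.
  + by move=> x _; apply: cvgM; [exact: c1|exact: cvg_cst].
  + by move=> n x _; rewrite normrM ler_wpM2r.
Qed.

Lemma CI_D (d_ e_ : nat -> R -> R) d e : CI d_ d -> CI e_ e -> CI (fun n x => d_ n x + e_ n x) (fun x => d x + e x).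
Proof.
move=> [a1 a2 a3] [b1 b2 b3]; split.
- by move=> n; exact: itgD.
- exact: itgD.
- rewrite (_ : (fun n => _) = (fun n => Rint setT (d_ n) + Rint setT (e_ n))).
    by rewrite RintD//; exact: cvgD.
  by apply/funext => n; rewrite RintD.
Qed.

Lemma CI_Z k (d_ : nat -> R -> R) d : CI d_ d -> CI (fun n x => k * d_ n x) (fun x => k * d x).
Proof.
move=> [a1 a2 a3]; split.
- by move=> n; exact: itgZ.
- exact: itgZ.
- rewrite (_ : (fun n => _) = (fun n => k * Rint setT (d_ n))).
    by rewrite RintZ//; apply: cvgM => //; exact: cvg_cst.
  by apply/funext => n; rewrite RintZ.
Qed.

Variables (l1 l2 be : R).
Hypotheses (l1_gt0 : 0 < l1) (l2_gt0 : 0 < l2) (be_gt0 : 0 < be).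
Local Notation dA := (dA l1 l2).
Local Notation dB := (dB be).
Local Notation dC := (@dC R).
Local Notation mA := (mA l1 l2).
Local Notation mB := (mB be).
Local Notation mC := (@mC R).
Local Notation Psi := (Psi l1 l2 be).
Local Notation cinf := (cinf l1 l2 be).

Section Direction.
Variable h : @st R.
Local Notation phi := (su h).
Local Notation chi := (sv h).
Definition dX w x := sg w x * sg h x + sk w x * sk h x + l1 * (su w x * phi x) + l2 * (sv w x * chi x).
Definition dY1 u v x := 3 / 2 * ((v x * v x) * chi x) + 3 / 2 * be * ((u x * u x) * chi x)
   + 3 * be * ((u x * v x) * phi x).
Definition dY2 u v x := 3 / 2 * (v x * (chi x * chi x)) + 3 * be * (u x * (phi x * chi x))
  + 3 / 2 * be * (v x * (phi x * phi x)).
Definition dC1 u x := (u x * (u x * u x)) * phi x.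
Definition dC2 u x := (u x * u x) * (phi x * phi x).
Definition dC3 u x := u x * (phi x * (phi x * phi x)).

Lemma dA_exp w t s x : dA (sadd (sc t w) (sc s h)) x =
  t ^+ 2 * dA w x + 2 * t * s * dX w x + s ^+ 2 * dA h x.
Proof. by rewrite /Energy.dA /dX /=; ring. Qed.

Lemma dB_exp w t s x : dB (sadd (sc t w) (sc s h)) x =
  t ^+ 3 * dB w x + t ^+ 2 * s * dY1 (su w) (sv w) x + t * s ^+ 2 * dY2 (su w) (sv w) x
  + s ^+ 3 * dB h x.
Proof. by rewrite /Energy.dB /dY1 /dY2 /=; field. Qed.

Lemma dC_exp w t s x : dC (sadd (sc t w) (sc s h)) x =
  t ^+ 4 * dC w x + 4 * t ^+ 3 * s * dC1 (su w) x + 6 * t ^+ 2 * s ^+ 2 * dC2 (su w) x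
  + 4 * t * s ^+ 3 * dC3 (su w) x + s ^+ 4 * dC h x.
Proof. by rewrite /Energy.dC /dC1 /dC2 /dC3 /=; ring. Qed.
End Direction.

(** [A] and [C] are limits along the sequence and are not claimed to be the values at (u, v);
    [poly_crit] only needs them as coefficients. Every coefficient that depends on (u, v) is an
    integral against a compactly supported function, so pointwise convergence suffices. *)
Lemma euler_lagrange (w_ : nat -> st) u v (A C : R) phi phi1 phi2 chi chi1 chi2 :
  (forall n, H1p (w_ n)) -> (forall n, Psi (w_ n) = 0) ->
  BC (fun n => su (w_ n)) u -> BC (fun n => sv (w_ n)) v ->
  mA (w_ n) @[n --> \oo] --> A -> mC (w_ n) @[n --> \oo] --> C ->
  0 < A -> 6^-1 * A + 12^-1 * C = cinf ->
  tf phi -> (forall x, is_derive x 1 phi (phi1 x)) -> (forall x, is_derive x 1 phi1 (phi2 x)) ->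
  tf chi -> (forall x, is_derive x 1 chi (chi1 x)) -> (forall x, is_derive x 1 chi1 (chi2 x)) ->
  Rint setT (fun x => l1 * (u x * phi x) + -1 * (u x * phi2 x)
     + l2 * (v x * chi x) + -1 * (v x * chi2 x))
  - Rint setT (fun x => u x * (u x * u x) * phi x)
  - Rint setT (fun x => 2^-1 * (v x * v x * chi x) + 2^-1 * be * (u x * u x * chi x)
       + be * (u x * v x * phi x)) = 0.
Proof.
move=> Hw HP Bu Bv cA cC A0 hc tp dp dp1 tc dc dc1.
pose h := St phi phi1 chi chi1.
have Hh : H1p h by split; exact: tf_H1.
have tp1 := tf_of_derive tp dp; have tc1 := tf_of_derive tc dc.
have tp2 := tf_of_derive tp1 dp1; have tc2 := tf_of_derive tc1 dc1.
have sp := tf_CS tp; have sx := tf_CS tc; have sp2 := tf_CS tp2; have sx2 := tf_CS tc2.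
(* The cross term [dX] integrated by parts: moving both derivatives onto the test functions removes
   the need for any convergence of derivatives. *)
pose DX u v x := l1 * (u x * phi x) + -1 * (u x * phi2 x)
     + l2 * (v x * chi x) + -1 * (v x * chi2 x).
have CX : CI (fun n => DX (su (w_ n)) (sv (w_ n))) (DX u v).
  by do 3?apply: CI_D; apply: CI_Z; apply: CI_BC.
have CY1 : CI (fun n => dY1 h (su (w_ n)) (sv (w_ n))) (dY1 h u v).
  by do 2?apply: CI_D; apply: CI_Z; apply: CI_BC => //; apply: BC_M.
have CY2 : CI (fun n => dY2 h (su (w_ n)) (sv (w_ n))) (dY2 h u v).
  by do 2?apply: CI_D; apply: CI_Z; apply: CI_BC => //; apply: CS_M.
have CC1 : CI (fun n => dC1 h (su (w_ n))) (dC1 h u).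
  by apply: CI_BC => //; apply: BC_M => //; apply: BC_M.
have CC2 : CI (fun n => dC2 h (su (w_ n))) (dC2 h u).
  by apply: CI_BC => //; [apply: BC_M|apply: CS_M].
have CC3 : CI (fun n => dC3 h (su (w_ n))) (dC3 h u).
  by apply: CI_BC => //; apply: CS_M => //; apply: CS_M.
have itX n : itg setT (dX h (w_ n)).
  case: (Hw n) => hu hv; case: (Hh) => hp hq.
  apply: itgD => //; [apply: itgD => //; [apply: itgD => //|apply: itgZ => //]|apply: itgZ => //];
  apply: L2_mul; by [exact: h1_L2 hu|exact: h1_L2 hv|exact: h1_L2 hp|exact: h1_L2 hq
    |exact: h1_dL2 hu|exact: h1_dL2 hv|exact: h1_dL2 hp|exact: h1_dL2 hq].
have eX n : Rint setT (dX h (w_ n)) = Rint setT (DX (su (w_ n)) (sv (w_ n))).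
  case: (Hw n) => hu hv.
  have hp1 := tf_H1 tp1 dp1; have hq1 := tf_H1 tc1 dc1.
  have e1 := H1_prod hu hp1; have e2 := H1_prod hv hq1.
  have i1 : itg setT (fun x => su (w_ n) x * phi2 x + sg (w_ n) x * phi1 x).
    by apply: itgD => //; apply: L2_mul;
      by [exact: h1_L2 hu|exact: h1_dL2 hu|exact: h1_L2 hp1|exact: h1_dL2 hp1].
  have i2 : itg setT (fun x => sv (w_ n) x * chi2 x + sk (w_ n) x * chi1 x).
    by apply: itgD => //; apply: L2_mul;
      by [exact: h1_L2 hv|exact: h1_dL2 hv|exact: h1_L2 hq1|exact: h1_dL2 hq1].
  have iD := ci_n CX n.
  have -> : dX h (w_ n) = (fun x => DX (su (w_ n)) (sv (w_ n)) x +
     ((su (w_ n) x * phi2 x + sg (w_ n) x * phi1 x) +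
      (sv (w_ n) x * chi2 x + sk (w_ n) x * chi1 x))).
    by apply/funext => x; rewrite /dX /DX /=; ring.
  rewrite RintD//; last exact: itgD.
  by rewrite [X in _ + X]RintD// e1 e2 !addr0.
have EA n t s : mA (sadd (sc t (w_ n)) (sc s h)) =
    t ^+ 2 * mA (w_ n) + 2 * t * s * Rint setT (DX (su (w_ n)) (sv (w_ n))) + s ^+ 2 * mA h.
  rewrite -eX; have iA := itg_dA l1 l2 (Hw n); have ih := itg_dA l1 l2 Hh.
  rewrite (_ : mA _ = Rint setT (fun x => t ^+ 2 * dA (w_ n) x +
     2 * t * s * dX h (w_ n) x + s ^+ 2 * dA h x)); last first.
    by apply: eq_Rint => x _; rewrite dA_exp.
  rewrite RintD//; [|by apply: itgD => //; exact: itgZ|exact: itgZ].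
  by rewrite RintD//; [rewrite !RintZ|exact: itgZ|exact: itgZ].
have EB n t s : mB (sadd (sc t (w_ n)) (sc s h)) =
    t ^+ 3 * mB (w_ n) + t ^+ 2 * s * Rint setT (dY1 h (su (w_ n)) (sv (w_ n)))
    + t * s ^+ 2 * Rint setT (dY2 h (su (w_ n)) (sv (w_ n))) + s ^+ 3 * mB h.
  have iA := itg_dB be (Hw n); have ih := itg_dB be Hh.
  have iy1 := ci_n CY1 n; have iy2 := ci_n CY2 n.
  rewrite (_ : mB _ = Rint setT (fun x => t ^+ 3 * dB (w_ n) x +
     t ^+ 2 * s * dY1 h (su (w_ n)) (sv (w_ n)) x + t * s ^+ 2 * dY2 h (su (w_ n)) (sv (w_ n)) x
     + s ^+ 3 * dB h x)); last first.
    by apply: eq_Rint => x _; rewrite dB_exp.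
  rewrite RintD//; [|by repeat (apply: itgD => //); exact: itgZ|exact: itgZ].
  rewrite RintD//; [|by apply: itgD => //; exact: itgZ|exact: itgZ].
  by rewrite RintD//; [rewrite !RintZ|exact: itgZ|exact: itgZ].
have EC n t s : mC (sadd (sc t (w_ n)) (sc s h)) =
    t ^+ 4 * mC (w_ n) + 4 * t ^+ 3 * s * Rint setT (dC1 h (su (w_ n)))
    + 6 * t ^+ 2 * s ^+ 2 * Rint setT (dC2 h (su (w_ n)))
    + 4 * t * s ^+ 3 * Rint setT (dC3 h (su (w_ n))) + s ^+ 4 * mC h.
  have iA := itg_dC (Hw n); have ih := itg_dC Hh.
  have i1 := ci_n CC1 n; have i2 := ci_n CC2 n; have i3 := ci_n CC3 n.
  rewrite (_ : mC _ = Rint setT (fun x => t ^+ 4 * dC (w_ n) x +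
     4 * t ^+ 3 * s * dC1 h (su (w_ n)) x + 6 * t ^+ 2 * s ^+ 2 * dC2 h (su (w_ n)) x
     + 4 * t * s ^+ 3 * dC3 h (su (w_ n)) x + s ^+ 4 * dC h x)); last first.
    by apply: eq_Rint => x _; rewrite dC_exp.
  rewrite RintD//; [|by repeat (apply: itgD => //); exact: itgZ|exact: itgZ].
  rewrite RintD//; [|by repeat (apply: itgD => //); exact: itgZ|exact: itgZ].
  rewrite RintD//; [|by apply: itgD => //; exact: itgZ|exact: itgZ].
  by rewrite RintD//; [rewrite !RintZ|exact: itgZ|exact: itgZ].
have cB : mB (w_ n) @[n --> \oo] --> A - C.
  rewrite (_ : (fun n => _) = (fun n => mA (w_ n) - mC (w_ n))); first exact: cvgB.
  by apply/funext => n; have := HP n; rewrite /Energy.Psi; lra.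
have C0 : 0 <= C.
  by apply: (cvgr_to_ge cC); apply: nearW => n; exact: mC_ge0.
pose X := Rint setT (DX u v).
pose Y1 := Rint setT (dY1 h u v); pose Y2 := Rint setT (dY2 h u v).
pose c1 := Rint setT (dC1 h u); pose c2 := Rint setT (dC2 h u).
pose c3 := Rint setT (dC3 h u).
have cst k (a_ : nat -> R) l : a_ n @[n --> \oo] --> l -> k * a_ n @[n --> \oo] --> k * l.
  by move=> ?; apply: cvgM => //; exact: cvg_cst.
have := @poly_crit R A C X (mA h) Y1 Y2 (mB h) c1 c2 c3 (mC h) A0 C0.
have -> : Rint setT (fun x => 2^-1 * (v x * v x * chi x) + 2^-1 * be * (u x * u x * chi x)
       + be * (u x * v x * phi x)) = 3^-1 * Y1.
  rewrite -RintZ//; last exact: ci_l CY1.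
  by apply: eq_Rint => x _; rewrite /dY1 /=; field.
apply => t s.
have cEA : mA (sadd (sc t (w_ n)) (sc s h)) @[n --> \oo] -->
    t ^+ 2 * A + 2 * t * s * X + s ^+ 2 * mA h.
  rewrite (_ : (fun n => _) = (fun n => t ^+ 2 * mA (w_ n) + 2 * t * s *
    Rint setT (DX (su (w_ n)) (sv (w_ n))) + s ^+ 2 * mA h)); last by apply/funext => n; exact: EA.
  by apply: cvgD; [apply: cvgD; apply: cst => //; exact: ci_c CX|exact: cvg_cst].
have cEB : mB (sadd (sc t (w_ n)) (sc s h)) @[n --> \oo] -->
    t ^+ 3 * (A - C) + t ^+ 2 * s * Y1 + t * s ^+ 2 * Y2 + s ^+ 3 * mB h.
  rewrite (_ : (fun n => _) = (fun n => t ^+ 3 * mB (w_ n) + t ^+ 2 * s *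
    Rint setT (dY1 h (su (w_ n)) (sv (w_ n)))
    + t * s ^+ 2 * Rint setT (dY2 h (su (w_ n)) (sv (w_ n))) + s ^+ 3 * mB h));
    last by apply/funext => n; exact: EB.
  apply: cvgD; last exact: cvg_cst.
  by do 2?apply: cvgD; apply: cst => //; [exact: ci_c CY1|exact: ci_c CY2].
have cEC : mC (sadd (sc t (w_ n)) (sc s h)) @[n --> \oo] -->
    t ^+ 4 * C + 4 * t ^+ 3 * s * c1 + 6 * t ^+ 2 * s ^+ 2 * c2
        + 4 * t * s ^+ 3 * c3 + s ^+ 4 * mC h.
  rewrite (_ : (fun n => _) = (fun n => t ^+ 4 * mC (w_ n) +
    4 * t ^+ 3 * s * Rint setT (dC1 h (su (w_ n)))
    + 6 * t ^+ 2 * s ^+ 2 * Rint setT (dC2 h (su (w_ n)))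
    + 4 * t * s ^+ 3 * Rint setT (dC3 h (su (w_ n))) + s ^+ 4 * mC h));
    last by apply/funext => n; exact: EC.
  apply: cvgD; last exact: cvg_cst.
  by do 3?apply: cvgD; apply: cst => //; [exact: ci_c CC1|exact: ci_c CC2|exact: ci_c CC3].
set LP := (X in X < 0 -> _); set LE := (X in _ -> _ <= X).
have cP : (mA (sadd (sc t (w_ n)) (sc s h)) - mB (sadd (sc t (w_ n)) (sc s h))
    - mC (sadd (sc t (w_ n)) (sc s h))) @[n --> \oo] --> LP.
  by apply: cvgB cEC; exact: cvgB cEA cEB.
have cE : (6^-1 * mA (sadd (sc t (w_ n)) (sc s h))
    + 12^-1 * mC (sadd (sc t (w_ n)) (sc s h))) @[n --> \oo] --> LE.
  by apply: cvgD; apply: cst.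
(* For fixed t and s with negative limit, t w_n + s h is admissible for large n, so its energy is at
   least [cinf]; the inequality then passes to the limit. *)
move=> neg; rewrite hc.
apply: (cvgr_to_ge cE); near=> n.
apply: (cinf_le l1_gt0 l2_gt0); first by apply: H1p_add; exact: H1p_sc.
by near: n; exact: (cvgr_lt _ cP _ neg).
Unshelve. all: by end_near. Qed.

End EulerLagrange.

(** * Regularity of the minimizer *)

Section Regularity.
Context {R : realType}.
Implicit Types (f g u p q phi psi : R -> R) (a b c x y : R).

Lemma AC_tf p q phi phi1 : AC p q -> tf phi -> (forall x, is_derive x 1 phi (phi1 x)) ->
  Rint setT (fun x => p x * phi1 x) = - Rint setT (fun x => q x * phi x).
Proof.
move=> h tp dp; have hp := tf_H1 tp dp.
have [M M0 hM] : exists2 M, 0 < M & supp_in M phi by case: tp.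
have hM' := supp_in_derive hM dp.
have hM2 : supp_in (M + 1) phi by apply: supp_in_le hM; lra.
have cphi := h1_cont hp.
have cphi1 := tf_cont (tf_of_derive tp dp).
have s1 : supp_in (M + 1) (fun x => p x * phi1 x) by move=> x /hM' ->; rewrite mulr0.
have s2 : supp_in (M + 1) (fun x => q x * phi x) by move=> x /hM2 ->; rewrite mulr0.
rewrite (Rint_supp s1) (Rint_supp s2).
have le : - (M + 1) <= M + 1 by lra.
have := ac_prod h (h1_ac hp) le.
rewrite (hM2 (M + 1)) ?(hM2 (- (M + 1))) ?normrN ?ger0_norm//; try lra.
rewrite !mulr0 subrr RintD// => [e||].
- by apply/eqP; rewrite -addr_eq0 -e.
- by apply: itg_cont; apply: contM => //; exact: ac_cont h.
- apply: (@eq_itg _ _ (fun x => phi x * q x)) => //; first by move=> x _; rewrite mulrC.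
  by apply: itg_contM => //; [exact: ac_itg h|exact: ac_mble h].
Qed.

Definition prim f x := if 0 <= x then Rint `[0, x] f else - Rint `[x, 0] f.

Lemma primE f a x : continuous f -> a <= x -> a <= 0 ->
  prim f x = Rint `[a, x] f - Rint `[a, 0] f.
Proof.
move=> cf ax a0; rewrite /prim; case: ifPn => [x0|].
  by rewrite (Rint_split a0 x0); [ring|exact: itg_cont].
rewrite -ltNge => /ltW x0.
by rewrite [in RHS](Rint_split ax x0); [ring|exact: itg_cont].
Qed.

Lemma prim_derive f x : continuous f -> is_derive x 1 (prim f) (f x).
Proof.
move=> cf; pose a := Num.min x 0 - 1.
have ax : a < x by rewrite /a /Num.min; case: ifP; lra.
have a0 : a <= 0 by rewrite /a /Num.min; case: ifP; lra.
have hi : itg `[a, x + 1] f by exact: itg_cont.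
have x1 : x < x + 1 by lra.
have [hd he] := @continuous_FTC1_closed R f a x (x + 1) x1 hi ax (cf x).
have d1 : is_derive x 1 (fun y => Rint `[a, y] f) (f x).
  by rewrite -he derive1E; exact: derivableP.
have d2 := is_deriveB d1 (is_derive_cst (Rint `[a, 0] f) x 1).
rewrite subr0 in d2.
apply: near_eq_is_derive d2.
near=> y; rewrite (primE cf _ a0)//.
by apply: ltW; near: y; exact: lt_nbhsr.
Unshelve. all: by end_near. Qed.

(** Subtracting the double primitive [F2] of [f] leaves a [z] orthogonal to all second derivatives
    of test functions. Applying the zero-mean correction of du Bois-Reymond twice shows that [z] is
    affine. *)
Lemma weak_C2 u f : continuous u -> continuous f ->
  (forall phi phi1 phi2, tf phi -> (forall x, is_derive x 1 phi (phi1 x)) ->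
    (forall x, is_derive x 1 phi1 (phi2 x)) ->
    Rint setT (fun x => u x * phi2 x) = Rint setT (fun x => f x * phi x)) ->
  exists2 u1, (forall x, is_derive x 1 u (u1 x)) & (forall x, is_derive x 1 u1 (f x)).
Proof.
move=> cu cf H.
pose F1 := prim f; have dF1 x : is_derive x 1 F1 (f x) by exact: prim_derive.
have cF1 := is_derive_cont dF1.
pose F2 := prim F1; have dF2 x : is_derive x 1 F2 (F1 x) by exact: prim_derive.
have cF2 := is_derive_cont dF2.
pose z x := u x - F2 x.
have cz : continuous z by exact: contB.
have Hz phi phi1 phi2 : tf phi -> (forall x, is_derive x 1 phi (phi1 x)) ->
    (forall x, is_derive x 1 phi1 (phi2 x)) -> tf phi1 -> tf phi2 ->
    Rint setT (fun x => z x * phi2 x) = 0.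
  move=> tp dp dp1 tp1 tp2.
  have -> : (fun x => z x * phi2 x) = (fun x => u x * phi2 x - F2 x * phi2 x).
    by apply/funext => x; rewrite /z mulrBl.
  rewrite RintB//; [|exact: tf_itgM|exact: tf_itgM].
  rewrite (H _ _ _ tp dp dp1) (AC_tf (AC_C1 dF2 cF1) tp1 dp1).
  by rewrite (AC_tf (AC_C1 dF1 cf) tp dp) opprK subrr.
pose K := Rint setT (@bump R).
have K0 : K != 0 by rewrite gt_eqF// Rint_bump_gt0.
have [b1 db tb1] := tf_derive (@bump_tf R).
(* The slope of [z]: a weak derivative equal to c would give the integral of z bump' the value - c
   K. *)
pose c := - (Rint setT (fun x => z x * b1 x) / K).
have Hz1 psi psi1 : tf psi -> (forall x, is_derive x 1 psi (psi1 x)) -> tf psi1 ->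
    Rint setT (fun x => z x * psi1 x) = - c * Rint setT psi.
  move=> tp dp tp1.
  pose k := - (Rint setT psi / K).
  have tb := @bump_tf R.
  pose g x := psi x + k * bump x; pose g1 x := psi1 x + k * b1 x.
  have tg : tf g by apply: tf_add => //; exact: tf_scale.
  have tg1 : tf g1 by apply: tf_add => //; exact: tf_scale.
  have dg x : is_derive x 1 g (g1 x).
    exact: (is_deriveD (dp x) (@is_deriveZ _ _ _ (@bump R) k x 1 _ (db x))).
  have ig : Rint setT g = 0.
    rewrite RintD//; [|exact: tf_itg|by apply: itgZ => //; exact: tf_itg].
    by rewrite RintZ//; [rewrite -/K /k mulNr divfK// subrr|exact: tf_itg].
  have := Hz _ _ _ (anti_tf tg ig) (fun x => anti_derive x tg) dg tg tg1.
  have -> : (fun x => z x * g1 x) = (fun x => z x * psi1 x + k * (z x * b1 x)).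
    by apply/funext => x; rewrite /g1; ring.
  rewrite RintD//; [|exact: tf_itgM|by apply: itgZ => //; exact: tf_itgM].
  rewrite RintZ//; last exact: tf_itgM.
  by move=> e; have -> : - c * Rint setT psi = - (k * Rint setT (fun x => z x * b1 x)); [rewrite /c /k; ring|lra].
have dlin x : is_derive x 1 (fun y : R => c * y) c.
  have := @is_deriveZ _ _ _ (@id R) c x 1 1 (is_derive_id _ _).
  by rewrite /GRing.scale/= mulr1.
have clin := is_derive_cont dlin.
have [d hd] : exists d, forall x, z x - c * x = d.
  apply: (@du_bois_reymond_cont _ (fun x => z x - c * x)); first exact: contB.
  move=> psi psi1 tp dp.
  have tp1 := tf_of_derive tp dp.
  have -> : (fun x => (z x - c * x) * psi1 x) = (fun x => z x * psi1 x - c * x * psi1 x).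
    by apply/funext => x; rewrite mulrBl.
  rewrite RintB//; [|exact: tf_itgM|exact: (@tf_itgM _ (fun x => c * x))].
  rewrite (Hz1 _ _ tp dp tp1) (AC_tf (AC_C1 dlin (@continuous_fun_cst R c)) tp dp).
  by rewrite RintZ//; [ring|exact: tf_itg].
exists (fun x => F1 x + c).
  move=> x; have -> : u = (fun x => F2 x + (c * x + d)).
    by apply/funext => y; have := hd y; rewrite /z; lra.
  have := is_deriveD (dF2 x) (is_deriveD (dlin x) (is_derive_cst d x 1)).
  by rewrite addr0.
move=> x; have := is_deriveD (dF1 x) (is_derive_cst c x 1).
by rewrite addr0.
Qed.

End Regularity.

(** * Classical solutions obtained as limits *)

Section Limits.
Context {R : realType}.
Local Notation mu := (@lebesgue_measure R).
Implicit Types (f g u v phi psi : R -> R) (a b c x y t s : R) (w z : @st R).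

Lemma holder_cont f (M : R) :
  (forall x y, x <= y -> (f y - f x) ^+ 2 <= (y - x) * M) -> continuous f.
Proof.
move=> hf x; apply/cvgrPdist_lt => e e0.
have M1 : 0 < `|M| + 1 by have := normr_ge0 M; lra.
pose d := e ^+ 2 / (`|M| + 1).
have d0 : 0 < d by rewrite divr_gt0// exprn_gt0.
near=> y.
have xy : `|x - y| < d by near: y; exact: (@cvgr_dist_lt _ _ _ _ _ id x).
have key s t : s <= t -> `|s - t| < d -> `|f t - f s| < e.
  move=> st dst; rewrite -(@ltr_pXn2r _ 2)// ?nnegrE//; last exact: ltW.
  rewrite real_normK ?num_real//; apply: le_lt_trans (hf _ _ st) _.
  rewrite distrC ger0_norm ?subr_ge0// in dst.
  apply: (@le_lt_trans _ _ ((t - s) * (`|M| + 1))).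
    by rewrite ler_wpM2l ?subr_ge0//; have := ler_norm M; lra.
  by rewrite -ltr_pdivlMr.
have [/key|/ltW/key] := leP x y; first by rewrite (distrC (f y)); exact.
by rewrite (distrC y); exact.
Unshelve. all: by end_near. Qed.

Lemma tf0 : tf (fun _ : R => 0).
Proof. by split; [exact: smooth_cst|exists 1]. Qed.

Lemma itg_of_bdd f (K : R) : mble f -> (forall x, 0 <= f x) ->
  (forall a b, itg `[a, b] f) ->
  (forall n : nat, Rint `[- n%:R, n%:R] f <= K) -> itg setT f /\ Rint setT f <= K.
Proof.
move=> mf f0 hf hK.
pose g n := EFin \o (f \_ `[- n%:R, n%:R]).
have mg n : measurable_fun (setT : set (measurableTypeR R)) (g n).
  by apply/measurable_EFinP; exact: mble_restrict.
have g0 n (x : measurableTypeR R) : setT x -> (0 <= g n x)%E.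
  by move=> _; rewrite /g /= lee_fin /patch; case: ifP.
have ndg (x : measurableTypeR R) : setT x -> {homo g^~ x : n m / (n <= m)%N >-> (n <= m)%E}.
  move=> _ n m nm; rewrite /g /= lee_fin /patch.
  case: ifPn => [|_]; last by case: ifP.
  rewrite inE/= in_itv/= -ler_norml => xn.
  by rewrite ifT// inE/= in_itv/= -ler_norml (le_trans xn)// ler_nat.
have lg x : g ^~ x @ \oo --> (f x)%:E.
  apply: (@cvg_near_cst _ _ (f x)%:E).
  near=> n; rewrite /g /= /patch mem_set//= in_itv/= -ler_norml.
  by near: n; exact: nbhs_infty_ger.
have cv := @cvg_monotone_convergence _ _ R mu setT measurableT g mg g0 ndg.
have e : (\int[mu]_x limn (g ^~ x) = \int[mu]_x (f x)%:E)%E.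
  by apply: eq_integral => x _; apply/cvg_lim => //; exact: lg.
rewrite e in cv.
have gK n : (\int[mu]_x g n x <= K%:E)%E.
  have := hK n; rewrite /Rint /Rintegral integral_mkcond -lee_fin fineK.
    by rewrite restrict_EFin.
  by apply: integrable_fin_num => //; rewrite restrict_EFin; apply: (itg_restrict _ (hf _ _)).
have iK : (\int[mu]_x (f x)%:E <= K%:E)%E.
  rewrite -(cvg_lim _ cv)//; apply: lime_le; first by apply/cvg_ex; eexists; exact: cv.
  exact: nearW.
have hi : itg setT f.
  apply/integrableP; split; first exact/measurable_EFinP.
  rewrite (_ : (\int[mu]_x `|_| = \int[mu]_x (f x)%:E)%E).
    by apply: le_lt_trans iK _; rewrite ltry.
  by apply: eq_integral => x _ /=; rewrite ger0_norm.
split => //; rewrite /Rint /Rintegral -lee_fin fineK//.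
exact: (integrable_fin_num _ hi).
Unshelve. all: by end_near. Qed.

Variables (l1 l2 be : R).
Hypotheses (l1_gt0 : 0 < l1) (l2_gt0 : 0 < l2) (be_gt0 : 0 < be).
Local Notation mA := (mA l1 l2).
Local Notation mC := (@mC R).
Local Notation Psi := (Psi l1 l2 be).
Local Notation cinf := (cinf l1 l2 be).

(** The system is read as u'' = rhs1 and v'' = rhs2. *)
Definition rhs1 u v x := l1 * u x - u x ^+ 3 - be * (u x * v x).
Definition rhs2 u v x := l2 * v x - 2^-1 * v x ^+ 2 - 2^-1 * be * u x ^+ 2.

Record Sol w : Prop := MkSol {
  sol_u : forall x, is_derive x 1 (su w) (sg w x) ;
  sol_g : forall x, is_derive x 1 (sg w) (rhs1 (su w) (sv w) x) ;
  sol_v : forall x, is_derive x 1 (sv w) (sk w x) ;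
  sol_k : forall x, is_derive x 1 (sk w) (rhs2 (su w) (sv w) x) }.

Lemma rhs1_cont u v : continuous u -> continuous v -> continuous (rhs1 u v).
Proof.
move=> cu cv; apply: contB; last by apply: contZ; exact: contM.
by apply: contB; [exact: contZ|exact: contX].
Qed.

Lemma rhs2_cont u v : continuous u -> continuous v -> continuous (rhs2 u v).
Proof.
move=> cu cv; apply: contB; last by apply: contZ; exact: contX.
by apply: contB; [exact: contZ|apply: contZ; exact: contX].
Qed.

Lemma limit_sol (w_ : nat -> st) u v (A C : R) :
  (forall n, H1p (w_ n)) -> (forall n, Psi (w_ n) = 0) ->
  BC (fun n => su (w_ n)) u -> BC (fun n => sv (w_ n)) v ->
  continuous u -> continuous v ->
  mA (w_ n) @[n --> \oo] --> A -> mC (w_ n) @[n --> \oo] --> C ->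
  0 < A -> 6^-1 * A + 12^-1 * C = cinf ->
  exists u1 v1, Sol (St u u1 v v1).
Proof.
move=> Hw HP Bu Bv cu cv cA cC A0 hc.
have z0 x : is_derive x 1 (fun _ : R => 0 : R) 0 by exact: is_derive_cst.
have [u1 du du1] : exists2 u1, (forall x, is_derive x 1 u (u1 x)) &
    (forall x, is_derive x 1 u1 (rhs1 u v x)).
  apply: weak_C2 => //; first exact: rhs1_cont.
  move=> phi phi1 phi2 tp dp dp1; have tp2 := tf_of_derive (tf_of_derive tp dp) dp1.
  (* A zero second direction isolates the first equation. *)
  have := euler_lagrange l1_gt0 l2_gt0 Hw HP Bu Bv cA cC A0 hc tp dp dp1 tf0 z0 z0.
  have i1 := tf_itgM cu tp; have i2 := tf_itgM cu tp2.
  have i3 := tf_itgM (contM cu (contM cu cu)) tp; have i4 := tf_itgM (contM cu cv) tp.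
  have -> : (fun x => l1 * (u x * phi x) + -1 * (u x * phi2 x) + l2 * (v x * 0) + -1 * (v x * 0)) =
    (fun x => l1 * (u x * phi x) - u x * phi2 x) by apply/funext => x; ring.
  have -> : (fun x => 2^-1 * (v x * v x * 0) + 2^-1 * be * (u x * u x * 0) + be * (u x * v x * phi x))
    = (fun x => be * (u x * v x * phi x)) by apply/funext => x; ring.
  rewrite RintB//; last exact: itgZ.
  rewrite RintZ// RintZ// => e.
  have -> : (fun x => rhs1 u v x * phi x) = (fun x => l1 * (u x * phi x)
    - u x * (u x * u x) * phi x - be * (u x * v x * phi x)).
    by apply/funext => x; rewrite /rhs1; ring.
  rewrite RintB//; [|by apply: itgB => //; exact: itgZ|exact: itgZ].
  rewrite RintB//; last exact: itgZ.
  by rewrite RintZ// RintZ//; lra.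
have [v1 dv dv1] : exists2 v1, (forall x, is_derive x 1 v (v1 x)) &
    (forall x, is_derive x 1 v1 (rhs2 u v x)).
  apply: weak_C2 => //; first exact: rhs2_cont.
  move=> phi phi1 phi2 tp dp dp1; have tp2 := tf_of_derive (tf_of_derive tp dp) dp1.
  have := euler_lagrange l1_gt0 l2_gt0 Hw HP Bu Bv cA cC A0 hc tf0 z0 z0 tp dp dp1.
  have i1 := tf_itgM cv tp; have i2 := tf_itgM cv tp2.
  have i3 := tf_itgM (contM cv cv) tp; have i4 := tf_itgM (contM cu cu) tp.
  have -> : (fun x => l1 * (u x * 0) + -1 * (u x * 0) + l2 * (v x * phi x) + -1 * (v x * phi2 x)) =
    (fun x => l2 * (v x * phi x) - v x * phi2 x) by apply/funext => x; ring.
  have -> : (fun x => u x * (u x * u x) * 0) = (fun x => 0 * (v x * phi x)).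
    by apply/funext => x; ring.
  have -> : (fun x => 2^-1 * (v x * v x * phi x) + 2^-1 * be * (u x * u x * phi x) + be * (u x * v x * 0))
    = (fun x => 2^-1 * (v x * v x * phi x) + 2^-1 * be * (u x * u x * phi x)).
    by apply/funext => x; ring.
  rewrite RintB//; last exact: itgZ.
  rewrite RintD//; [|exact: itgZ|exact: itgZ].
  rewrite !RintZ// => e.
  have -> : (fun x => rhs2 u v x * phi x) = (fun x => l2 * (v x * phi x)
    - 2^-1 * (v x * v x * phi x) - 2^-1 * be * (u x * u x * phi x)).
    by apply/funext => x; rewrite /rhs2; ring.
  rewrite RintB//; [|by apply: itgB => //; exact: itgZ|exact: itgZ].
  rewrite RintB//; [|exact: itgZ|exact: itgZ].
  by rewrite !RintZ//; lra.
by exists u1, v1.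
Qed.

Lemma sq_itg_bddM p u g (K : R) : H1 u g -> mble p -> (forall x, `|p x| <= K) ->
  itg setT (fun x => (p x * u x) ^+ 2).
Proof.
move=> h mp hp; apply: (@eq_itg _ _ (fun x => p x ^+ 2 * u x ^+ 2)) => //.
  by move=> x _; rewrite exprMn.
apply: (itg_bddP (K := K ^+ 2) h); first exact: mbleX.
move=> x; rewrite normrX ler_pXn2r ?nnegrE//.
exact: le_trans (hp x).
Qed.

(** Each right-hand side is a sum of bounded coefficients times square integrable functions. So the
    derivatives of a solution lie in W^{1,2} themselves, and [H1_prod] applies to them on the whole
    line. *)
Lemma sol_H1 w : H1p w -> Sol w ->
  H1 (sg w) (rhs1 (su w) (sv w)) /\ H1 (sk w) (rhs2 (su w) (sv w)).
Proof.
move=> [h k] [d1 d2 d3 d4].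
have [K K0 hK] := H1_bdd h; have [L L0 hL] := H1_bdd k.
have cu := h1_cont h; have cv := h1_cont k.
have cst0 (r : R) : continuous (fun _ : R => r) by exact: continuous_fun_cst.
split.
- split; [apply: AC_C1 => //; exact: rhs1_cont|exact: h1_der h|].
  apply: (@eq_itg _ _ (fun x => ((l1 - su w x ^+ 2 - be * sv w x) * su w x) ^+ 2)) => //.
    by move=> x _; rewrite /rhs1; congr (_ ^+ 2); ring.
  apply: (@sq_itg_bddM _ _ _ (l1 + K ^+ 2 + be * L) h).
    apply: cont_mble; apply: contB; last exact: contZ.
    by apply: contB => //; exact: contX.
  move=> x; apply: le_trans (ler_normB _ _) _; apply: lerD; last first.
    by rewrite normrM (gtr0_norm be_gt0) ler_wpM2l// ltW.
  apply: le_trans (ler_normB _ _) _; rewrite (gtr0_norm l1_gt0) lerD2l.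
  by rewrite normrX ler_pXn2r ?nnegrE// ltW.
- split; [apply: AC_C1 => //; exact: rhs2_cont|exact: h1_der k|].
  apply: (@eq_itg _ _ (fun x => ((l2 - 2^-1 * sv w x) * sv w x + - 2^-1 * be * su w x * su w x) ^+ 2)) => //.
    by move=> x _; rewrite /rhs2; congr (_ ^+ 2); ring.
  have c1 : continuous (fun x => l2 - 2^-1 * sv w x) by apply: contB => //; exact: contZ.
  have c2 : continuous (fun x => - 2^-1 * be * su w x) by exact: contZ.
  apply: itgT_sqD.
  + by apply: cont_mble; exact: contM.
  + by apply: cont_mble; exact: contM.
  + apply: (@sq_itg_bddM _ _ _ (l2 + 2^-1 * L) k); first exact: cont_mble.
    move=> x; apply: le_trans (ler_normB _ _) _; rewrite (gtr0_norm l2_gt0) lerD2l.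
    by rewrite normrM gtr0_norm ?invr_gt0// ler_wpM2l.
  + apply: (@sq_itg_bddM _ _ _ (`|- 2^-1 * be| * K) h); first exact: cont_mble.
    by move=> x; rewrite normrM ler_wpM2l.
Qed.

(** The equations tested against the solution itself. *)
Lemma sol_Psi w : H1p w -> Sol w -> Psi w = 0.
Proof.
move=> hw hs; have [h1 k1] := sol_H1 hw hs; case: (hw) => h k.
have e1 := H1_prod h h1; have e2 := H1_prod k k1.
rewrite PsiE//.
have -> : dPsi l1 l2 be w = (fun x => (su w x * rhs1 (su w) (sv w) x + sg w x * sg w x) +
   (sv w x * rhs2 (su w) (sv w) x + sk w x * sk w x)).
  by apply/funext => x; rewrite /dPsi /dA /dB /dC /rhs1 /rhs2; field.
rewrite RintD//; first by rewrite e1 e2 addr0.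
- by apply: itgD => //; apply: L2_mul; by [exact: h1_L2 h|exact: h1_L2 h1|exact: h1_dL2 h1].
- by apply: itgD => //; apply: L2_mul; by [exact: h1_L2 k|exact: h1_L2 k1|exact: h1_dL2 k1].
Qed.

End Limits.

(** * A priori bounds and lower semicontinuity of the energy *)

Section Existence.
Context {R : realType}.
Implicit Types (f g u v phi psi : R -> R) (a b c x y t s : R) (w z : @st R).
Variables (l1 l2 be : R).
Hypotheses (l1_gt0 : 0 < l1) (l2_gt0 : 0 < l2) (be_gt0 : 0 < be).
Local Notation mA := (mA l1 l2).
Local Notation Psi := (Psi l1 l2 be).
Local Notation En := (En l1 l2).
Local Notation cinf := (cinf l1 l2 be).
Local Notation del := (del l1 l2 be).
Local Notation Sol := (Sol l1 l2 be).
Local Notation dI := (dI l1 l2).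

Lemma mA_der w : H1p w -> Rint setT (fun x => sg w x ^+ 2) <= mA w /\
  Rint setT (fun x => sk w x ^+ 2) <= mA w.
Proof.
move=> hw; have iA := itg_dA l1 l2 hw; case: hw => h k.
have ig := h1_der h; have ik := h1_der k.
split; apply: Rint_le => // x _; rewrite /dA.
- have : 0 <= l1 * su w x ^+ 2 by rewrite mulr_ge0 ?sqr_ge0// ltW.
  have : 0 <= l2 * sv w x ^+ 2 by rewrite mulr_ge0 ?sqr_ge0// ltW.
  have := sqr_ge0 (sk w x); lra.
- have : 0 <= l1 * su w x ^+ 2 by rewrite mulr_ge0 ?sqr_ge0// ltW.
  have : 0 <= l2 * sv w x ^+ 2 by rewrite mulr_ge0 ?sqr_ge0// ltW.
  have := sqr_ge0 (sg w x); lra.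
Qed.

(** Constant of the embedding into bounded functions, with both squared sup norms controlled by
    [mA]: [H1_bound] gives the factor 2, and [mA] controls the L2 norms up to 1/l1 and 1/l2. *)
Definition emb : R := 2 * (l1^-1 + l2^-1 + 1).

Lemma emb_gt0 : 0 < emb.
Proof. by rewrite mulr_gt0// !addr_gt0 ?invr_gt0. Qed.

Lemma sup_mA w x : H1p w -> su w x ^+ 2 <= emb * mA w /\ sv w x ^+ 2 <= emb * mA w.
Proof.
move=> hw; have [g1 g2] := mA_der hw; have [u1 u2] := mA_ge l1_gt0 l2_gt0 hw.
have A0 := mA_ge0 l1_gt0 l2_gt0 w.
case: (hw) => h k.
have i1 : 0 <= l1^-1 * mA w by rewrite mulr_ge0// invr_ge0 ltW.
have i2 : 0 <= l2^-1 * mA w by rewrite mulr_ge0// invr_ge0 ltW.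
split; [apply: le_trans (H1_bound x h) _|apply: le_trans (H1_bound x k) _];
  rewrite /emb -mulrA ler_pM2l// !mulrDl mul1r; apply: lerD => //.
- apply: (@le_trans _ _ (l1^-1 * mA w)); last lra.
  by rewrite -ler_pdivrMl ?invr_gt0// invrK.
- apply: (@le_trans _ _ (l2^-1 * mA w)); last lra.
  by rewrite -ler_pdivrMl ?invr_gt0// invrK.
Qed.

Lemma holder_mA w x y : H1p w -> x <= y ->
  (su w y - su w x) ^+ 2 <= (y - x) * mA w /\ (sv w y - sv w x) ^+ 2 <= (y - x) * mA w.
Proof.
move=> hw xy; have [g1 g2] := mA_der hw; case: (hw) => h k.
have key f : itg setT (fun r => f r ^+ 2) -> Rint setT (fun r => f r ^+ 2) <= mA w ->
    Rint `[x, y] (fun r => f r ^+ 2) <= mA w.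
  by move=> hf; apply: le_trans; apply: Rint_sub_le => // z _; exact: sqr_ge0.
split.
- apply: le_trans (ac_osc_sq (h1_ac h) (lexx x) xy (lexx y)) _.
  by rewrite ler_wpM2l ?subr_ge0//; apply: key => //; exact: h1_der h.
- apply: le_trans (ac_osc_sq (h1_ac k) (lexx x) xy (lexx y)) _.
  by rewrite ler_wpM2l ?subr_ge0//; apply: key => //; exact: h1_der k.
Qed.

Lemma min_seq w0 : H1p w0 -> Psi w0 < 0 ->
  exists w_ : nat -> st, forall n, [/\ H1p (w_ n), is_even (su (w_ n)) /\ is_even (sv (w_ n)),
    Psi (w_ n) = 0, del <= `|su (w_ n) 0| \/ del <= `|sv (w_ n) 0| &
    En (w_ n) <= cinf + n.+1%:R^-1].
Proof.
move=> h0 P0.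
have H (n : nat) : exists w, [/\ H1p w, is_even (su w) /\ is_even (sv w),
    Psi w = 0, del <= `|su w 0| \/ del <= `|sv w 0| & En w <= cinf + n.+1%:R^-1].
  (* [symmetrize] doubles the excess of energy over [cinf], hence the half. *)
  have e0 : 0 < n.+1%:R^-1 / 2 :> R by rewrite divr_gt0// invr_gt0.
  have [w [hw Pw Ew]] := cinf_near l1_gt0 l2_gt0 h0 P0 e0.
  have [z [hz ez Pz dz Ez]] := symmetrize l1_gt0 l2_gt0 be_gt0 hw Pw.
  exists z; split => //; apply: le_trans Ez _.
  have -> : n.+1%:R^-1 = 2 * (n.+1%:R^-1 / 2) :> R by rewrite [RHS]mulrC divfK// pnatr_eq0.
  by move: (n.+1%:R^-1 / 2) Ew => e; lra.
have [w_ hw_] := choice H.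
by exists w_.
Qed.

Lemma cinf_ge0 w0 : H1p w0 -> Psi w0 < 0 -> 0 <= cinf.
Proof.
move=> h0 P0; apply: lb_le_inf; first by exists (En w0); exists w0.
exact: adm_lb.
Qed.

Lemma Rint_cvg_bdd (f_ : nat -> R -> R) f (K a b : R) : (forall n, mble (f_ n)) -> mble f ->
  (forall n x, `|f_ n x| <= K) -> (forall x, f_ n x @[n --> \oo] --> f x) ->
  continuous f -> forall p, continuous p ->
  Rint `[a, b] (fun x => f_ n x * p x) @[n --> \oo] --> Rint `[a, b] (fun x => f x * p x).
Proof.
move=> m1 m2 hK hc cf p cp.
apply: (@Rint_dom _ _ _ _ (fun x => K * `|p x|)) => //.
- by move=> n; apply: mbleM => //; exact: cont_mble.
- by apply: mbleM => //; exact: cont_mble.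
- by apply: itgZ => //; apply: itg_norm => //; exact: itg_cont.
- by move=> x _; apply: cvgM; [exact: hc|exact: cvg_cst].
- by move=> n x _; rewrite normrM ler_wpM2r.
Qed.

(* 2 g_n u' - u'^2 <= g_n^2, and its integral converges to that of u'^2 after an
   integration by parts. *)
Lemma dirichlet_lsc (u_ g_ : nat -> R -> R) u u1 f (K a b : R) : a <= b ->
  (forall n, AC (u_ n) (g_ n)) -> (forall n x, `|u_ n x| <= K) ->
  (forall x, u_ n x @[n --> \oo] --> u x) ->
  (forall x, is_derive x 1 u (u1 x)) -> (forall x, is_derive x 1 u1 (f x)) -> continuous f ->
  Rint `[a, b] (fun x => 2 * (g_ n x * u1 x) - u1 x ^+ 2) @[n --> \oo] -->
  Rint `[a, b] (fun x => u1 x ^+ 2).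
Proof.
move=> ab hu hK hc du du1 cf.
have cu := is_derive_cont du; have cu1 := is_derive_cont du1.
have a1 := AC_C1 du cu1; have a2 := AC_C1 du1 cf.
have iu (F : R -> R) : continuous F -> itg `[a, b] F by move=> ?; exact: itg_cont.
have ig n : itg `[a, b] (fun x => g_ n x * u1 x).
  apply: (@eq_itg _ _ (fun x => u1 x * g_ n x)) => //; first by move=> x _; rewrite mulrC.
  by apply: itg_contM => //; [exact: ac_itg (hu n)|exact: ac_mble (hu n)].
have e n : Rint `[a, b] (fun x => g_ n x * u1 x) = u_ n b * u1 b - u_ n a * u1 a -
    Rint `[a, b] (fun x => u_ n x * f x).
  have cn := ac_cont (hu n).
  by rewrite (ac_prod (hu n) a2 ab) RintD//; [ring|apply: iu; exact: contM].
have e0 : Rint `[a, b] (fun x => u1 x * u1 x) = u b * u1 b - u a * u1 a -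
    Rint `[a, b] (fun x => u x * f x).
  by rewrite (ac_prod a1 a2 ab) RintD//; [ring|apply: iu; exact: contM|apply: iu; exact: contM].
have cg : Rint `[a, b] (fun x => g_ n x * u1 x) @[n --> \oo] --> Rint `[a, b] (fun x => u1 x * u1 x).
  rewrite e0 (_ : (fun n => _) = (fun n => u_ n b * u1 b - u_ n a * u1 a -
    Rint `[a, b] (fun x => u_ n x * f x))); last by apply/funext.
  apply: cvgB.
    by apply: cvgB; apply: cvgM; [exact: hc|exact: cvg_cst|exact: hc|exact: cvg_cst].
  apply: (@Rint_cvg_bdd _ _ K) => //; last exact: cont_mble.
  by move=> n; apply: cont_mble; exact: ac_cont (hu n).
have -> : (fun x => u1 x ^+ 2) = (fun x => u1 x * u1 x) by apply/funext => x; rewrite expr2.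
have iq : itg `[a, b] (fun x => u1 x * u1 x) by apply: iu; exact: contM.
rewrite (_ : (fun n => _) = (fun n => 2 * Rint `[a, b] (fun x => g_ n x * u1 x)
    - Rint `[a, b] (fun x => u1 x * u1 x))); last first.
  apply/funext => n.
  have -> : (fun x => 2 * (g_ n x * u1 x) - u1 x ^+ 2) = (fun x => 2 * (g_ n x * u1 x) - u1 x * u1 x).
    by apply/funext => x; rewrite expr2.
  by rewrite RintB//; [rewrite RintZ|exact: itgZ].
set L := Rint _ _ in cg *.
rewrite [X in _ --> X](_ : L = 2 * L - L); last by ring.
by apply: cvgB; [apply: cvgM => //; exact: cvg_cst|exact: cvg_cst].
Qed.

(** On each [-n, n] the density [d m], in which squares of derivatives are replaced by their tangent
    lower bounds, lies below [dI (w_ m)] and has an integral converging to that of [dI w]. *)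
Lemma lsc_En (w_ : nat -> st) w (c K : R) : (forall n, H1p (w_ n)) ->
  (forall n x, `|su (w_ n) x| <= K) -> (forall n x, `|sv (w_ n) x| <= K) ->
  (forall x, su (w_ n) x @[n --> \oo] --> su w x) ->
  (forall x, sv (w_ n) x @[n --> \oo] --> sv w x) ->
  Sol w -> En (w_ n) @[n --> \oo] --> c -> H1p w /\ En w <= c.
Proof.
move=> hw hu hv cu_ cv_ [d1 d2 d3 d4] cE.
have cu := is_derive_cont d1; have cg := is_derive_cont d2.
have cv := is_derive_cont d3; have ck := is_derive_cont d4.
have K0 : 0 <= K by exact: le_trans (normr_ge0 _) (hu 0%N 0).
have cr1 := @rhs1_cont R l1 be _ _ cu cv; have cr2 := @rhs2_cont R l2 be _ _ cu cv.
have cdI : continuous (dI w).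
  apply: contD; apply: contZ; last exact: contX.
  by do 3?apply: contD; (try apply: contZ); exact: contX.
have key (n : nat) : Rint `[- n%:R, n%:R] (dI w) <= c.
  set a := - n%:R; set b := n%:R; have ab : a <= b by rewrite /a /b; have := ler0n R n; lra.
  pose d (m : nat) x := 6^-1 * (2 * (sg (w_ m) x * sg w x) - sg w x ^+ 2)
    + 6^-1 * (2 * (sk (w_ m) x * sk w x) - sk w x ^+ 2)
    + 6^-1 * l1 * (su (w_ m) x ^+ 2 * 1) + 6^-1 * l2 * (sv (w_ m) x ^+ 2 * 1)
    + 12^-1 * (su (w_ m) x ^+ 4 * 1).
  have i1 m : itg `[a, b] (fun x => 2 * (sg (w_ m) x * sg w x) - sg w x ^+ 2).
    have [h k] := hw m; apply: itgB => //; last by apply: itg_cont; exact: contX.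
    apply: itgZ => //; apply: (@eq_itg _ _ (fun x => sg w x * sg (w_ m) x)) => //.
      by move=> x _; rewrite mulrC.
    by apply: itg_contM => //; [exact: ac_itg (h1_ac h)|exact: h1_dmble h].
  have i2 m : itg `[a, b] (fun x => 2 * (sk (w_ m) x * sk w x) - sk w x ^+ 2).
    have [h k] := hw m; apply: itgB => //; last by apply: itg_cont; exact: contX.
    apply: itgZ => //; apply: (@eq_itg _ _ (fun x => sk w x * sk (w_ m) x)) => //.
      by move=> x _; rewrite mulrC.
    by apply: itg_contM => //; [exact: ac_itg (h1_ac k)|exact: h1_dmble k].
  have c1 : continuous (fun _ : R => 1 : R) by exact: continuous_fun_cst.
  have ipw (F : R -> R) j : continuous F -> itg `[a, b] (fun x => F x ^+ j * 1).
    by move=> cF; apply: itg_cont; apply: contM => //; exact: contX.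
  have cw m : continuous (su (w_ m)) by case: (hw m) => h _; exact: h1_cont h.
  have cw' m : continuous (sv (w_ m)) by case: (hw m) => _ h; exact: h1_cont h.
  have ed m : Rint `[a, b] (d m) =
      6^-1 * Rint `[a, b] (fun x => 2 * (sg (w_ m) x * sg w x) - sg w x ^+ 2)
    + 6^-1 * Rint `[a, b] (fun x => 2 * (sk (w_ m) x * sk w x) - sk w x ^+ 2)
    + 6^-1 * l1 * Rint `[a, b] (fun x => su (w_ m) x ^+ 2 * 1)
    + 6^-1 * l2 * Rint `[a, b] (fun x => sv (w_ m) x ^+ 2 * 1)
    + 12^-1 * Rint `[a, b] (fun x => su (w_ m) x ^+ 4 * 1).
    have j1 := i1 m; have j2 := i2 m.
    have j3 := ipw _ 2%N (cw m); have j4 := ipw _ 2%N (cw' m); have j5 := ipw _ 4%N (cw m).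
    rewrite RintD//; [|by repeat (apply: itgD => //); exact: itgZ|exact: itgZ].
    rewrite RintD//; [|by repeat (apply: itgD => //); exact: itgZ|exact: itgZ].
    rewrite RintD//; [|by repeat (apply: itgD => //); exact: itgZ|exact: itgZ].
    by rewrite RintD//; [rewrite !RintZ|exact: itgZ|exact: itgZ].
  have id m : itg `[a, b] (d m).
    have j1 := i1 m; have j2 := i2 m.
    have j3 := ipw _ 2%N (cw m); have j4 := ipw _ 2%N (cw' m); have j5 := ipw _ 4%N (cw m).
    by repeat (apply: itgD => //); exact: itgZ.
  have le m : Rint `[a, b] (d m) <= En (w_ m).
    rewrite EnE//; apply: (@le_trans _ _ (Rint `[a, b] (dI (w_ m)))).
      apply: Rint_le => //; first by apply: itgTS => //; exact: itg_dI.
      move=> x _; rewrite /d /Energy.dI /dA /dC.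
      have := sqr_ge0 (sg (w_ m) x - sg w x); have := sqr_ge0 (sk (w_ m) x - sk w x).
      rewrite !mulr1 !sqrrB; lra.
    by apply: Rint_sub_le => //; [exact: itg_dI|move=> x _; exact: dI_ge0].
  have cvX (F_ : nat -> R -> R) (F : R -> R) j : (forall m, continuous (F_ m)) ->
      continuous F -> (forall m x, `|F_ m x| <= K) -> (forall x, F_ m x @[m --> \oo] --> F x) ->
      Rint `[a, b] (fun x => F_ m x ^+ j * 1) @[m --> \oo] --> Rint `[a, b] (fun x => F x ^+ j * 1).
    move=> cF_ cF bF cvF.
    apply: (@Rint_cvg_bdd (fun m x => F_ m x ^+ j) (fun x => F x ^+ j) (K ^+ j)) => //.
    - by move=> m; apply: cont_mble; exact: contX.
    - by apply: cont_mble; exact: contX.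
    - by move=> m x; rewrite normrX lerXn2r ?nnegrE.
    - move=> x; have := @exprn_continuous R j (F x).
      by move=> h; exact: (cvg_comp _ _ (cvF x) h).
    - exact: contX.
  have cst k (a_ : nat -> R) (l : R) : a_ n @[n --> \oo] --> l -> k * a_ n @[n --> \oo] --> k * l.
    by move=> ?; apply: cvgM => //; exact: cvg_cst.
  have cd : Rint `[a, b] (d m) @[m --> \oo] --> Rint `[a, b] (dI w).
    have -> : Rint `[a, b] (dI w) =
        6^-1 * Rint `[a, b] (fun x => sg w x ^+ 2) + 6^-1 * Rint `[a, b] (fun x => sk w x ^+ 2)
        + 6^-1 * l1 * Rint `[a, b] (fun x => su w x ^+ 2 * 1)
        + 6^-1 * l2 * Rint `[a, b] (fun x => sv w x ^+ 2 * 1)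
        + 12^-1 * Rint `[a, b] (fun x => su w x ^+ 4 * 1).
      have j1 : itg `[a, b] (fun x => sg w x ^+ 2) by apply: itg_cont; exact: contX.
      have j2 : itg `[a, b] (fun x => sk w x ^+ 2) by apply: itg_cont; exact: contX.
      have j3 := ipw _ 2%N cu; have j4 := ipw _ 2%N cv; have j5 := ipw _ 4%N cu.
      have -> : dI w = (fun x => 6^-1 * sg w x ^+ 2 + 6^-1 * sk w x ^+ 2
         + 6^-1 * l1 * (su w x ^+ 2 * 1) + 6^-1 * l2 * (sv w x ^+ 2 * 1)
         + 12^-1 * (su w x ^+ 4 * 1)).
        by apply/funext => x; rewrite /Energy.dI /dA /dC; ring.
      rewrite RintD//; [|by repeat (apply: itgD => //); exact: itgZ|exact: itgZ].
      rewrite RintD//; [|by repeat (apply: itgD => //); exact: itgZ|exact: itgZ].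
      rewrite RintD//; [|by repeat (apply: itgD => //); exact: itgZ|exact: itgZ].
      by rewrite RintD//; [rewrite !RintZ|exact: itgZ|exact: itgZ].
    under eq_fun do rewrite ed.
    apply: cvgD; last by apply: cst; exact: cvX.
    apply: cvgD; last by apply: cst; exact: cvX.
    apply: cvgD; last by apply: cst; exact: cvX.
    apply: cvgD; apply: cst.
      apply: (@dirichlet_lsc (fun m => su (w_ m)) (fun m => sg (w_ m)) (su w) (sg w) (rhs1 l1 be (su w) (sv w)) K a b ab) => //.
      by move=> m; case: (hw m) => h _; exact: h1_ac h.
    apply: (@dirichlet_lsc (fun m => sv (w_ m)) (fun m => sk (w_ m)) (sv w) (sk w) (rhs2 l2 be (su w) (sv w)) K a b ab) => //.
    by move=> m; case: (hw m) => _ h; exact: h1_ac h.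
  apply: (ler_cvg_to cd cE); exact: nearW.
(* The bound is uniform in the interval, so integrability over the line is obtained here, and with
   it membership in W^{1,2}, as [dI w] dominates a multiple of each square. *)
have [hi hle] := itg_of_bdd (cont_mble cdI) (dI_ge0 l1_gt0 l2_gt0 w)
  (fun a b => itg_cont a b cdI) key.
have hw' : H1p w.
  have dom (F : R -> R) (k : R) : continuous F -> (forall x, F x ^+ 2 <= k * dI w x) ->
      itg setT (fun x => F x ^+ 2).
    move=> cF hF; apply: (itg_le _ _ (itgZ k _ hi)) => //.
      by apply: cont_mble; exact: contX.
    by move=> x _; rewrite ger0_norm ?sqr_ge0.
  have P x : [/\ 0 <= sg w x ^+ 2, 0 <= sk w x ^+ 2, 0 <= su w x ^+ 4,
      0 <= l1 * su w x ^+ 2 & 0 <= l2 * sv w x ^+ 2].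
    by split; rewrite ?sqr_ge0 ?exprn_even_ge0// mulr_ge0 ?sqr_ge0// ltW.
  split; split.
  - exact: AC_C1.
  - apply: (@dom _ (6 / l1)) => // x; rewrite mulrAC ler_pdivlMr// mulrC /Energy.dI /dA /dC.
    by have [? ? ? ? ?] := P x; lra.
  - apply: (@dom _ 6) => // x; rewrite /Energy.dI /dA /dC.
    by have [? ? ? ? ?] := P x; lra.
  - exact: AC_C1.
  - apply: (@dom _ (6 / l2)) => // x; rewrite mulrAC ler_pdivlMr// mulrC /Energy.dI /dA /dC.
    by have [? ? ? ? ?] := P x; lra.
  - apply: (@dom _ 6) => // x; rewrite /Energy.dI /dA /dC.
    by have [? ? ? ? ?] := P x; lra.
by split => //; rewrite EnE.
Qed.

End Existence.

(** * Existence and positivity *)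

Section Minimizer.
Context {R : realType}.
Implicit Types (f g u v phi psi : R -> R) (a b c x y t s : R) (w z : @st R).
Variables (l1 l2 be : R).
Hypotheses (l1_gt0 : 0 < l1) (l2_gt0 : 0 < l2) (be_gt0 : 0 < be).
Local Notation mA := (mA l1 l2).
Local Notation mB := (mB be).
Local Notation mC := (@mC R).
Local Notation Psi := (Psi l1 l2 be).
Local Notation En := (En l1 l2).
Local Notation cinf := (cinf l1 l2 be).
Local Notation del := (del l1 l2 be).
Local Notation Sol := (Sol l1 l2 be).
Local Notation emb := (emb l1 l2).

Lemma cvg_even (f_ : nat -> R -> R) f : (forall n, is_even (f_ n)) ->
  (forall x, f_ n x @[n --> \oo] --> f x) -> is_even f.
Proof.
move=> ev hc x; have h1 := hc (- x); have h2 := hc x.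
have e : (fun n => f_ n (- x)) = (fun n => f_ n x) by apply/funext => n; exact: ev.
by rewrite e in h1; exact: (cvg_unique (@Rhausdorff R) h1 h2).
Qed.

Lemma exist_min w0 : H1p w0 -> Psi w0 < 0 ->
  exists w, [/\ H1p w, Sol w, is_even (su w) /\ is_even (sv w), 0 < mA w & En w = cinf].
Proof.
move=> h0 P0.
have [w_ hw_] := min_seq l1_gt0 l2_gt0 be_gt0 h0 P0.
have c0 := cinf_ge0 l1_gt0 l2_gt0 h0 P0.
have hw n : H1p (w_ n) by case: (hw_ n).
have d0 := del_gt0 l1_gt0 l2_gt0 be_gt0.
have em0 := emb_gt0 l1_gt0 l2_gt0.
pose E1 := 6 * (cinf + 1).
have E10 : 0 <= E1 by rewrite mulr_ge0// addr_ge0.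
have inv1 n : n.+1%:R^-1 <= 1 :> R by rewrite invf_le1// ler1n.
have bA n : 0 <= mA (w_ n) <= E1.
  have [_ _ _ _ hE] := hw_ n; have := inv1 n.
  rewrite mA_ge0//=; move: hE; rewrite /Energy.En /E1; have := mC_ge0 (w_ n).
  by move: (n.+1%:R^-1) => q; lra.
have bC n : 0 <= mC (w_ n) <= 2 * E1.
  have [_ _ _ _ hE] := hw_ n; have := inv1 n.
  rewrite mC_ge0//=; move: hE; rewrite /Energy.En /E1; have := mA_ge0 l1_gt0 l2_gt0 (w_ n).
  by move: (n.+1%:R^-1) => q; lra.
(* A single constant serves as sup bound, as Hoelder constant and as bound for [mA] and [mC]. *)
pose M := 1 + emb * E1 + 2 * E1.
have eE0 : 0 <= emb * E1 by rewrite mulr_ge0// ltW.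
have sqb (q : R) : q ^+ 2 <= emb * E1 -> `|q| <= M.
  rewrite -real_normK ?num_real// /M => hq.
  have := sqr_ge0 (`|q| - 1); nra.
have embA n : emb * mA (w_ n) <= emb * E1.
  by rewrite ler_pM2l//; have /andP[] := bA n.
have bu n x : `|su (w_ n) x| <= M.
  by apply: sqb; have [h _] := sup_mA l1_gt0 l2_gt0 x (hw n); exact: le_trans (embA n).
have bv n x : `|sv (w_ n) x| <= M.
  by apply: sqb; have [_ h] := sup_mA l1_gt0 l2_gt0 x (hw n); exact: le_trans (embA n).
have AM n : mA (w_ n) <= M by have /andP[] := bA n; rewrite /M; lra.
have hu n x y : x <= y -> (su (w_ n) y - su (w_ n) x) ^+ 2 <= (y - x) * M.
  move=> xy; have [h _] := holder_mA l1_gt0 l2_gt0 (hw n) xy.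
  by apply: le_trans h _; rewrite ler_wpM2l ?subr_ge0.
have hv n x y : x <= y -> (sv (w_ n) y - sv (w_ n) x) ^+ 2 <= (y - x) * M.
  move=> xy; have [_ h] := holder_mA l1_gt0 l2_gt0 (hw n) xy.
  by apply: le_trans h _; rewrite ler_wpM2l ?subr_ge0.
have [s1 [hs1 [u cu1]]] := selection bu hu.
have [s2 [hs2 [v cv2]]] := selection (fun n => bv (s1 n)) (fun n => hv (s1 n)).
have nA n : `|mA (w_ (s1 (s2 n)))| <= M.
  by rewrite ger0_norm ?AM//; have /andP[] := bA (s1 (s2 n)).
have [s3 [hs3 [A cA3]]] := selection_scalar nA.
have nC n : `|mC (w_ (s1 (s2 (s3 n))))| <= M.
  have /andP[C0 C1] := bC (s1 (s2 (s3 n))).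
  by rewrite ger0_norm// /M; lra.
have [s4 [hs4 [C cC]]] := selection_scalar nC.
pose s n := s1 (s2 (s3 (s4 n))).
have hs n : (n <= s n)%N.
  apply: leq_trans (hs4 n) _; apply: leq_trans (hs3 _) _.
  by apply: leq_trans (hs2 _) _; exact: hs1.
pose W n := w_ (s n).
have cA : mA (W n) @[n --> \oo] --> A by exact: (cvg_subseq hs4 cA3).
have cv x : sv (W n) x @[n --> \oo] --> v x.
  exact: (cvg_subseq hs4 (cvg_subseq hs3 (cv2 x))).
have cu x : su (W n) x @[n --> \oo] --> u x.
  exact: (cvg_subseq hs4 (cvg_subseq hs3 (cvg_subseq hs2 (cu1 x)))).
have HW n : H1p (W n) by exact: hw.
have PW n : Psi (W n) = 0 by case: (hw_ (s n)).
have holder_lim (f_ : nat -> R -> R) f : (forall n x y, x <= y -> (f_ n y - f_ n x) ^+ 2 <= (y - x) * M) ->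
    (forall x, f_ n x @[n --> \oo] --> f x) ->
    forall x y, x <= y -> (f y - f x) ^+ 2 <= (y - x) * M.
  move=> hf cf x y xy.
  have h : (f_ n y - f_ n x) ^+ 2 @[n --> \oo] --> (f y - f x) ^+ 2.
    by rewrite !expr2; apply: cvgM; apply: cvgB.
  by apply: (cvgr_to_le h); apply: nearW => n; exact: hf.
have cont_u : continuous u.
  by apply: (@holder_cont _ _ M); apply: (holder_lim _ _ (fun n => hu (s n)) cu).
have cont_v : continuous v.
  by apply: (@holder_cont _ _ M); apply: (holder_lim _ _ (fun n => hv (s n)) cv).
have M1 : 0 < M by rewrite /M; lra.
have BCu : BC (fun n => su (W n)) u.
  split => //; [|exact: cont_mble|by exists M => // n x; exact: bu].
  by move=> n; have [h _] := HW n; exact: h1_mble h.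
have BCv : BC (fun n => sv (W n)) v.
  split => //; [|exact: cont_mble|by exists M => // n x; exact: bv].
  by move=> n; have [_ h] := HW n; exact: h1_mble h.
(* One component has modulus at least [del] at 0, and the embedding turns this into a lower bound
   for [mA] uniform in n. *)
have A0 : 0 < A.
  apply: (@lt_le_trans _ _ (emb^-1 * del ^+ 2)).
    by rewrite mulr_gt0 ?invr_gt0// exprn_gt0.
  apply: (cvgr_to_ge cA); apply: nearW => n.
  rewrite ler_pdivrMl//.
  have sq (q : R) : del <= `|q| -> del ^+ 2 <= q ^+ 2.
    by move=> hq; rewrite -[leRHS]real_normK ?num_real// lerXn2r ?nnegrE// ltW.
  have [e1 e2] := sup_mA l1_gt0 l2_gt0 0 (HW n).
  have [_ _ _ [hd|hd] _] := hw_ (s n).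
    by apply: le_trans (sq _ hd) _; exact: e1.
  by apply: le_trans (sq _ hd) _; exact: e2.
have cE : En (W n) @[n --> \oo] --> 6^-1 * A + 12^-1 * C.
  by apply: cvgD; apply: cvgM => //; exact: cvg_cst.
have E0 w : H1p w -> Psi w = 0 -> 0 < mA w -> cinf <= En w.
  by move=> h P A1; apply: cinf_le0 => //; rewrite P.
have AWpos n : 0 < mA (W n).
  have [e1 e2] := sup_mA l1_gt0 l2_gt0 0 (HW n).
  rewrite ltNge; apply/negP => An.
  have e3 : emb * mA (W n) <= 0 by rewrite pmulr_rle0.
  have z0 (q : R) : q ^+ 2 <= 0 -> `|q| = 0.
    by move=> hq; apply/eqP; rewrite normr_eq0 -sqrf_eq0; apply/eqP/le_anti; rewrite hq sqr_ge0.
  have [_ _ _ [hd|hd] _] := hw_ (s n).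
    by have := z0 _ (le_trans e1 e3); rewrite /W => q; lra.
  by have := z0 _ (le_trans e2 e3); rewrite /W => q; lra.
have Ec : 6^-1 * A + 12^-1 * C = cinf.
  apply/eqP; rewrite eq_le; apply/andP; split; last first.
    by apply: (cvgr_to_ge cE); apply: nearW => n; exact: E0.
  have ch : cinf + n.+1%:R^-1 @[n --> \oo] --> cinf + 0.
    by apply: cvgD; [exact: cvg_cst|exact: cvg_harmonic].
  rewrite -[leRHS]addr0; apply: (ler_cvg_to cE ch).
  apply: nearW => n; have [_ _ _ _ hE] := hw_ (s n).
  apply: le_trans hE _; rewrite lerD2l lef_pV2 ?posrE// ler_nat ltnS; exact: hs.
have [u1 [v1 hS]] := limit_sol l1_gt0 l2_gt0 HW PW BCu BCv cont_u cont_v cA cC A0 Ec.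
have [hH hE] := lsc_En (w := St u u1 v v1) l1_gt0 l2_gt0 HW (fun n => bu (s n)) (fun n => bv (s n)) cu cv hS cE.
(* Since [mA] may drop in the limit, A > 0 does not suffice; the pointwise bound by [del] at 0 does
   survive. *)
have A1 : 0 < mA (St u u1 v v1).
  rewrite ltNge; apply/negP => An.
  have [uz vz] := mA_eq0 l1_gt0 l2_gt0 hH An.
  have c1 := cu 0; have c2 := cv 0; rewrite /= in uz vz; rewrite uz in c1; rewrite vz in c2.
  have n1 : \forall n \near \oo, `|su (W n) 0| < del.
    by apply: filterS (@cvgr_dist_lt _ _ _ _ _ _ _ c1 _ d0) => n; rewrite sub0r normrN.
  have n2 : \forall n \near \oo, `|sv (W n) 0| < del.
    by apply: filterS (@cvgr_dist_lt _ _ _ _ _ _ _ c2 _ d0) => n; rewrite sub0r normrN.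
  have [n [q1 q2]] := filter_ex (filterI n1 n2).
  by have [_ _ _ [hd|hd] _] := hw_ (s n); move: q1 q2; rewrite /W ltNge ?hd// => _; rewrite ltNge hd.
have P1 := sol_Psi l1_gt0 l2_gt0 be_gt0 hH hS.
exists (St u u1 v v1); split => //.
- split; [apply: (cvg_even _ cu)|apply: (cvg_even _ cv)] => n; by case: (hw_ (s n)) => _ [].
- by apply/eqP; rewrite eq_le; apply/andP; split; [rewrite -Ec|exact: E0].
Qed.

(* sg(u) u1 is the limit of the derivatives of sqrt (u^2 + 1/(n+1)). *)
Lemma H1_abs u u1 : H1 u u1 -> (forall x, is_derive x 1 u (u1 x)) -> continuous u1 ->
  H1 (fun x => `|u x|) (fun x => Num.sg (u x) * u1 x).
Proof.
move=> h du cu1; have cu := is_derive_cont du.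
pose e (n : nat) : R := n.+1%:R^-1.
have e0 n : 0 < e n by rewrite invr_gt0.
pose r n x := Num.sqrt (u x ^+ 2 + e n).
have pos n x : 0 < u x ^+ 2 + e n by rewrite ltr_wpDl// sqr_ge0.
have r0 n x : 0 < r n x by rewrite sqrtr_gt0.
have rE n x : r n x ^+ 2 = u x ^+ 2 + e n by rewrite sqr_sqrtr// ltW.
pose d n x := u x * u1 x / r n x.
have dr n x : is_derive x 1 (r n) (d n x).
  have d1 := @is_deriveM _ _ u u x 1 _ _ (du x) (du x).
  have d2 := is_deriveD d1 (is_derive_cst (e n) x 1).
  have ee : (fun y => u y ^+ 2 + e n) = (u * u + cst (e n)).
    by apply/funext => y; rewrite /= expr2.
  rewrite -ee in d2.
  have := @is_derive1_comp R Num.sqrt (fun y => u y ^+ 2 + e n) x _ _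
    (is_derive1_sqrt (pos n x)) d2.
  move=> hd; apply: is_derive_eq hd _.
  rewrite /GRing.scale /= addr0 /d -/(r n x).
  by field; rewrite gt_eqF.
have cr n : continuous (r n) by exact: is_derive_cont (dr n).
have cd n : continuous (d n).
  move=> x; apply: cvgM; first by apply: contM.
  by apply: cvgV; [rewrite gt_eqF|exact: cr].
have ur n x : `|u x| <= r n x.
  rewrite -(@ler_pXn2r _ 2)// ?nnegrE//; last exact: ltW.
  by rewrite real_normK ?num_real// rE lerDl ltW.
have ru n x : r n x ^+ 2 <= `|u x| ^+ 2 + e n by rewrite rE real_normK ?num_real.
have ce : e n @[n --> \oo] --> 0 by exact: cvg_harmonic.
have crl x : r n x @[n --> \oo] --> `|u x|.
  have hx : u x ^+ 2 + e n @[n --> \oo] --> u x ^+ 2.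
    by rewrite -[X in _ --> X]addr0; apply: cvgD => //; exact: cvg_cst.
  rewrite -sqrtr_sqr; exact: (cvg_comp _ _ hx (@sqrt_continuous R (u x ^+ 2))).
have cdl x : d n x @[n --> \oo] --> Num.sg (u x) * u1 x.
  have [u0|un0] := eqVneq (u x) 0.
    rewrite u0 sgr0 mul0r (_ : (fun n => _) = (fun=> 0)); first exact: cvg_cst.
    by apply/funext => n; rewrite /d u0 !mul0r.
  have -> : Num.sg (u x) * u1 x = u x * u1 x / `|u x|.
    by rewrite {2}[u x]numEsg; field; rewrite normr_eq0.
  apply: cvgM; first exact: cvg_cst.
  by apply: cvgV; [rewrite normr_eq0|exact: crl].
have dn n x : `|d n x| <= `|u1 x|.
  rewrite /d !normrM normfV (gtr0_norm (r0 n x)) mulrAC ler_piMl//.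
  by rewrite ler_pdivrMr// mul1r.
have md : mble (fun x => Num.sg (u x) * u1 x).
  apply: (@measurable_fun_cvg _ (measurableTypeR R) R setT d) => //.
  by move=> n; exact: cont_mble.
have sq x : (Num.sg (u x) * u1 x) ^+ 2 <= u1 x ^+ 2.
  rewrite exprMn ler_piMl ?sqr_ge0//.
  by rewrite -real_normK ?num_real// normr_sg; case: (u x == 0); rewrite ?expr0n ?expr1n.
have itsq : itg setT (fun x => (Num.sg (u x) * u1 x) ^+ 2).
  apply: (itg_le _ _ (h1_der h)) => //; first exact: mbleX.
  by move=> x _; rewrite ger0_norm ?sqr_ge0.
split => //; last first.
  apply: (@eq_itg _ _ (fun x => u x ^+ 2)) => //; last exact: h1_fun h.
  by move=> x _; rewrite real_normK ?num_real.
split => //; first by move=> a b; exact: itgTS.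
move=> a b ab.
have c1 : Rint `[a, b] (d n) @[n --> \oo] --> Rint `[a, b] (fun x => Num.sg (u x) * u1 x).
  apply: (@Rint_dom _ _ _ _ (fun x => `|u1 x|)) => //.
  - by move=> n; exact: cont_mble.
  - by apply: itg_norm => //; exact: itg_cont.
have c2 : r n b - r n a @[n --> \oo] --> `|u b| - `|u a| by exact: cvgB.
apply: (cvg_unique (@Rhausdorff R) c2).
rewrite (_ : (fun n => _) = (fun n => Rint `[a, b] (d n)))//.
by apply/funext => n; exact: (ac_ftc (AC_C1 (dr n) (cd n)) ab).
Qed.

Lemma Psi_vanish w : H1p w -> (forall x, su w x = 0) -> (forall x, sv w x = 0) -> Psi w = mA w.
Proof.
move=> hw u0 v0; rewrite PsiE//; apply: eq_Rint => x _.
by rewrite /dPsi /dB /dC u0 v0 !expr0n /= !mul0r !mulr0 addr0 !subr0.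
Qed.

Lemma abs_min w : H1p w -> Sol w -> is_even (su w) /\ is_even (sv w) -> 0 < mA w -> En w = cinf ->
  exists z, [/\ H1p z, Sol z, is_even (su z) /\ is_even (sv z), 0 < mA z & En z = cinf] /\
    forall x, 0 <= su z x /\ 0 <= sv z x.
Proof.
move=> hw hS [ev1 ev2] A0 Ec; have P0 := sol_Psi l1_gt0 l2_gt0 be_gt0 hw hS.
case: (hS) => d1 d2 d3 d4; case: (hw) => h k.
have cg := is_derive_cont d2; have ck := is_derive_cont d4.
have h' := H1_abs h d1 cg; have k' := H1_abs k d3 ck.
pose z := St (fun x => `|su w x|) (fun x => Num.sg (su w x) * sg w x)
  (fun x => `|sv w x|) (fun x => Num.sg (sv w x) * sk w x).
have hz : H1p z by [].
have sgsq (p q : R) : (Num.sg p * q) ^+ 2 <= q ^+ 2.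
  rewrite exprMn ler_piMl ?sqr_ge0//.
  by rewrite -real_normK ?num_real// normr_sg; case: (p == 0); rewrite ?expr0n ?expr1n.
have nsq (p : R) : `|p| ^+ 2 = p ^+ 2 by rewrite real_normK ?num_real.
have leA : mA z <= mA w.
  apply: Rint_le => //; [exact: itg_dA|exact: itg_dA|move=> x _].
  rewrite /dA /= !nsq; have := sgsq (su w x) (sg w x); have := sgsq (sv w x) (sk w x); lra.
have eqC : mC z = mC w.
  apply: eq_Rint => x _; rewrite /dC /=.
  by rewrite (exprM _ 2 2) nsq -exprM.
have leB : mB w <= mB z.
  apply: Rint_le => //; [exact: itg_dB|exact: itg_dB|move=> x _].
  rewrite /dB /= nsq.
  have l3 : sv w x ^+ 3 <= `|sv w x| ^+ 3 by rewrite -normrX ler_norm.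
  have l4 : su w x ^+ 2 * sv w x <= su w x ^+ 2 * `|sv w x|.
    by rewrite ler_wpM2l ?sqr_ge0// ler_norm.
  have : be * (su w x ^+ 2 * sv w x) <= be * (su w x ^+ 2 * `|sv w x|) by rewrite ler_pM2l.
  lra.
have A1 : 0 < mA z.
  rewrite ltNge; apply/negP => An.
  have [uz vz] := mA_eq0 l1_gt0 l2_gt0 hz An.
  suff : mA w <= 0 by lra.
  have uz' x : su w x = 0 by apply/eqP; rewrite -normr_eq0; have /= -> := uz x.
  have vz' x : sv w x = 0 by apply/eqP; rewrite -normr_eq0; have /= -> := vz x.
  by rewrite -(Psi_vanish hw uz' vz') P0.
have Pz : Psi z <= 0 by rewrite -P0 /Energy.Psi eqC; lra.
have Ez : En z <= cinf by rewrite -Ec /Energy.En eqC; lra.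
have Ezc : En z = cinf by apply/eqP; rewrite eq_le Ez cinf_le0.
(* The infimum is attained at [z], which [cinf_lt] forbids when Psi z < 0. *)
have Pz0 : Psi z = 0.
  apply/eqP; rewrite eq_le Pz leNgt; apply/negP => Pneg.
  by have := cinf_lt l1_gt0 l2_gt0 hz Pneg; rewrite Ezc ltxx.
have cst_BC (f : R -> R) g : H1 f g -> BC (fun _ : nat => f) f.
  move=> hf; have [K K0 hK] := H1_bdd hf; have mf := h1_mble hf.
  by split => //; [exists K|move=> x; exact: cvg_cst].
(* Minimality makes [z] a solution: the constant sequence [z] meets the hypotheses of
   [limit_sol]. *)
have [u1 [v1 hS']] := @limit_sol _ _ _ _ l1_gt0 l2_gt0 (fun _ : nat => z) (su z) (sv z) (mA z) (mC z)
  (fun=> hz) (fun=> Pz0) (cst_BC _ _ h') (cst_BC _ _ k') (h1_cont h') (h1_cont k')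
  (@cvg_cst _ _ _ _ _) (@cvg_cst _ _ _ _ _) A1 Ezc.
have bdd (f : R -> R) g : H1 f g -> exists K, forall x, `|f x| <= K.
  by move=> hf; have [K K0 hK] := H1_bdd hf; exists K.
have [K hK] := bdd _ _ h'; have [L hL] := bdd _ _ k'.
have bK (n : nat) x : `|su z x| <= Num.max K L by rewrite le_max hK.
have bL (n : nat) x : `|sv z x| <= Num.max K L by rewrite le_max hL orbT.
(* The derivatives u1, v1 of the new solution are not syntactically those stored in [z];
   semicontinuity along the constant sequence transfers membership in W^{1,2} and the energy
   bound. *)
have [hH hE] := @lsc_En _ _ _ _ l1_gt0 l2_gt0 (fun _ : nat => z) (St (su z) u1 (sv z) v1) (En z) _ (fun=> hz)
   bK bL (fun x => @cvg_cst _ _ _ _ _) (fun x => @cvg_cst _ _ _ _ _) hS' (@cvg_cst _ _ _ _ _).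
have A2 : 0 < mA (St (su z) u1 (sv z) v1).
  rewrite ltNge; apply/negP => An.
  have [uz vz] := mA_eq0 l1_gt0 l2_gt0 hH An.
  suff : mA w <= 0 by lra.
  have uz' x : su w x = 0 by apply/eqP; rewrite -normr_eq0; have /= -> := uz x.
  have vz' x : sv w x = 0 by apply/eqP; rewrite -normr_eq0; have /= -> := vz x.
  by rewrite -(Psi_vanish hw uz' vz') P0.
exists (St (su z) u1 (sv z) v1); split; last by move=> x; split; exact: normr_ge0.
split => //.
- by split => x; rewrite /= ?ev1 ?ev2.
- apply/eqP; rewrite eq_le -{1}Ezc hE /=; apply: cinf_le0 => //.
  by rewrite (sol_Psi l1_gt0 l2_gt0 be_gt0 hH hS').
Qed.

End Minimizer.

(** * Positivity and the choice of Lambda *)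

Section Positivity.
Context {R : realType}.
Implicit Types (f g u v : R -> R) (a b c x y t s : R) (w z : @st R).

Lemma nonincreasing f f' a b : (forall x, is_derive x 1 f (f' x)) -> continuous f' ->
  a <= b -> (forall x, a <= x -> f' x <= 0) -> f b <= f a.
Proof.
move=> df cf ab neg; rewrite -subr_le0 (ac_ftc (AC_C1 df cf) ab).
have -> : 0 = Rint `[a, b] (fun=> 0 : R) by rewrite Rint_cst// mul0r.
apply: Rint_le => //; [exact: itg_cont|exact: itg_cst|].
by move=> x /=; rewrite in_itv/= => /andP[ax _]; exact: neg.
Qed.

(* e^(kx) (u' - k u), and then e^(-kx) u, is nonincreasing on [x0, +oo[. *)
Lemma strong_max u u1 f (k : R) x0 : (forall x, is_derive x 1 u (u1 x)) ->
  (forall x, is_derive x 1 u1 (f x)) -> continuous f ->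
  (forall x, f x <= k ^+ 2 * u x) -> (forall x, 0 <= u x) -> u x0 = 0 ->
  forall x, x0 <= x -> u x = 0.
Proof.
move=> du du1 cf hf u0 ux0.
have cu := is_derive_cont du; have cu1 := is_derive_cont du1.
have u10 : u1 x0 = 0.
  have hd : is_derive x0 1 u 0.
    apply: (@derive1_at_min R u (x0 - 1) (x0 + 1)); first lra.
    - by move=> t _; case: (du t).
    - by rewrite in_itv/=; apply/andP; split; lra.
    - by move=> t _; rewrite ux0.
  by rewrite -(@derive_val _ _ _ _ _ _ _ (du x0)) (@derive_val _ _ _ _ _ _ _ hd).
have dexp (r : R) x : is_derive x 1 (fun y => expR (r * y)) (r * expR (r * x)).
  have dl := @is_deriveZ _ _ _ (@id R) r x 1 1 (is_derive_id _ _).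
  have := @is_derive1_comp R expR (fun y => r * y) x _ _ (is_derive_expR _) dl.
  move=> h; apply: is_derive_eq h _.
  by rewrite /GRing.scale/= mulr1 mulrC.
pose y x := u1 x - k * u x.
have dy x : is_derive x 1 y (f x - k * u1 x).
  exact: (is_deriveB (du1 x) (@is_deriveZ _ _ _ u k x 1 _ (du x))).
pose F x := expR (k * x) * y x.
have dF x : is_derive x 1 F (expR (k * x) * (f x - k ^+ 2 * u x)).
  have := is_deriveM (dexp k x) (dy x).
  move=> h; apply: is_derive_eq h _.
  by rewrite /GRing.scale /= /y; ring.
have cE (r : R) : continuous (fun y => expR (r * y)) by exact: is_derive_cont (dexp r).
have y0 x : x0 <= x -> y x <= 0.
  move=> xx; have := @nonincreasing F _ x0 x dF _ xx.
  rewrite {2}/F /y u10 ux0 mulr0 subr0 mulr0 => h.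
  rewrite -(pmulr_rle0 _ (expR_gt0 (k * x))); apply: h.
    by apply: contM => //; apply: contB => //; exact: contZ.
  by move=> t _; rewrite pmulr_rle0 ?expR_gt0// subr_le0.
pose G x := expR (- k * x) * u x.
have dG x : is_derive x 1 G (expR (- k * x) * y x).
  have := is_deriveM (dexp (- k) x) (du x).
  move=> h; apply: is_derive_eq h _.
  by rewrite /GRing.scale /= /y; ring.
move=> x xx; apply/eqP; rewrite eq_le u0 andbT.
have := @nonincreasing G _ x0 x dG _ xx.
rewrite {2}/G ux0 mulr0 => h.
rewrite -(pmulr_rle0 _ (expR_gt0 (- k * x))); apply: h.
  by apply: contM => //; apply: contB => //; exact: contZ.
by move=> t xt; rewrite pmulr_rle0 ?expR_gt0//; exact: y0.
Qed.

(** [strong_max] propagates a zero only to the right. Evenness provides one at - |x0| <= 0, which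
    covers [0, +oo[, and then reflects the conclusion. *)
Lemma even_pos u u1 f (l : R) : 0 < l -> (forall x, is_derive x 1 u (u1 x)) ->
  (forall x, is_derive x 1 u1 (f x)) -> continuous f ->
  (forall x, f x <= l * u x) -> (forall x, 0 <= u x) -> is_even u ->
  (forall x, u x = 0) \/ (forall x, 0 < u x).
Proof.
move=> l0 du du1 cf hf u0 ev.
have [[x0 h]|h] := pselect (exists x0, u x0 = 0); [left|right] => x; last first.
  by rewrite lt_neqAle u0 andbT eq_sym; apply/eqP => e; apply: h; exists x.
have hf' y : f y <= Num.sqrt l ^+ 2 * u y by rewrite sqr_sqrtr// ltW.
have n0 : u (- `|x0|) = 0.
  by have [x0p|x0n] := leP 0 x0; [rewrite ger0_norm// ev|rewrite ltr0_norm// opprK].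
have key := strong_max du du1 cf hf' u0 n0.
have x00 := normr_ge0 x0.
have [xp|xn] := leP 0 x; first by apply: key; lra.
by rewrite -ev; apply: key; lra.
Qed.

Variables (l1 l2 : R).
Hypotheses (l1_gt0 : 0 < l1) (l2_gt0 : 0 < l2).

Definition semi_level : R := 6^-1 * (4 * l2 ^+ 2 / emb l1 l2).

Lemma semi_level_gt0 : 0 < semi_level.
Proof.
have e0 := emb_gt0 l1_gt0 l2_gt0.
by rewrite mulr_gt0 ?invr_gt0// divr_gt0// mulr_gt0// exprn_gt0.
Qed.

(** When u = 0, [be] drops out and A = B is at most (K/2) times the integral of v^2, K being the sup
    bound from the embedding. As l2 times that integral is at most A, this forces K >= 2 l2; with
    K^2 = emb A it bounds A from below. *)
Lemma semi_trivial (be : R) w : H1p w -> Psi l1 l2 be w = 0 -> 0 < mA l1 l2 w ->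
  (forall x, su w x = 0) -> semi_level <= En l1 l2 w.
Proof.
move=> hw P0 A0 uz; have e0 := emb_gt0 l1_gt0 l2_gt0.
pose K := Num.sqrt (emb l1 l2 * mA l1 l2 w).
have K0 : 0 <= K by exact: sqrtr_ge0.
have K2 : K ^+ 2 = emb l1 l2 * mA l1 l2 w by rewrite sqr_sqrtr// mulr_ge0// ltW.
have hK x : sv w x <= K.
  apply: le_trans (ler_norm _) _.
  rewrite -(@ler_pXn2r _ 2)// ?nnegrE// real_normK ?num_real// K2.
  by case: (sup_mA l1_gt0 l2_gt0 x hw).
have [_ A2] := mA_ge l1_gt0 l2_gt0 hw.
case: (hw) => h k; have iv := h1_fun k.
have B1 : mB be w <= 2^-1 * K * Rint setT (fun x => sv w x ^+ 2).
  rewrite -RintZ//; apply: Rint_le => //; [exact: itg_dB|exact: itgZ|move=> x _].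
  rewrite /dB uz expr0n /= mul0r mulr0 addr0 -mulrA ler_pM2l ?invr_gt0//.
  by rewrite exprS ler_wpM2r// sqr_ge0.
have C1 : mC w = 0.
  rewrite -[RHS](mul0r (Rint setT (fun x => sv w x ^+ 2))) -RintZ//.
  by apply: eq_Rint => x _; rewrite /dC uz expr0n /= mul0r.
have A3 : mA l1 l2 w = mB be w by move: P0; rewrite /Psi C1; lra.
set S := Rint _ _ in A2 B1.
have k2 : 2 * l2 <= K.
  rewrite -(ler_pM2l A0).
  have : mA l1 l2 w * l2 <= 2^-1 * K * S * l2 by rewrite ler_pM2r// A3.
  have : 2^-1 * K * (l2 * S) <= 2^-1 * K * mA l1 l2 w by rewrite ler_wpM2l// mulr_ge0.
  move=> h1 h2.
  have e1 : 2^-1 * K * S * l2 = 2^-1 * K * (l2 * S) by ring.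
  have e2 : mA l1 l2 w * (2 * l2) = 2 * (mA l1 l2 w * l2) by ring.
  have e3 : mA l1 l2 w * K = 2 * (2^-1 * K * mA l1 l2 w) by field.
  lra.
rewrite /semi_level /En C1 mulr0 addr0 ler_pM2l ?invr_gt0// ler_pdivrMr// [leRHS]mulrC -K2.
have -> : 4 * l2 ^+ 2 = (2 * l2) ^+ 2 by ring.
by rewrite lerXn2r ?nnegrE// mulr_ge0// ltW.
Qed.

(** The scale t is fixed first, by [semi_level] alone, so that the energy is small whatever [be] is.
    The cubic term of the pair (bump, bump) is positive and grows linearly in [be], so a large [be]
    then makes [Psi] negative. *)
Lemma test_state : exists Lam : R, 0 < Lam /\ forall be, Lam < be ->
  exists w0, [/\ H1p w0, Psi l1 l2 be w0 < 0 & En l1 l2 w0 < semi_level].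
Proof.
have tb := @bump_tf R.
have [b1 db tb1] := tf_derive tb.
have hb := tf_H1 tb db.
pose w := St (@bump R) b1 (@bump R) b1.
have hw : H1p w by [].
pose A := mA l1 l2 w; pose C := mC w.
pose B := Rint setT (fun x => @bump R x ^+ 3).
have cb := tf_cont tb.
have i3 : itg setT (fun x => @bump R x ^+ 3).
  apply: itg_supp_cont; first exact: contX.
  by exists 1 => // x hx; rewrite bump_supp// expr0n.
have B0 : 0 < B.
  apply: (@Rint_gt0 _ _ 2^-1) => //; first exact: contX.
    by move=> x; rewrite exprn_ge0// bump_ge0.
  by rewrite exprn_gt0// bump_gt0//; lra.
have A0 : 0 <= A by exact: mA_ge0.
have C0 : 0 <= C by exact: mC_ge0.
have s0 := semi_level_gt0.
have AC : 0 < A + C + 1 by lra.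
pose t := Num.min 1 (semi_level / (A + C + 1)).
have t0 : 0 < t by rewrite lt_min ltr01 divr_gt0.
have t1 : t <= 1 by rewrite ge_min lexx.
have t2 : t * (A + C + 1) <= semi_level.
  by rewrite -ler_pdivlMr// ge_min lexx orbT.
have eB be : mB be w = (2^-1 + 3 / 2 * be) * B.
  by rewrite /B -RintZ//; apply: eq_Rint => x _; rewrite /dB /=; field.
(* Beyond A / (t B) the cubic term outweighs A; adding 1 makes the threshold positive, as only A >=
   0 is at hand. *)
exists (A / (t * B) + 1); split.
  by rewrite ltr_wpDl// divr_ge0// mulr_ge0// ltW.
move=> be hbe; exists (sc t w).
have tB : 0 < t * B by rewrite mulr_gt0.
have AtB : 0 <= A / (t * B) by rewrite divr_ge0// ltW.
have hbe' : A < be * (t * B) by rewrite -ltr_pdivrMr//; lra.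
split; first exact: (H1p_sc t hw).
- rewrite /Psi mA_sc// mB_sc// mC_sc// eB -/A -/C.
  have -> : t ^+ 2 * A - t ^+ 3 * ((2^-1 + 3 / 2 * be) * B) - t ^+ 4 * C =
    t ^+ 2 * (A - 3 / 2 * (be * (t * B)) - 2^-1 * (t * B) - t ^+ 2 * C) by field.
  rewrite pmulr_rlt0 ?exprn_gt0//.
  have : 0 <= t ^+ 2 * C by rewrite mulr_ge0// sqr_ge0.
  lra.
- rewrite /En mA_sc// mC_sc// -/A -/C.
  have q2 : t ^+ 2 <= t by rewrite -[leRHS]expr1; apply: ler_wiXn2l => //; lra.
  have q4 : t ^+ 4 <= t by rewrite -[leRHS]expr1; apply: ler_wiXn2l => //; lra.
  have : t ^+ 2 * A <= t * A by rewrite ler_wpM2r.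
  have : t ^+ 4 * C <= t * C by rewrite ler_wpM2r.
  have : 0 <= t * A by rewrite mulr_ge0// ltW.
  have : 0 <= t * C by rewrite mulr_ge0// ltW.
  move: t2; rewrite !mulrDr mulr1; lra.
Qed.

Lemma core : exists Lam : R, 0 < Lam /\ forall be, Lam < be ->
  exists w, [/\ H1p w, Sol l1 l2 be w, is_even (su w) /\ is_even (sv w),
    (forall x, 0 < su w x) /\ (forall x, 0 < sv w x) & 0 < mA l1 l2 w /\ En l1 l2 w = cinf l1 l2 be].
Proof.
have [Lam [Lam0 hL]] := test_state.
exists Lam; split => // be hbe.
have be0 : 0 < be by lra.
have [w0 [h0 P0 E0]] := hL be hbe.
have [w [hw Sw evw Aw Ew]] := exist_min l1_gt0 l2_gt0 be0 h0 P0.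
have [z [[hz Sz [ev1 ev2] Az Ez] zp]] := abs_min l1_gt0 l2_gt0 be0 hw Sw evw Aw Ew.
exists z; split => //.
have Ez' : En l1 l2 z < semi_level.
  by rewrite Ez; apply: le_lt_trans (cinf_le l1_gt0 l2_gt0 h0 P0) E0.
have Pz := sol_Psi l1_gt0 l2_gt0 be0 hz Sz.
case: (Sz) => d1 d2 d3 d4; case: (hz) => h k.
have cr1 := @rhs1_cont R l1 be _ _ (h1_cont h) (h1_cont k).
have cr2 := @rhs2_cont R l2 be _ _ (h1_cont h) (h1_cont k).
have le1 x : rhs1 l1 be (su z) (sv z) x <= l1 * su z x.
  have [u0 v0] := zp x; rewrite /rhs1.
  have : 0 <= su z x ^+ 3 by rewrite exprn_ge0.
  have : 0 <= be * (su z x * sv z x) by apply: mulr_ge0; [exact: ltW|exact: mulr_ge0].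
  lra.
have le2 x : rhs2 l2 be (su z) (sv z) x <= l2 * sv z x.
  have [u0 v0] := zp x; rewrite /rhs2.
  have : 0 <= sv z x ^+ 2 by rewrite exprn_ge0.
  have : 0 <= 2^-1 * be * su z x ^+ 2.
    by apply: mulr_ge0; [apply: mulr_ge0 => //; exact: ltW|exact: sqr_ge0].
  lra.
have [uz|up] := even_pos l1_gt0 d1 d2 cr1 le1 (fun x => (zp x).1) ev1.
  have := semi_trivial hz Pz Az uz; lra.
have [vz|vp] := even_pos l2_gt0 d3 d4 cr2 le2 (fun x => (zp x).2) ev2; last by [].
(* If v = 0, the second equation reduces to be u^2 / 2 = 0, against u > 0. *)
exfalso.
have k0 x : sk z x = 0.
    have := d3 x; rewrite (_ : sv z = cst 0); last by apply/funext.
    move=> hd; rewrite -(@derive_val _ _ _ _ _ _ _ hd).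
    by rewrite (@derive_val _ _ _ _ _ _ _ (is_derive_cst (0:R) x 1)).
have r0 x : rhs2 l2 be (su z) (sv z) x = 0.
    have := d4 x; rewrite (_ : sk z = cst 0); last by apply/funext.
    move=> hd; rewrite -(@derive_val _ _ _ _ _ _ _ hd).
    by rewrite (@derive_val _ _ _ _ _ _ _ (is_derive_cst (0:R) x 1)).
have := r0 0; rewrite /rhs2 vz mulr0 expr0n /= mulr0 !subr0 sub0r => /eqP.
  by rewrite oppr_eq0 !mulf_eq0 invr_eq0 pnatr_eq0 /= gt_eqF// gt_eqF// up.
Qed.

End Positivity.

(** * Critical points of Phi on W^{1,2} *)

Section Link.
Context {R : realType}.
Local Notation mu := (@lebesgue_measure R).
Local Notation ae_imp := (@filterS _ _ (ae_filter_ringOfSetsType mu) _ _ _).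
Local Notation ae_imp2 := (@filterS2 _ _ (ae_filter_ringOfSetsType mu) _ _ _ _).
Implicit Types (f g u v p q : R -> R) (a b c x y t s : R).

Lemma LfunE f : f \in Lfun mu 2%:E <-> mble f /\ itg setT (fun x => f x ^+ 2).
Proof.
split=> [hf|[mf hf]].
  split; last exact: Lfun2_integrable_sqr.
  by move: hf; rewrite inE => /andP[+ _]; rewrite inE.
rewrite inE; apply/andP; split; rewrite inE//=.
rewrite /finite_norm unlock /=; apply: poweR_lty.
have /integrableP[_] := hf; apply: le_lt_trans.
rewrite le_eqVlt; apply/orP; left; apply/eqP; apply: eq_integral => x _ /=.
by rewrite powR_mulrn// normrX.
Qed.

Lemma itg_sq_loc f a b : mble f -> itg setT (fun x => f x ^+ 2) -> itg `[a, b] f.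
Proof. by move=> mf hf; apply: itg_sq_itv => //; exact: itgTS. Qed.

Lemma AC_prim g : mble g -> itg setT (fun x => g x ^+ 2) -> AC (prim g) g.
Proof.
move=> mg hg; have ig a b := itg_sq_loc a b mg hg.
split => //; first by move=> a b; exact: itgTS.
move=> a b ab; rewrite /prim.
have [a0|a0] := leP 0 a.
  by rewrite (le_trans a0 ab) (Rint_split a0 ab)//; ring.
have [b0|b0] := leP 0 b; first by rewrite (Rint_split (ltW a0) b0)//; ring.
by rewrite (Rint_split ab (ltW b0))//; ring.
Qed.

Lemma weak_derivE u g : weak_derivative u g <->
  forall phi phi1, tf phi -> (forall x, is_derive x 1 phi (phi1 x)) ->
    Rint setT (fun x => u x * phi1 x) = - Rint setT (fun x => g x * phi x).
Proof.
split=> [h phi phi1 tp dp|h phi tp].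
  by have := h phi (tf_test tp); rewrite (is_derive_derive1 dp).
have tp' := test_tf tp; have [p1 dp _] := tf_derive tp'.
by have := h _ _ tp' dp; rewrite (is_derive_derive1 dp).
Qed.

(* p is the continuous representative of u in W^{1,2}, and g its weak derivative. *)
Definition rep u p g := [/\ mble u, ae_eq mu setT u p & H1 p g].

(** [u] minus the primitive of [g] has zero weak derivative, hence is almost everywhere a constant
    by du Bois-Reymond. *)
Lemma weak_rep u g : u \in Lfun mu 2%:E -> g \in Lfun mu 2%:E -> weak_derivative u g ->
  exists p, rep u p g.
Proof.
move=> /LfunE[m_u iu] /LfunE[mg ig] /weak_derivE hw.
have hac := AC_prim mg ig.
have cp := ac_cont hac.
have lu a b := itg_sq_loc a b m_u iu.
have [|||c hc] := @du_bois_reymond_ae _ (fun x => u x - prim g x).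
- by apply: mbleB => //; exact: cont_mble.
- by move=> a b; apply: itgB => //; exact: itg_cont.
- move=> phi phi1 tp dp.
  have tp1 := tf_of_derive tp dp.
  have -> : (fun x => (u x - prim g x) * phi1 x) = (fun x => u x * phi1 x - prim g x * phi1 x).
    by apply/funext => x; rewrite mulrBl.
  have st : exists2 M, 0 < M & supp_in M phi1 by case: tp1.
  rewrite RintB//; last 2 first.
  + by apply: itg_suppM => //; exact: tf_cont.
  + exact: tf_itgM.
  by rewrite (hw _ _ tp dp) (AC_tf hac tp dp) subrr.
exists (fun x => prim g x + c).
have mp : mble (fun x => prim g x + c).
  by apply: mbleD; [exact: cont_mble|exact: mble_cst].
have ae : ae_eq mu setT u (fun x => prim g x + c).
  apply: (ae_imp hc) => x /= hx /hx e.
  by rewrite -e addrC subrK.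
split => //; split => //.
- split; [by []|by move=> a b; exact: itgTS|].
  by move=> a b ab; rewrite -(ac_ftc hac ab); ring.
- apply: (@ae_eq_itg _ (fun x => u x ^+ 2)) => //; [exact: mbleX|exact: mbleX|].
  by apply: (ae_imp ae) => x /= hx /hx ->.
Qed.

Lemma rep_weak u p g : rep u p g -> [/\ u \in Lfun mu 2%:E, g \in Lfun mu 2%:E & weak_derivative u g].
Proof.
move=> [m_u ae h]; have mp := h1_mble h; split.
- apply/LfunE; split => //.
  apply: (@ae_eq_itg _ (fun x => p x ^+ 2)); [exact: mbleX|exact: mbleX| |exact: h1_fun h].
  by apply: (ae_imp ae) => x /= hx /hx ->.
- by apply/LfunE; split; [exact: h1_dmble h|exact: h1_der h].
- apply/weak_derivE => phi phi1 tp dp.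
  rewrite -(AC_tf (h1_ac h) tp dp).
  have tp1 := tf_of_derive tp dp.
  have mp1 := cont_mble (tf_cont tp1).
  apply: ae_eq_Rint; [exact: mbleM|exact: mbleM|].
  by apply: (ae_imp ae) => x /= hx /hx ->.
Qed.

Lemma rep_W12 u p g : rep u p g -> W12 u.
Proof. by move=> /rep_weak[h1 h2 h3]; split => //; exists g. Qed.

Lemma W12_rep u : W12 u -> exists p g, rep u p g.
Proof.
by move=> [hu [g [hg hw]]]; have [p hp] := weak_rep hu hg hw; exists p, g.
Qed.

Lemma weak_uniq u g g' : mble g -> mble g' -> itg setT (fun x => g x ^+ 2) ->
  itg setT (fun x => g' x ^+ 2) -> weak_derivative u g -> weak_derivative u g' ->
  ae_eq mu setT g g'.
Proof.
move=> mg mg' ig ig' /weak_derivE h /weak_derivE h'.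
have lg a b := itg_sq_loc a b mg ig; have lg' a b := itg_sq_loc a b mg' ig'.
have : ae_eq mu setT (fun x => g x - g' x) (fun=> 0).
  apply: test_ae0; [exact: mbleB|by move=> a b; exact: itgB|move=> phi tp].
  have [p1 dp _] := tf_derive tp.
  have e1 := h _ _ tp dp; have e2 := h' _ _ tp dp.
  have -> : (fun x => (g x - g' x) * phi x) = (fun x => g x * phi x - g' x * phi x).
    by apply/funext => x; rewrite mulrBl.
  have st : exists2 M, 0 < M & supp_in M phi by case: tp.
  have ct := tf_cont tp.
  by rewrite RintB//; [lra|exact: itg_suppM|exact: itg_suppM].
by apply: ae_imp => x /= hx /hx/eqP;
  rewrite subr_eq0 => /eqP.
Qed.

(** The witness [g] rules out the default value of [xget], and uniqueness of weak derivatives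
    identifies the chosen one with [g], though only almost everywhere. *)
Lemma rep_wderiv u p g : rep u p g ->
  [/\ mble (wderiv u), ae_eq mu setT (wderiv u) g & itg setT (fun x => wderiv u x ^+ 2)].
Proof.
move=> hr; have [h1 h2 h3] := rep_weak hr.
have : [set g | g \in Lfun mu 2%:E /\ weak_derivative u g] (wderiv u).
  by rewrite /wderiv; apply: (@xgetPex _ (fun=> 0)); exists g.
move=> [/LfunE[m1 i1] w1]; split => //.
case: hr => _ _ hh.
by apply: (@weak_uniq u) => //; [exact: h1_dmble hh|exact: h1_der hh].
Qed.

Lemma rep_add u p g u' p' g' : rep u p g -> rep u' p' g' ->
  rep (u + u') (fun x => p x + p' x) (fun x => g x + g' x).
Proof.
move=> [m1 a1 h1] [m2 a2 h2]; split; [exact: mbleD| |exact: H1_D].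
apply: (ae_imp2 a1 a2) => x /= e1 e2 xT.
by rewrite -(e1 xT) -(e2 xT).
Qed.

Lemma rep_scale k u p g : rep u p g ->
  rep (fun x => k * u x) (fun x => k * p x) (fun x => k * g x).
Proof.
move=> [m1 a1 h1]; split; [exact: mbleZ| |exact: H1_Z].
by apply: (ae_imp a1) => x /= e1 xT; rewrite e1.
Qed.

Lemma rep_refl u g : H1 u g -> rep u u g.
Proof.
move=> h; split => //; first exact: h1_mble h.
by apply: (@filterE _ _ (ae_filter_ringOfSetsType mu)).
Qed.

Variables (l1 l2 be : R).
Hypotheses (l1_gt0 : 0 < l1) (l2_gt0 : 0 < l2) (be_gt0 : 0 < be).

Definition rep2 (w : (R -> R) * (R -> R)) (z : @st R) :=
  rep w.1 (su z) (sg z) /\ rep w.2 (sv z) (sk z).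

(** [Phi] sorted by degree of homogeneity: a third of [mB] is 1/6 of the integral of v^3 plus be/2
    times that of u^2 v. *)
Definition PhiS z : R := 2^-1 * mA l1 l2 z - 4^-1 * mC z - 3^-1 * mB be z.

Lemma sqnorm_rep l u p g : rep u p g ->
  sqnorm l u = Rint setT (fun x => g x ^+ 2) + l * Rint setT (fun x => p x ^+ 2).
Proof.
move=> hr; have [m1 a1 i1] := rep_wderiv hr; case: (hr) => m_u au h.
rewrite -RintZ//; last exact: h1_fun h.
rewrite -RintD//; [|exact: h1_der h|by apply: itgZ => //; exact: h1_fun h].
apply: ae_eq_Rint.
- by apply: mbleD; [exact: mbleX|apply: mbleZ; exact: mbleX].
- by apply: mbleD; [apply: mbleX; exact: h1_dmble h|apply: mbleZ; apply: mbleX; exact: h1_mble h].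
- apply: (ae_imp2 a1 au) => x /= e1 e2 xT.
  by rewrite e1// e2.
Qed.

Lemma mA_split z : H1p z -> mA l1 l2 z = Rint setT (fun x => sg z x ^+ 2)
  + l1 * Rint setT (fun x => su z x ^+ 2)
  + (Rint setT (fun x => sk z x ^+ 2) + l2 * Rint setT (fun x => sv z x ^+ 2)).
Proof.
move=> [h k]; have i1 := h1_fun h; have i2 := h1_der h; have i3 := h1_fun k; have i4 := h1_der k.
have -> : mA l1 l2 z = Rint setT (fun x => (sg z x ^+ 2 + l1 * su z x ^+ 2)
    + (sk z x ^+ 2 + l2 * sv z x ^+ 2)).
  by apply: eq_Rint => x _; rewrite /dA; ring.
rewrite RintD//; [|by apply: itgD => //; exact: itgZ|by apply: itgD => //; exact: itgZ].
rewrite RintD//; last exact: itgZ.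
rewrite [X in _ + X = _]RintD//; last exact: itgZ.
by rewrite !RintZ.
Qed.

Lemma EE_norm_rep w z : rep2 w z -> EE_norm l1 l2 w = Num.sqrt (mA l1 l2 z).
Proof.
move=> [h k]; rewrite /EE_norm (sqnorm_rep _ h) (sqnorm_rep _ k) mA_split//.
by split; [case: h|case: k].
Qed.

Lemma Phi_rep w z : rep2 w z -> Phi l1 l2 be w = PhiS z.
Proof.
move=> [h k]; have hz : H1p z by split; [case: h|case: k].
rewrite /Phi (sqnorm_rep _ h) (sqnorm_rep _ k) /PhiS mA_split//.
case: h => m1 a1 h; case: k => m2 a2 k.
have mp := h1_mble h; have mq := h1_mble k.
have e1 : \int[leb R]_x (w.1 x ^+ 4) = mC z.
  apply: ae_eq_Rint; [exact: mbleX|exact: mbleX|].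
  by apply: (ae_imp a1) => x /= e xT; rewrite e.
have i3 : itg setT (fun x => sv z x ^+ 3).
  have [K K0 hK] := H1_bdd k.
  exact: itg_bddP k mq hK.
have i4 : itg setT (fun x => su z x ^+ 2 * sv z x).
  have [K K0 hK] := H1_bdd k.
  apply: (@eq_itg _ _ (fun x => sv z x * su z x ^+ 2)) => //; first by move=> x _; rewrite mulrC.
  exact: itg_bddP h mq hK.
have e2 : \int[leb R]_x (w.2 x ^+ 3) = Rint setT (fun x => sv z x ^+ 3).
  apply: ae_eq_Rint; [exact: mbleX|exact: mbleX|].
  by apply: (ae_imp a2) => x /= e xT; rewrite e.
have e3 : \int[leb R]_x (w.1 x ^+ 2 * w.2 x) = Rint setT (fun x => su z x ^+ 2 * sv z x).
  apply: ae_eq_Rint; [by apply: mbleM => //; exact: mbleX|by apply: mbleM => //; exact: mbleX|].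
  apply: (ae_imp2 a1 a2) => x /= f1 f2 xT.
  by rewrite f1// f2.
have e4 : mB be z = 2^-1 * Rint setT (fun x => sv z x ^+ 3)
    + 3 / 2 * be * Rint setT (fun x => su z x ^+ 2 * sv z x).
  by rewrite /mB RintD//; [rewrite !RintZ|exact: itgZ|exact: itgZ].
by rewrite e1 e2 e3 e4; field.
Qed.

Lemma rep2_add w z w' z' : rep2 w z -> rep2 w' z' -> rep2 (w + w') (sadd z z').
Proof. by move=> [h k] [h' k']; split; apply: rep_add. Qed.

Lemma rep2_H1p w z : rep2 w z -> H1p z.
Proof. by move=> [[_ _ h] [_ _ k]]. Qed.

Lemma EE_rep w : EE w -> exists z, rep2 w z.
Proof.
move=> [/W12_rep[p [g h]] /W12_rep[q [k h']]].
by exists (St p g q k).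
Qed.

(** The derivative is tested in the direction of w itself: Phi((1 + r) w) - Phi(w) = r (Psi + r q),
    with q bounded for r <= 1. *)
Lemma critical_Psi w z : rep2 w z -> critical_point l1 l2 be w -> Psi l1 l2 be z = 0.
Proof.
move=> hr hc; have hz := rep2_H1p hr.
set A := mA l1 l2 z; set B := mB be z; set C := mC z.
have A0 : 0 <= A by exact: mA_ge0.
have nA0 : 0 <= Num.sqrt A by exact: sqrtr_ge0.
apply/eqP; rewrite -normr_eq0 eq_le normr_ge0 andbT.
apply/ler_addgt0Pr => e' e'0; rewrite add0r.
pose e := e' / (Num.sqrt A + 1).
have e0 : 0 < e by rewrite divr_gt0//; lra.
have eE : e * Num.sqrt A + e = e'.
  by rewrite -[X in _ + X]mulr1 -mulrDr divfK// gt_eqF//; lra.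
have [d [d0 hd]] := hc e e0.
(* Bounds q for 0 < r <= 1: 11 = 6 + 4 + 1 and 4 = 3 + 1 bound the factors 6 + 4 r + r^2 and 3 +
   r. *)
pose N := `|2^-1 * A| + 11 * `|C| + 4 * `|B|.
have N0 : 0 <= N by rewrite !addr_ge0// mulr_ge0.
pose r := Num.min 1 (Num.min (d / (Num.sqrt A + 1) / 2) (e / (N + 1))).
have r0 : 0 < r.
  rewrite !lt_min ltr01 /=; apply/andP; split; last by rewrite divr_gt0//; lra.
  by rewrite divr_gt0// divr_gt0//; lra.
have r1 : r <= 1 by rewrite ge_min lexx.
have r2 : r * (Num.sqrt A + 1) <= d / 2.
  rewrite -ler_pdivlMr; last lra.
  by rewrite mulrAC !ge_min lexx orbT.
have r3 : r * (N + 1) <= e.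
  rewrite -ler_pdivlMr; last lra.
  by rewrite !ge_min lexx !orbT.
pose h : (R -> R) * (R -> R) := (fun x => r * w.1 x, fun x => r * w.2 x).
have hh : rep2 h (sc r z) by case: hr => a b; split; apply: rep_scale.
have EEh : EE h by case: hh => a b; split; [exact: rep_W12 a|exact: rep_W12 b].
have nh : EE_norm l1 l2 h = r * Num.sqrt A.
  rewrite (EE_norm_rep hh) mA_sc// sqrtrM ?sqr_ge0// sqrtr_sqr gtr0_norm//.
have := hd h EEh; rewrite nh => /(_ _).
have lt : r * Num.sqrt A < d by rewrite mulrDr mulr1 in r2; lra.
move=> /(_ lt).
rewrite (Phi_rep (rep2_add hr hh)) (Phi_rep hr).
have -> : sadd z (sc r z) = sc (1 + r) z.
  by rewrite /sadd /sc /=; f_equal; apply/funext => x; rewrite mulrDl mul1r.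
rewrite /PhiS mA_sc// mB_sc// mC_sc// -/A -/B -/C.
pose q := 2^-1 * A - 4^-1 * C * (6 + 4 * r + r ^+ 2) - 3^-1 * B * (3 + r).
have -> : 2^-1 * ((1 + r) ^+ 2 * A) - 4^-1 * ((1 + r) ^+ 4 * C) - 3^-1 * ((1 + r) ^+ 3 * B)
   - (2^-1 * A - 4^-1 * C - 3^-1 * B) = r * (Psi l1 l2 be z + r * q).
  by rewrite /Psi -/A -/B -/C /q; field.
rewrite normrM gtr0_norm// mulrCA ler_pM2l// => H.
have qN : `|q| <= N.
  rewrite /q /N; apply: le_trans (ler_normB _ _) _; apply: lerD; last first.
    rewrite !normrM (_ : `|3^-1| = 3^-1 :> R); last by rewrite gtr0_norm ?invr_gt0.
    rewrite (_ : `|3 + r| = 3 + r); last by rewrite gtr0_norm//; lra.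
    have := normr_ge0 B; nra.
  apply: le_trans (ler_normB _ _) _; apply: lerD => //.
  rewrite !normrM (_ : `|4^-1| = 4^-1 :> R); last by rewrite gtr0_norm ?invr_gt0.
  have rr : r ^+ 2 <= 1 by rewrite exprn_ile1// ltW.
  have rr0 : 0 <= r ^+ 2 by exact: sqr_ge0.
  rewrite (_ : `|6 + 4 * r + r ^+ 2| = 6 + 4 * r + r ^+ 2); last by rewrite gtr0_norm//; lra.
  rewrite mulrAC ler_wpM2r//; lra.
have rq : `|r * q| <= e.
  rewrite normrM gtr0_norm//; apply: le_trans r3.
  by rewrite ler_wpM2l ?ltW//; lra.
have := ler_normB (Psi l1 l2 be z + r * q) (r * q).
rewrite addrK; lra.
Qed.

Lemma bound_state_level w z : rep2 w z -> ~ EE_zero w -> critical_point l1 l2 be w ->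
  cinf l1 l2 be <= Phi l1 l2 be w.
Proof.
move=> hr hn hc; have hz := rep2_H1p hr; have P0 := critical_Psi hr hc.
rewrite (Phi_rep hr).
have -> : PhiS z = En l1 l2 z by move: P0; rewrite /Psi /PhiS /En; lra.
apply: cinf_le0 => //; last by rewrite P0.
rewrite ltNge; apply/negP => An; apply: hn.
have [uz vz] := mA_eq0 l1_gt0 l2_gt0 hz An.
case: hr => [[_ a1 _] [_ a2 _]]; split.
- by apply: (ae_imp a1) => x /= e xT; rewrite e// uz.
- by apply: (ae_imp a2) => x /= e xT; rewrite e// vz.
Qed.

End Link.

(** * Solutions are critical points of Phi *)

Section Critical.
Context {R : realType}.
Implicit Types (f g u v p q : R -> R) (a b c x y t s : R) (z h : @st R).
Variables (l1 l2 be : R).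
Hypotheses (l1_gt0 : 0 < l1) (l2_gt0 : 0 < l2) (be_gt0 : 0 < be).

(** The part of the increment of [dPhi] linear in h; at a solution it has zero integral by
    [H1_prod]. The remainder [drem] has degree at least two in h. *)
Definition dlin z h x :=
  (su h x * rhs1 l1 be (su z) (sv z) x + sg h x * sg z x)
  + (sv h x * rhs2 l2 be (su z) (sv z) x + sk h x * sk z x).

Definition drem z h x := 2^-1 * dA l1 l2 h x
  - (3 / 2 * (su z x ^+ 2 * su h x ^+ 2) + su z x * su h x ^+ 3 + 4^-1 * su h x ^+ 4)
  - (2^-1 * (sv z x * sv h x ^+ 2) + be * (su z x * su h x * sv h x)
     + 2^-1 * be * (sv z x * su h x ^+ 2) + 6^-1 * sv h x ^+ 3
     + 2^-1 * be * (su h x ^+ 2 * sv h x)).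

Definition dPhi z x := 2^-1 * dA l1 l2 z x - 4^-1 * dC z x - 3^-1 * dB be z x.

Lemma dPhi_exp z h x : dPhi (sadd z h) x = dPhi z x + (dlin z h x + drem z h x).
Proof.
by rewrite /dPhi /dA /dB /dC /dlin /drem /dA /rhs1 /rhs2 /=; field.
Qed.

Lemma itg_dPhi z : H1p z -> itg setT (dPhi z).
Proof.
move=> hz; apply: itgB => //; last by apply: itgZ => //; exact: itg_dB.
by apply: itgB => //; apply: itgZ => //; [exact: itg_dA|exact: itg_dC].
Qed.

Lemma PhiSE z : H1p z -> PhiS l1 l2 be z = Rint setT (dPhi z).
Proof.
move=> hz; have i1 := itg_dA l1 l2 hz; have i2 := itg_dC hz; have i3 := itg_dB be hz.
rewrite RintB//; [|by apply: itgB => //; exact: itgZ|exact: itgZ].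
by rewrite RintB//; [rewrite !RintZ|exact: itgZ|exact: itgZ].
Qed.

Lemma Rint_dlin z h : H1p z -> Sol l1 l2 be z -> H1p h ->
  itg setT (dlin z h) /\ Rint setT (dlin z h) = 0.
Proof.
move=> hz hs [h1 h2]; have [k1 k2] := sol_H1 l1_gt0 l2_gt0 be_gt0 hz hs.
have i1 : itg setT (fun x => su h x * rhs1 l1 be (su z) (sv z) x + sg h x * sg z x).
  by apply: itgD => //; apply: L2_mul;
    by [exact: h1_L2 h1|exact: h1_L2 k1|exact: h1_dL2 h1|exact: h1_dL2 k1].
have i2 : itg setT (fun x => sv h x * rhs2 l2 be (su z) (sv z) x + sk h x * sk z x).
  by apply: itgD => //; apply: L2_mul;
    by [exact: h1_L2 h2|exact: h1_L2 k2|exact: h1_dL2 h2|exact: h1_dL2 k2].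
split; first exact: itgD.
by rewrite RintD// (H1_prod h1 k1) (H1_prod h2 k2) addr0.
Qed.

(** Every monomial has degree at least two in (p, q); with |p|, |q| <= 1 the excess degree is
    discarded. *)
Lemma drem_bound (U V K p q : R) : 0 <= K -> `|U| <= K -> `|V| <= K -> `|p| <= 1 -> `|q| <= 1 ->
  `|3 / 2 * (U ^+ 2 * p ^+ 2) + U * p ^+ 3 + 4^-1 * p ^+ 4
   + (2^-1 * (V * q ^+ 2) + be * (U * p * q) + 2^-1 * be * (V * p ^+ 2) + 6^-1 * q ^+ 3
     + 2^-1 * be * (p ^+ 2 * q))| <= (2 * K ^+ 2 + 2 * K + 1 + be * (2 * K + 1)) * (p ^+ 2 + q ^+ 2).
Proof.
move=> K0 hU hV hp hq.
have p0 := sqr_ge0 p; have q0 := sqr_ge0 q; have b0 := be_gt0.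
have U2 : 0 <= U ^+ 2 <= K ^+ 2.
  by rewrite sqr_ge0 -real_normK ?num_real// lerXn2r ?nnegrE.
have P2 : p ^+ 2 <= 1 by rewrite -real_normK ?num_real// exprn_ile1.
have t1 : 0 <= U ^+ 2 * p ^+ 2 <= K ^+ 2 * p ^+ 2.
  by case/andP: U2 => u1 u2; rewrite mulr_ge0//= ler_wpM2r.
have t2 : `|U * p ^+ 3| <= K * p ^+ 2.
  rewrite (_ : U * p ^+ 3 = U * p * p ^+ 2); last by ring.
  rewrite normrM (ger0_norm p0) ler_wpM2r// normrM -[leRHS]mulr1.
  exact: ler_pM.
have t3 : 0 <= p ^+ 4 <= p ^+ 2.
  by rewrite (_ : p ^+ 4 = p ^+ 2 * p ^+ 2); [rewrite mulr_ge0//= ler_piMr|ring].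
have t4 : `|V * q ^+ 2| <= K * q ^+ 2.
  by rewrite normrM (ger0_norm q0) ler_wpM2r.
have t5 : `|U * p * q| <= K * (p ^+ 2 + q ^+ 2).
  rewrite -mulrA normrM; apply: ler_pM => //.
  rewrite normrM -[p ^+ 2]real_normK ?num_real// -[q ^+ 2]real_normK ?num_real//.
  by have := sqr_ge0 (`|p| - `|q|); have := sqr_ge0 (`|p| + `|q|); nra.
have t6 : `|V * p ^+ 2| <= K * p ^+ 2.
  by rewrite normrM (ger0_norm p0) ler_wpM2r.
have t7 : `|q ^+ 3| <= q ^+ 2.
  by rewrite exprS normrM (ger0_norm q0) ler_piMl.
have t8 : `|p ^+ 2 * q| <= p ^+ 2 by rewrite normrM (ger0_norm p0) ler_piMr.
have t5' : `|be * (U * p * q)| <= be * (K * (p ^+ 2 + q ^+ 2)).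
  by rewrite normrM (gtr0_norm b0) ler_pM2l.
have t6' : `|be * (V * p ^+ 2)| <= be * (K * p ^+ 2).
  by rewrite normrM (gtr0_norm b0) ler_pM2l.
have t8' : `|be * (p ^+ 2 * q)| <= be * p ^+ 2.
  by rewrite normrM (gtr0_norm b0) ler_pM2l.
have n1 : 0 <= K * p ^+ 2 by rewrite mulr_ge0.
have n2 : 0 <= K * q ^+ 2 by rewrite mulr_ge0.
have n3 : 0 <= be * (K * p ^+ 2) by rewrite mulr_ge0// ltW.
have n4 : 0 <= be * (K * q ^+ 2) by rewrite mulr_ge0// ltW.
have n5 : 0 <= be * p ^+ 2 by rewrite mulr_ge0// ltW.
have n6 : 0 <= be * q ^+ 2 by rewrite mulr_ge0// ltW.
have n7 : 0 <= K ^+ 2 * q ^+ 2 by rewrite mulr_ge0// sqr_ge0.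
have -> : (2 * K ^+ 2 + 2 * K + 1 + be * (2 * K + 1)) * (p ^+ 2 + q ^+ 2) =
  2 * (K ^+ 2 * p ^+ 2) + 2 * (K ^+ 2 * q ^+ 2) + 2 * (K * p ^+ 2) + 2 * (K * q ^+ 2)
  + p ^+ 2 + q ^+ 2 + 2 * (be * (K * p ^+ 2)) + 2 * (be * (K * q ^+ 2)) + be * p ^+ 2 + be * q ^+ 2.
  by ring.
have E2 : be * (K * (p ^+ 2 + q ^+ 2)) = be * (K * p ^+ 2) + be * (K * q ^+ 2) by ring.
have E3 : 2^-1 * be * (V * p ^+ 2) = 2^-1 * (be * (V * p ^+ 2)) by ring.
have E4 : 2^-1 * be * (p ^+ 2 * q) = 2^-1 * (be * (p ^+ 2 * q)) by ring.
rewrite E2 in t5'; rewrite E3 E4.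
move: t1 t2 t3 t4 t5' t6' t7 t8'; rewrite !ler_norml.
move=> /andP[? ?] /andP[? ?] /andP[? ?] /andP[? ?] /andP[? ?] /andP[? ?] /andP[? ?] /andP[? ?].
by apply/andP; split; lra.
Qed.

(** The linear part integrates to zero, leaving a remainder quadratic in the norm of h; the
    smallness condition serves to get |h| <= 1 pointwise through the embedding. *)
Lemma sol_expansion z : H1p z -> Sol l1 l2 be z -> exists2 L : R, 0 < L &
  forall h, H1p h -> emb l1 l2 * mA l1 l2 h <= 1 ->
  `|PhiS l1 l2 be (sadd z h) - PhiS l1 l2 be z| <= L * mA l1 l2 h.
Proof.
move=> hz hs; case: (hz) => zu zv.
have [K1 K10 hK1] := H1_bdd zu; have [K2 K20 hK2] := H1_bdd zv.
pose K := K1 + K2.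
have K0 : 0 <= K by rewrite /K; lra.
pose N := 2 * K ^+ 2 + 2 * K + 1 + be * (2 * K + 1).
have N0 : 0 < N.
  have b0 := be_gt0.
  have : 0 <= be * (2 * K + 1) by apply: mulr_ge0; lra.
  have := sqr_ge0 K; rewrite /N; lra.
pose L := 2^-1 + N * (l1^-1 + l2^-1).
have L0 : 0 < L.
  by rewrite addr_gt0// ?invr_gt0// mulr_gt0// addr_gt0// invr_gt0.
exists L => // h hh hsmall.
have [il e0] := Rint_dlin hz hs hh.
have ia := itg_dPhi hz; have ib := itg_dPhi (H1p_add hz hh).
have er : drem z h = (fun x => dPhi (sadd z h) x - dPhi z x - dlin z h x).
  by apply/funext => x; rewrite dPhi_exp; ring.
have ir : itg setT (drem z h).
  by rewrite er; apply: itgB => //; exact: itgB.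
have -> : PhiS l1 l2 be (sadd z h) - PhiS l1 l2 be z = Rint setT (drem z h).
  rewrite PhiSE; last exact: H1p_add.
  rewrite PhiSE// er (RintB measurableT (itgB measurableT ib ia) il) e0 subr0.
  by rewrite (RintB measurableT ib ia).
have iA := itg_dA l1 l2 hh.
apply: le_trans (Rint_norm _ ir) _ => //.
rewrite -RintZ//; apply: Rint_le => //; [exact: itg_norm|exact: itgZ|move=> x _].
have [s1 s2] := sup_mA l1_gt0 l2_gt0 x hh.
have le1 (r : R) : r ^+ 2 <= emb l1 l2 * mA l1 l2 h -> `|r| <= 1.
  move=> hr; rewrite -(@ler_pXn2r _ 2)// ?nnegrE// real_normK ?num_real// expr1n.
  exact: le_trans hr hsmall.
have hU : `|su z x| <= K by apply: le_trans (hK1 x) _; rewrite /K; lra.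
have hV : `|sv z x| <= K by apply: le_trans (hK2 x) _; rewrite /K; lra.
have := drem_bound K0 hU hV (le1 _ s1) (le1 _ s2); rewrite -/N => hb.
have a0 := dA_ge0 l1_gt0 l2_gt0 h x.
have b1 : su h x ^+ 2 + sv h x ^+ 2 <= (l1^-1 + l2^-1) * dA l1 l2 h x.
  have g0 := sqr_ge0 (sg h x); have k0 := sqr_ge0 (sk h x).
  have u0 : 0 <= l1 * su h x ^+ 2 by rewrite mulr_ge0 ?sqr_ge0// ltW.
  have v0 : 0 <= l2 * sv h x ^+ 2 by rewrite mulr_ge0 ?sqr_ge0// ltW.
  rewrite mulrDl; apply: lerD.
    by rewrite -ler_pdivrMl ?invr_gt0// invrK /dA; lra.
  by rewrite -ler_pdivrMl ?invr_gt0// invrK /dA; lra.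
rewrite /drem -addrA -opprD.
apply: le_trans (ler_normB _ _) _; rewrite /L [leRHS]mulrDl; apply: lerD.
  by rewrite ger0_norm// mulr_ge0.
apply: le_trans hb _; rewrite -mulrA ler_pM2l//.
Qed.

Lemma sol_critical z : H1p z -> Sol l1 l2 be z -> critical_point l1 l2 be (su z, sv z).
Proof.
move=> hz hs e e0; have [L L0 hL] := sol_expansion hz hs.
have em0 := emb_gt0 l1_gt0 l2_gt0.
(* For a norm n < d, the first bound gives emb n^2 <= 1, as [sol_expansion] requires, and the second
   gives L n^2 <= e n. *)
pose d := Num.min (emb l1 l2 + 1)^-1 (e / L).
have d0 : 0 < d by rewrite lt_min invr_gt0 divr_gt0// andbT; lra.
exists d; split => // h /EE_rep[s hr].
have hrz : rep2 (su z, sv z) z by case: hz => h1 h2; split; exact: rep_refl.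
rewrite (Phi_rep _ _ _ (rep2_add hrz hr)) (Phi_rep _ _ _ hrz).
rewrite (EE_norm_rep _ _ hr).
have A0 := mA_ge0 l1_gt0 l2_gt0 s.
set n := Num.sqrt (mA l1 l2 s).
have n0 : 0 <= n by exact: sqrtr_ge0.
have n2 : n ^+ 2 = mA l1 l2 s by rewrite sqr_sqrtr.
rewrite lt_min => /andP[nd1 nd2].
have n1 : n * (emb l1 l2 + 1) <= 1.
  by rewrite -ler_pdivlMr ?mul1r ?ltW//; lra.
have nL : n * L <= e by rewrite -ler_pdivlMr// ltW.
apply: le_trans (hL _ (rep2_H1p hr) _) _.
- rewrite -n2 expr2 mulrA.
  have h1 : emb l1 l2 * n <= 1 by have := n1; rewrite mulrDr mulr1 mulrC; lra.
  have h2 : n <= 1.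
    have : 0 <= n * emb l1 l2 by rewrite mulr_ge0// ltW.
    by have := n1; rewrite mulrDr mulr1; lra.
  have h3 : 0 <= emb l1 l2 * n by rewrite mulr_ge0// ltW.
  by rewrite -[leRHS]mulr1; apply: ler_pM.
- by rewrite -n2 expr2 mulrA ler_wpM2r// mulrC.
Qed.

End Critical.

(* u and v are the continuous representatives of their classes in W^{1,2}(R),
   so that positivity and evenness are genuinely pointwise. *)
Theorem theorem1 (R : realType) (lambda1 lambda2 : R)
    (hlambda1 : 0 < lambda1) (hlambda2 : 0 < lambda2) :
  exists Lambda : R, 0 < Lambda /\
    forall beta : R, Lambda < beta ->
      exists u v : R -> R,
        [/\ ground_state lambda1 lambda2 beta (u, v),
            continuous u /\ continuous v,
            (forall x : R, 0 < u x) /\ (forall x : R, 0 < v x) &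
            (forall x : R, u (- x) = u x) /\ (forall x : R, v (- x) = v x)].
Proof.
have [Lam [Lam0 hL]] := core hlambda1 hlambda2.
exists Lam; split => // beta hbeta.
have b0 : 0 < beta by exact: lt_trans hbeta.
have [z [hz Sz [ev1 ev2] [up vp] [Az Ez]]] := hL beta hbeta.
case: (hz) => h k.
have hr : rep2 (su z, sv z) z by split; exact: rep_refl.
exists (su z), (sv z); split => //; last by split; [exact: h1_cont h|exact: h1_cont k].
split.
- split.
  + by split; [exact: rep_W12 hr.1|exact: rep_W12 hr.2].
  (* Vanishing almost everywhere would make the integral of u^2 zero, hence the continuous u zero
     everywhere, against u(0) > 0. *)
  + move=> [/= e1 _].
    have /(h1_eq0 h)/(_ 0) : Rint setT (fun x => su z x ^+ 2) <= 0.
      rewrite (@ae_eq_Rint _ _ (fun=> 0)).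
      * by rewrite /Rint (@Rintegral_cst _ _ _ lebesgue_measure)// mul0r.
      * by apply: mbleX; exact: h1_mble h.
      * exact: mble_cst.
      * apply: (@filterS _ _ (ae_filter_ringOfSetsType lebesgue_measure) _ _ _ e1) => x /= e xT.
        by rewrite e// expr0n.
    by move=> u0; have := up 0; rewrite u0 ltxx.
  + exact: sol_critical.
- move=> w' [/EE_rep[s hs] nz cr].
  have P0 := sol_Psi hlambda1 hlambda2 b0 hz Sz.
  have -> : Phi lambda1 lambda2 beta (su z, sv z) = cinf lambda1 lambda2 beta.
    rewrite (Phi_rep _ _ _ hr) -Ez.
    by move: P0; rewrite /Psi /PhiS /En; lra.
  by have := bound_state_level hlambda1 hlambda2 hs nz cr.
Qed.
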